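(* Let $L$ be a countable signature and let $T$ be a countable continuous $\mathcal{L}_{\omega_1\omega}(L)$-theory such that all of its models are (locally compact and) pseudo-connected. Then the equivalence relation $\cong_T$ on $\mathrm{Mod}(T)$, given by $\xi\cong_T\eta\iff M_\xi\cong M_\eta$, is essentially countable.
   Context: Logic. A modulus of continuity is a continuous $\Delta\colon[0,\infty)\to[0,\infty)$ with $\Delta(0)=0$ and $\Delta(r)\le\Delta(r+s)\le\Delta(r)+\Delta(s)$; a map $f$ between metric spaces respects $\Delta$ if $d(f(x),f(x'))\le\Delta(d(x,x'))$. A countable signature $L$ consists of predicate and function symbols (constants are $0$-ary functions), each with an arity and a modulus of continuity, and each predicate symbol also with a compact interval bounding its values; there is a distinguished binary predicate $d$ for the metric. An $L$-structure is a complete metric space $(M,d)$ with interpretations of the symbols respecting arities, moduli and bounds; $M^k$ carries the max metric. Continuous $\mathcal{L}_{\omega_1\omega}(L)$-formulas are real-valued, built from atomic formulas and the constant $1$ using $\phi+\psi$, $r\phi$ ($r\in\mathbb{Q}$), $\max$, $\min$, $\sup_x$, $\inf_x$, and countable suprema and infima of families of formulas in the same finite tuple of free variables respecting a common modulus of continuity and bound. A theory is a set of conditions $\phi=c$ with $\phi$ a sentence and $c\in\mathbb{R}$; $M\models T$ means $\phi^M=c$ for all conditions in $T$. A fragment $\mathcal{F}$ is a countable set of formulas containing all atomic formulas and closed under the finitary connectives, quantifiers, subformulas, and substitution of terms for variables. Space of models. Let $\mathcal F$ be a fragment containing all sentences of $T$ and $\bar x=(x_0,x_1,\dots)$. For a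 tuple $\bar a$ in $M$, $\mathrm{tp}_{\mathcal F}(\bar a)$ is the map $\phi\mapsto\phi^M(\bar a)$ on $\mathcal F$-formulas. $\mathrm{Mod}(T)$ is the set of types $\xi=\mathrm{tp}_{\mathcal F}(\bar a)$ of sequences $\bar a\in M^{\mathbb N}$ in models $M\models T$ such that $(\inf_y\phi(y,\bar x))^\xi=\inf_j\phi(x_j,\bar x)^\xi$ for all $\phi\in\mathcal F$; equivalently, $\overline{\{a_i:i\in\mathbb N\}}$ is an $\mathcal F$-elementary substructure of $M$. This structure is denoted $M_\xi$, a separable model of $T$, well defined up to isomorphism. So $\xi$ codes a separable model of $T$ together with an enumerated dense sequence. The topology of pointwise convergence on $\mathcal F$-formulas makes $\mathrm{Mod}(T)$ a Polish space; the underlying set of codes and its standard Borel structure do not depend on $\mathcal F$. Pseudo-connectedness. For a locally compact metric space $(Z,d)$ and $z\in Z$ let $\rho(z)=\sup\{r\in\mathbb R:\overline{B_r(z)}\text{ is compact}\}$, where $B_r(z)$ is the open ball. The pseudo-component of $z_0\in Z$ is $C[z_0]=\{z\in Z:\exists z_1,\dots,z_n\ \forall i=0,\dots,n-1\ d(z_i,z_{i+1})<\rho(z_i)\text{ and }z_n=z\}$. $Z$ is pseudo-connected if it has only one pseudo-component; a structure is pseudo-connected if its underlying metric space is. An equivalence relation is essentially countable if it is Borel reducible to a Borel equivalence relation with countable classes on a standard Borel space. *)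

(* Defs.v *)
From mathcomp Require Import all_boot all_order all_algebra.
From mathcomp Require Import all_classical all_reals all_analysis.
From Stdlib Require Import RelationClasses.

Set Implicit Arguments.
Unset Strict Implicit.
Unset Printing Implicit Defensive.

Import Order.TTheory GRing.Theory Num.Theory.
Import numFieldNormedType.Exports.

Local Open Scope classical_set_scope.
Local Open Scope ring_scope.

(** * Moduli of continuity, signatures, structures *)

(* The modulus is a map [0, +oo) -> [0, +oo); its values at negative reals are
   irrelevant. *)
Definition is_modulus (R : realType) (D : R -> R) : Prop :=
  [/\ {within [set r : R | 0 <= r], continuous D},
      D 0 = 0,
      (forall r, 0 <= r -> 0 <= D r) &
      forall r s, 0 <= r -> 0 <= s -> D r <= D (r + s) /\ D (r + s) <= D r + D s].

Record signature (R : realType) := Signature {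
  psymb : countType;
  fsymb : countType;
  parity : psymb -> nat;
  farity : fsymb -> nat;
  pmodulus : psymb -> R -> R;
  fmodulus : fsymb -> R -> R;
  pmodulusP : forall P, is_modulus (pmodulus P);
  fmodulusP : forall f, is_modulus (fmodulus f);
  plower : psymb -> R;
  pupper : psymb -> R;
  pboundP : forall P, plower P <= pupper P;
  dsymb : psymb;
  dsymb_arity : parity dsymb = 2%N
}.

Definition complete_metric (R : realType) (M : metricType R) : Prop :=
  forall F : set_system M, ProperFilter F -> cauchy F -> exists x : M, F --> x.

Definition max_dist (R : realType) (M : metricType R) (k : nat)
    (a b : 'I_k -> M) : R :=
  \big[Num.max/0]_(i < k) mdist (a i) (b i).

Record structure (R : realType) (L : signature R) := Structure {
  carrier :> metricType R;
  carrier_nonempty : exists x : carrier, True;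
  carrier_complete : complete_metric carrier;
  pinterp : forall P : psymb L, ('I_(parity P) -> carrier) -> R;
  finterp : forall f : fsymb L, ('I_(farity f) -> carrier) -> carrier;
  pinterp_modulus : forall P (a b : 'I_(parity P) -> carrier),
    `|pinterp a - pinterp b| <= pmodulus P (max_dist a b);
  finterp_modulus : forall f (a b : 'I_(farity f) -> carrier),
    mdist (finterp a) (finterp b) <= fmodulus f (max_dist a b);
  pinterp_bound : forall P (a : 'I_(parity P) -> carrier),
    plower P <= pinterp a <= pupper P;
  pinterp_dist : forall x y : carrier,
    pinterp (fun i : 'I_(parity (dsymb L)) => if val i == 0%N then x else y)
    = mdist x y
}.

Definition embedding (R : realType) (L : signature R) (M N : structure L)
    (e : M -> N) : Prop :=
  (forall f (a : 'I_(farity f) -> M), e (finterp a) = finterp (e \o a)) /\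
  (forall P (a : 'I_(parity P) -> M), pinterp (e \o a) = pinterp a).

Definition isomorphic (R : realType) (L : signature R) (M N : structure L) :
    Prop :=
  exists2 e : M -> N, embedding e & bijective e.

(** * Infinitary continuous formulas *)

(* Variables are de Bruijn indices: free, [Var i] is x_i; [FSup] and [FInf] bind
   index 0 and shift the others, so that [FInf phi] is inf_y phi(y, x_0, x_1, ...). *)
Inductive term (R : realType) (L : signature R) : Type :=
| Var of nat
| App (f : fsymb L) of ('I_(farity f) -> term L).

Inductive preformula (R : realType) (L : signature R) : Type :=
| FAtom (P : psymb L) of ('I_(parity P) -> term L)
| FOne
| FAdd of preformula L & preformula L
| FScale of rat & preformula L
| FMax of preformula L & preformula L
| FMin of preformula L & preformula L
| FSup of preformula L
| FInf of preformula L
| FCSup of (nat -> preformula L)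
| FCInf of (nat -> preformula L).

Arguments Var {R L} _.
Arguments FOne {R L}.

Definition scons (A : Type) (x : A) (a : nat -> A) (n : nat) : A :=
  if n is m.+1 then a m else x.

Fixpoint teval (R : realType) (L : signature R) (M : structure L)
    (a : nat -> M) (t : term L) : M :=
  match t with
  | Var n => a n
  | App _ ts => finterp (fun i => teval a (ts i))
  end.

Fixpoint feval (R : realType) (L : signature R) (M : structure L)
    (a : nat -> M) (phi : preformula L) : R :=
  match phi with
  | FAtom _ ts => pinterp (fun i => teval a (ts i))
  | FOne => 1
  | FAdd p q => feval a p + feval a q
  | FScale r p => ratr r * feval a p
  | FMax p q => Num.max (feval a p) (feval a q)
  | FMin p q => Num.min (feval a p) (feval a q)
  | FSup p => sup (range (fun x : M => feval (scons x a) p))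
  | FInf p => inf (range (fun x : M => feval (scons x a) p))
  | FCSup ps => sup (range (fun n => feval a (ps n)))
  | FCInf ps => inf (range (fun n => feval a (ps n)))
  end.

(* All free variables are among x_0, ..., x_{k-1}. *)
Fixpoint tscoped (R : realType) (L : signature R) (k : nat) (t : term L) :
    Prop :=
  match t with
  | Var n => (n < k)%N
  | App _ ts => forall i, tscoped k (ts i)
  end.

Fixpoint scoped (R : realType) (L : signature R) (k : nat)
    (phi : preformula L) : Prop :=
  match phi with
  | FAtom _ ts => forall i, tscoped k (ts i)
  | FOne => True
  | FScale _ p => scoped k p
  | FAdd p q | FMax p q | FMin p q => scoped k p /\ scoped k q
  | FSup p | FInf p => scoped k.+1 p
  | FCSup ps | FCInf ps => forall n, scoped k (ps n)
  end.

(* In every structure, phi(x_0, ..., x_{k-1}) respects the modulus D on M^k and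
   takes its values in [lo, hi]. *)
Definition respects (R : realType) (L : signature R) (k : nat) (D : R -> R)
    (lo hi : R) (phi : preformula L) : Prop :=
  forall (M : structure L) (a b : nat -> M),
    `|feval a phi - feval b phi|
      <= D (max_dist (fun i : 'I_k => a i) (fun i : 'I_k => b i)) /\
    lo <= feval a phi <= hi.

Definition uniform_family (R : realType) (L : signature R)
    (ps : nat -> preformula L) : Prop :=
  exists (k : nat) (D : R -> R) (lo hi : R),
    is_modulus D /\
    forall n, scoped k (ps n) /\ respects k D lo hi (ps n).

(* The L_{omega_1 omega}(L)-formulas: those preformulas in which countable
   suprema and infima are only taken over families as above. *)
Fixpoint is_formula (R : realType) (L : signature R) (phi : preformula L) :
    Prop :=
  match phi with
  | FAtom _ _ | FOne => True
  | FAdd p q | FMax p q | FMin p q => is_formula p /\ is_formula q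
  | FScale _ p | FSup p | FInf p => is_formula p
  | FCSup ps | FCInf ps => (forall n, is_formula (ps n)) /\ uniform_family ps
  end.

Definition is_sentence (R : realType) (L : signature R) (phi : preformula L) :
    Prop :=
  is_formula phi /\ scoped 0 phi.

Fixpoint tsubst (R : realType) (L : signature R) (s : nat -> term L)
    (t : term L) : term L :=
  match t with
  | Var n => s n
  | App _ ts => App (fun i => tsubst s (ts i))
  end.

Definition lift_subst (R : realType) (L : signature R) (s : nat -> term L) :
    nat -> term L :=
  scons (Var 0) (fun n => tsubst (fun m => Var m.+1) (s n)).

Fixpoint fsubst (R : realType) (L : signature R) (s : nat -> term L)
    (phi : preformula L) : preformula L :=
  match phi with
  | FAtom _ ts => FAtom (fun i => tsubst s (ts i))
  | FOne => FOne
  | FAdd p q => FAdd (fsubst s p) (fsubst s q)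
  | FScale r p => FScale r (fsubst s p)
  | FMax p q => FMax (fsubst s p) (fsubst s q)
  | FMin p q => FMin (fsubst s p) (fsubst s q)
  | FSup p => FSup (fsubst (lift_subst s) p)
  | FInf p => FInf (fsubst (lift_subst s) p)
  | FCSup ps => FCSup (fun n => fsubst s (ps n))
  | FCInf ps => FCInf (fun n => fsubst s (ps n))
  end.

Definition immediate_subformulas (R : realType) (L : signature R)
    (phi : preformula L) : set (preformula L) :=
  match phi with
  | FAtom _ _ | FOne => set0
  | FAdd p q | FMax p q | FMin p q => [set p; q]
  | FScale _ p | FSup p | FInf p => [set p]
  | FCSup ps | FCInf ps => range ps
  end.

Record fragment (R : realType) (L : signature R) := Fragment {
  frag_set : set (preformula L);
  frag_countable : countable frag_set;
  frag_formula : forall p, frag_set p -> is_formula p;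
  frag_atom : forall (P : psymb L) (ts : 'I_(parity P) -> term L),
    frag_set (FAtom ts);
  frag_one : frag_set FOne;
  frag_add : forall p q, frag_set p -> frag_set q -> frag_set (FAdd p q);
  frag_scale : forall r p, frag_set p -> frag_set (FScale r p);
  frag_max : forall p q, frag_set p -> frag_set q -> frag_set (FMax p q);
  frag_min : forall p q, frag_set p -> frag_set q -> frag_set (FMin p q);
  frag_sup : forall p, frag_set p -> frag_set (FSup p);
  frag_inf : forall p, frag_set p -> frag_set (FInf p);
  frag_sub : forall p, frag_set p -> immediate_subformulas p `<=` frag_set;
  frag_subst : forall s p, frag_set p -> frag_set (fsubst s p)
}.

(** * Theories and the space of models *)

(* A pair (phi, c) stands for the condition phi = c. *)
Definition is_theory (R : realType) (L : signature R)
    (T : set (preformula L * R)) : Prop :=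
  forall p, T p -> is_sentence p.1.

Definition models (R : realType) (L : signature R) (M : structure L)
    (T : set (preformula L * R)) : Prop :=
  forall p, T p -> forall a : nat -> M, feval a p.1 = p.2.

Definition frag_type (R : realType) (L : signature R) (F : fragment L) : Type :=
  {phi : preformula L | frag_set F phi}.

Definition inf_in (R : realType) (L : signature R) (F : fragment L)
    (phi : frag_type F) : frag_type F :=
  exist _ (FInf (sval phi)) (frag_inf (svalP phi)).

(* phi(y, x_0, x_1, ...) |-> phi(x_j, x_0, x_1, ...) *)
Definition inst_in (R : realType) (L : signature R) (F : fragment L) (j : nat)
    (phi : frag_type F) : frag_type F :=
  exist _ (fsubst (scons (Var j) Var) (sval phi))
    (frag_subst (scons (Var j) Var) (svalP phi)).

Definition tp (R : realType) (L : signature R) (F : fragment L)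
    (M : structure L) (a : nat -> M) : {ptws frag_type F -> R} :=
  fun phi => feval a (sval phi).
Arguments tp {R L} F {M} a.

Definition Mod (R : realType) (L : signature R) (T : set (preformula L * R))
    (F : fragment L) : set {ptws frag_type F -> R} :=
  [set xi : {ptws frag_type F -> R} |
            (exists (M : structure L) (a : nat -> M),
               models M T /\ xi = tp F a) /\
            forall phi : frag_type F,
              xi (inf_in phi) = inf (range (fun j => xi (inst_in j phi)))].
Arguments Mod {R L} T F.

(* N is (a copy of) M_xi: the substructure with universe the closure of
   {a_i : i in nat}, where a realizes xi in a model of T. *)
Definition coded_structure (R : realType) (L : signature R)
    (T : set (preformula L * R)) (F : fragment L)
    (xi : {ptws frag_type F -> R}) (N : structure L) : Prop :=
  exists (M : structure L) (a : nat -> M) (e : N -> M),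
    [/\ models M T, xi = tp F a, embedding e & range e = closure (range a)].

(* Mod(T) with the topology induced by that of pointwise convergence. *)
Definition Mod_space (R : realType) (L : signature R)
    (T : set (preformula L * R)) (F : fragment L) : topologicalType :=
  set_type (Mod T F).

Definition iso_rel (R : realType) (L : signature R)
    (T : set (preformula L * R)) (F : fragment L) (xi eta : Mod_space T F) :
    Prop :=
  exists M N : structure L,
    [/\ coded_structure T (set_val xi) M, coded_structure T (set_val eta) N &
        isomorphic M N].
Arguments iso_rel {R L} T F.

(** * Pseudo-connectedness *)

Definition pc_radius (R : realType) (Z : metricType R) (z : Z) : \bar R :=
  ereal_sup [set r%:E | r in [set r : R | compact (closure (ball z r))]].

Definition pseudo_component (R : realType) (Z : metricType R) (z0 : Z) :
    set Z :=
  [set z | exists (n : nat) (s : nat -> Z),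
     [/\ s 0%N = z0,
         (forall i, (i < n)%N ->
            ((mdist (s i) (s i.+1))%:E < pc_radius (s i))%E) &
         s n = z]].

Definition pseudo_connected (R : realType) (Z : metricType R) : Prop :=
  locally_compact [set: Z] /\
  forall z w : Z, pseudo_component z = pseudo_component w.

(** * Essentially countable equivalence relations *)

Definition Borel (X : topologicalType) : set (set X) := <<s [set A : set X | open A] >>.

Definition standard_Borel (R : realType) (d : measure_display)
    (Y : measurableType d) : Prop :=
  exists (P : metricType R) (h : Y -> P),
    [/\ complete_metric P,
        (exists2 D : set P, countable D & dense D),
        bijective h &
        forall A : set Y, measurable A <-> Borel (h @` A)].

Definition essentially_countable (R : realType) (X : topologicalType)
    (E : X -> X -> Prop) : Prop :=
  exists (d : measure_display) (Y : measurableType d) (E' : set (Y * Y))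
      (f : X -> Y),
    [/\ @standard_Borel R d Y,
        [/\ measurable E', Equivalence (fun y z => E' (y, z)) &
            forall y, countable [set z | E' (y, z)]],
        (forall B : set Y, measurable B -> Borel (f @^-1` B)) &
        forall x x', E x x' <-> E' (f x, f x')].

(* Main.v *)
Require Import Defs.
From HB Require Import structures.
From mathcomp Require Import all_boot all_order all_algebra.
From mathcomp Require Import all_classical all_reals all_analysis.
From mathcomp Require Import measurable_realfun lra.
From Stdlib Require Import RelationClasses.

(** Call two pointed models equivalent if some isomorphism carries one base point to the
    other. For a pseudo-connected model the conditions "some finite tuple, reachable
    from the base point along chains of steps inside compact balls, satisfies
    [phi > q]" decide this equivalence: by compactness an ultralimit of approximate
    witnesses is an exact one, so pointed models with the same such conditions embed
    into each other, and an isometric self-map with a fixed point is onto because it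
    is recurrent on every set of reachable points.

    Compactness also separates [a] from the points of its ball lying at orbit distance
    at least [r / 4] by finitely many conditions [U]. The points where [(U, r)] does
    this form an open set, invariant under automorphisms, on which "orbit distance at
    most [r]" is an equivalence relation with countably many classes, the clusters.
    The conditions met in a cluster determine the cluster and the model, and each
    cluster is isolated by finitely many of them among the clusters of its kind within
    reach of a given one. Hence a cluster of [M] yields a canonical enumeration of all
    clusters of [M]; its code, a real number, depends only on [M] and the chosen
    cluster, so that [M] has only countably many codes, and each of them computes the
    others in a Borel way. All the properties involved can be tested on a dense
    sequence, so that everything is Borel on the space of models. *)

Set Implicit Arguments.
Unset Strict Implicit.
Unset Printing Implicit Defensive.

Import Order.TTheory GRing.Theory Num.Theory.
Import numFieldNormedType.Exports.

Local Open Scope classical_set_scope.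
Local Open Scope ring_scope.

(** * Uniform continuity and substitution *)

(** The type of a point is already a complete invariant of its pointed model, but a model may
    realize uncountably many types; passing to clusters, which are open, leaves countably many.
    Orbit distance at most [r] is not transitive in general: the jump from [r] to [r / 4] in the
    definition of a core is there so that [r / 4 + r / 4] falls back below [r]. Chains carry a
    margin because bare strict inequalities are lost in limits. A fixed margin survives ultralimits,
    and asking only for [1 / n.+1] from chains indexed by [n] still reaches every point, since a
    chain may wait at its start. Conditions of both polarities leave a rational gap; this makes them
    open in the point, hence testable on a dense sequence. An isometric self-map could a priori
    shrink the radii [rad] and so leave the sets of reachable points; recurrence has to exclude this
    as well. Finally, enumerating clusters along the dense sequence is not invariant under
    isomorphism, so one cluster must name all the others through finitely many bits. *)

Lemma itv_norm_le (R : realType) (lo hi y : R) : lo <= y <= hi -> `|y| <= `|lo| + `|hi|.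
Proof.
move=> /andP[? ?]; rewrite ler_norml.
have := ler_norm (- lo); have := ler_norm hi; rewrite normrN => ? ?.
by have := normr_ge0 lo; have := normr_ge0 hi => *; apply/andP; split; lra.
Qed.

(** * Suprema and infima of bounded families under small perturbations *)

Section real_bounds.
Context {R : realType} {I : Type}.
Implicit Types f g : I -> R.

Lemma range_has_sup f (B : R) : (exists i : I, True) ->
  (forall i, `|f i| <= B) -> has_sup (range f).
Proof.
move=> [i0 _] fB; split; first by exists (f i0), i0.
by exists B => _ [i _ <-]; rewrite (le_trans (ler_norm _)).
Qed.

Lemma range_has_inf f (B : R) : (exists i : I, True) ->
  (forall i, `|f i| <= B) -> has_inf (range f).
Proof.
move=> [i0 _] fB; split; first by exists (f i0), i0.
exists (- B) => _ [i _ <-]; have := fB i; rewrite ler_norml => /andP[] //.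
Qed.

Lemma sup_range_norm_le f (B : R) : (exists i : I, True) ->
  (forall i, `|f i| <= B) -> `|sup (range f)| <= B.
Proof.
move=> I0 fB; have hs := range_has_sup I0 fB; rewrite ler_norml.
case: I0 => i0 _; have := fB i0; rewrite ler_norml => /andP[h1 h2].
apply/andP; split.
  by apply: (le_trans h1); apply: ub_le_sup; [case: hs|exists i0].
apply: ge_sup; [by case: hs|].
by move=> _ [i _ <-]; rewrite (le_trans (ler_norm _)).
Qed.

Lemma inf_range_norm_le f (B : R) : (exists i : I, True) ->
  (forall i, `|f i| <= B) -> `|inf (range f)| <= B.
Proof.
move=> I0 fB; rewrite /inf normrN.
have -> : -%R @` range f = range (fun i => - f i).
  by apply/seteqP; split => [_ [_ [i _ <-] <-]|_ [i _ <-]]; [exists i|exists (f i) => //; exists i].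
by apply: sup_range_norm_le => // i; rewrite normrN.
Qed.

Lemma sup_range_dist_le f g (B e : R) : (exists i : I, True) ->
  (forall i, `|f i| <= B) -> (forall i, `|g i| <= B) ->
  (forall i, `|f i - g i| <= e) -> `|sup (range f) - sup (range g)| <= e.
Proof.
move=> I0 fB gB fg.
have hf := range_has_sup I0 fB; have hg := range_has_sup I0 gB.
rewrite ler_distl; apply/andP; split.
  rewrite lerBlDr; apply: ge_sup; first by case: hg.
  move=> _ [i _ <-]; have := fg i; rewrite ler_distl => /andP[h _].
  have h2 : f i <= sup (range f) by apply: ub_le_sup; [case: hf|exists i].
  lra.
apply: ge_sup; first by case: hf.
move=> _ [i _ <-]; have := fg i; rewrite ler_distl => /andP[_ h].
have h2 : g i <= sup (range g) by apply: ub_le_sup; [case: hg|exists i].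
lra.
Qed.

Lemma inf_range_dist_le f g (B e : R) : (exists i : I, True) ->
  (forall i, `|f i| <= B) -> (forall i, `|g i| <= B) ->
  (forall i, `|f i - g i| <= e) -> `|inf (range f) - inf (range g)| <= e.
Proof.
move=> I0 fB gB fg.
have opp_range h : -%R @` range h = range (fun i : I => - h i : R).
  by apply/seteqP; split => [_ [_ [i _ <-] <-]|_ [i _ <-]]; [exists i|exists (h i) => //; exists i].
rewrite /inf !opp_range -opprD normrN.
apply: (sup_range_dist_le (B := B)) => // i; rewrite ?normrN//.
by rewrite -opprD normrN.
Qed.

End real_bounds.

Section logic.
Context {R : realType} {L : signature R}.
Implicit Types (M N : structure L) (t : term L) (p q : preformula L).

Lemma modulus_small (D : R -> R) : is_modulus D -> forall e, 0 < e ->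
  exists2 d, 0 < d & forall r, 0 <= r -> r < d -> D r < e.
Proof.
move=> [cD D0 _ _] e e0.
have A0 : [set r : R | 0 <= r] 0 by exact: lexx.
have cD0 := (subspace_continuousP _ _).1 cD 0 A0.
have FF : Filter (within [set r : R | 0 <= r] (nbhs 0)) by exact: within_filter.
have := (cvgrPdist_lt _ _).1 cD0 _ e0 => /(_ FF).
rewrite /from_subspace D0 near_withinE => /nbhs_ballP[d /= d0 H].
exists d => // r r0 rd; have := H r; rewrite /ball /= sub0r normrN ger0_norm//.
by move=> /(_ rd r0); rewrite sub0r normrN; apply: le_lt_trans (ler_norm _).
Qed.

Lemma max_dist_lt (M : metricType R) k (a b : 'I_k -> M) e : 0 < e ->
  (forall i, mdist (a i) (b i) < e) -> max_dist a b < e.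
Proof. by move=> e0 H; rewrite /max_dist; elim/big_ind: _ => // x y; rewrite gt_max => -> ->. Qed.

Lemma max_dist_ge0 (M : metricType R) k (a b : 'I_k -> M) : 0 <= max_dist a b.
Proof.
rewrite /max_dist; elim/big_ind: _ => // [x y x0 y0|i _]; last exact: mdist_ge0.
by rewrite le_max x0.
Qed.

(** The modulus is chosen before the structure, so that it can serve in two models at once; [k]
    bounds the coordinates that matter. *)
Definition term_uc t := exists k, forall e : R, 0 < e ->
  exists2 d : R, 0 < d & forall M (a b : nat -> M),
    (forall i, (i < k)%N -> mdist (a i) (b i) < d) ->
    mdist (teval a t) (teval b t) < e.

Lemma term_fun_uc n (ts : 'I_n -> term L) : (forall i, term_uc (ts i)) ->
  exists k, forall e : R, 0 < e -> exists2 d : R, 0 < d &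
    forall M (a b : nat -> M),
      (forall i, (i < k)%N -> mdist (a i) (b i) < d) ->
      max_dist (fun i => teval a (ts i)) (fun i => teval b (ts i)) < e.
Proof.
move=> H; have [k Hk] := choice H.
exists (\max_(i < n) k i)%N => e e0.
have {Hk} /choice[d Hd] : forall i, exists d : R, 0 < d /\ forall M (a b : nat -> M),
    (forall j, (j < k i)%N -> mdist (a j) (b j) < d) ->
    mdist (teval a (ts i)) (teval b (ts i)) < e.
  by move=> i; have [d d0 Hd] := Hk i e e0; exists d.
exists (\big[Num.min/1]_(i < n) d i).
  by elim/big_ind: _ => // [x y x0 y0|i _]; [rewrite lt_min x0|case: (Hd i)].
move=> M a b ab; apply: max_dist_lt => // i.
apply: (Hd i).2 => j jk; apply: lt_le_trans (_ : \big[Num.min/1]_(i < n) d i <= d i).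
  by apply: ab; apply: leq_trans jk _; apply: leq_bigmax.
exact: bigmin_le_cond.
Qed.

Lemma term_ucP t : term_uc t.
Proof.
elim: t => [n|f ts IH].
  by exists n.+1 => e e0; exists e => // M a b /(_ n (ltnSn n)).
have [k Hk] := term_fun_uc IH; exists k => e e0.
have [d d0 Hd] := modulus_small (fmodulusP f) e0.
have [d' d'0 Hd'] := Hk _ d0; exists d' => // M a b ab /=.
apply: le_lt_trans (finterp_modulus _ _) _; apply: Hd; first exact: max_dist_ge0.
exact: Hd'.
Qed.

(** The final bound is non-strict because strict bounds do not pass to suprema and infima. *)
Definition formula_uc p := exists k, forall e : R, 0 < e ->
  exists2 d : R, 0 < d & forall M (a b : nat -> M),
    (forall i, (i < k)%N -> mdist (a i) (b i) < d) ->
    `|feval a p - feval b p| <= e.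

Definition formula_bounded p :=
  exists B : R, forall M (a : nat -> M), `|feval a p| <= B.

Lemma mdist_scons M (x : M) (a b : nat -> M) k d : 0 < d ->
  (forall i, (i < k)%N -> mdist (a i) (b i) < d) ->
  forall i, (i < k)%N -> mdist (scons x a i) (scons x b i) < d.
Proof. by move=> d0 H [_|i ik] /=; rewrite ?mdistxx//; apply: H; apply: ltnW. Qed.

Lemma formula_boundedP p : is_formula p -> formula_bounded p.
Proof.
elim: p => [P ts _||p IHp q IHq /= [/IHp[B HB] /IHq[C HC]]|r p IHp /= /IHp[B HB]
  |p IHp q IHq /= [/IHp[B HB] /IHq[C HC]]|p IHp q IHq /= [/IHp[B HB] /IHq[C HC]]
  |p IHp /= /IHp[B HB]|p IHp /= /IHp[B HB]|ps IH /=|ps IH /=].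
- exists (`|plower P| + `|pupper P|) => M a /=.
  exact/itv_norm_le/pinterp_bound.
- by exists 1 => M a; rewrite /= normr1.
- exists (B + C) => M a /=; apply: le_trans (ler_normD _ _) _.
  by rewrite lerD.
- by exists (`|ratr r| * B) => M a /=; rewrite normrM ler_wpM2l.
- exists (Num.max B C) => M a /=; rewrite le_max.
  by have [_|_] := leP (feval a p) (feval a q); rewrite ?HB ?HC ?orbT.
- exists (Num.max B C) => M a /=; rewrite le_max.
  by have [_|_] := leP (feval a p) (feval a q); rewrite ?HB ?HC ?orbT.
- exists B => M a /=; apply: sup_range_norm_le => //; exact: carrier_nonempty.
- exists B => M a /=; apply: inf_range_norm_le => //; exact: carrier_nonempty.
- move=> [_ [k [D [lo [hi [_ H]]]]]].
  exists (`|lo| + `|hi|) => M a /=; apply: sup_range_norm_le; first by exists 0%N.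
  by move=> n; have [_ /itv_norm_le] := (H n).2 M a a.
- move=> [_ [k [D [lo [hi [_ H]]]]]].
  exists (`|lo| + `|hi|) => M a /=; apply: inf_range_norm_le; first by exists 0%N.
  by move=> n; have [_ /itv_norm_le] := (H n).2 M a a.
Qed.

Lemma formula_uc2 p q : formula_uc p -> formula_uc q ->
  exists k, forall e : R, 0 < e -> exists2 d : R, 0 < d &
    forall M (a b : nat -> M),
    (forall i, (i < k)%N -> mdist (a i) (b i) < d) ->
    `|feval a p - feval b p| <= e /\ `|feval a q - feval b q| <= e.
Proof.
move=> [k Hk] [l Hl]; exists (maxn k l) => e e0.
have [d d0 Hd] := Hk _ e0; have [d' d'0 Hd'] := Hl _ e0.
exists (Num.min d d'); first by rewrite lt_min d0.
move=> M a b ab; split; [apply: Hd|apply: Hd'] => i ik.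
  have /ab : (i < maxn k l)%N by rewrite leq_max ik.
  by rewrite lt_min => /andP[].
have /ab : (i < maxn k l)%N by rewrite leq_max ik orbT.
by rewrite lt_min => /andP[].
Qed.

Lemma maxr_dist (x y x' y' e : R) : `|x - x'| <= e -> `|y - y'| <= e ->
  `|Num.max x y - Num.max x' y'| <= e.
Proof.
by rewrite !ler_norml => /andP[? ?] /andP[? ?]; apply/andP; case: (leP x y); case: (leP x' y') => *; split; lra.
Qed.

Lemma minr_dist (x y x' y' e : R) : `|x - x'| <= e -> `|y - y'| <= e ->
  `|Num.min x y - Num.min x' y'| <= e.
Proof.
by rewrite !ler_norml => /andP[? ?] /andP[? ?]; apply/andP; case: (leP x y); case: (leP x' y') => *; split; lra.
Qed.

Lemma uniform_family_uc (ps : nat -> preformula L) : uniform_family ps ->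
  exists k, forall e : R, 0 < e -> exists2 d : R, 0 < d &
    forall M (a b : nat -> M),
    (forall i, (i < k)%N -> mdist (a i) (b i) < d) ->
    forall n, `|feval a (ps n) - feval b (ps n)| <= e.
Proof.
move=> [k [D [lo [hi [mD H]]]]]; exists k => e e0.
have [d d0 Hd] := modulus_small mD e0; exists d => // M a b ab n.
have [h _] := (H n).2 M a b; apply: (le_trans h); apply/ltW/Hd.
  exact: max_dist_ge0.
by apply: max_dist_lt => // i; apply: ab.
Qed.

(** For countable suprema and infima the induction hypothesis yields no modulus common to all
    members; the one provided by [uniform_family] is used instead. *)
Lemma formula_ucP p : is_formula p -> formula_uc p.
Proof.
move=> fp; have := formula_boundedP fp; move: fp.
elim: p => [P ts _||p IHp q IHq /= [fp fq]|r p IHp /= fp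
  |p IHp q IHq /= [fp fq]|p IHp q IHq /= [fp fq]
  |p IHp /= fp|p IHp /= fp|ps IH /=|ps IH /=] HB.
- have [k Hk] := term_fun_uc (fun i => term_ucP (ts i)); exists k => e e0.
  have [d d0 Hd] := modulus_small (pmodulusP P) e0.
  have [d' d'0 Hd'] := Hk _ d0; exists d' => // M a b ab /=.
  apply: le_trans (pinterp_modulus _ _) _; apply/ltW/Hd; first exact: max_dist_ge0.
  exact: Hd'.
- by move=> _; exists 0%N => e e0; exists 1 => // M a b _ /=; rewrite subrr normr0 ltW.
- have [k Hk] := formula_uc2 (IHp fp (formula_boundedP fp)) (IHq fq (formula_boundedP fq)).
  exists k => e e0; have [d d0 Hd] := Hk (e / 2) ltac:(lra).
  exists d => // M a b /Hd[h1 h2] /=; rewrite opprD addrACA.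
  by apply: le_trans (ler_normD _ _) _; lra.
- have [k Hk] := IHp fp (formula_boundedP fp); exists k => e e0.
  have r0 : 0 < `|ratr r : R| + 1 by have := normr_ge0 (ratr r : R); lra.
  have [d d0 Hd] := Hk (e / (`|ratr r| + 1)) (divr_gt0 e0 r0).
  exists d => // M a b /Hd h /=; rewrite -mulrBr normrM.
  apply: le_trans (ler_wpM2l (normr_ge0 _) h) _.
  rewrite mulrA ler_pdivrMr// mulrC ler_wpM2l//; [exact: ltW|lra].
- have [k Hk] := formula_uc2 (IHp fp (formula_boundedP fp)) (IHq fq (formula_boundedP fq)).
  exists k => e e0; have [d d0 Hd] := Hk _ e0.
  by exists d => // M a b /Hd[h1 h2] /=; apply: maxr_dist.
- have [k Hk] := formula_uc2 (IHp fp (formula_boundedP fp)) (IHq fq (formula_boundedP fq)).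
  exists k => e e0; have [d d0 Hd] := Hk _ e0.
  by exists d => // M a b /Hd[h1 h2] /=; apply: minr_dist.
- have [B {}HB] := formula_boundedP fp; have [k Hk] := IHp fp (formula_boundedP fp).
  exists k => e e0; have [d d0 Hd] := Hk _ e0.
  exists d => // M a b ab /=; apply: (sup_range_dist_le (B := B)) => //.
    exact: carrier_nonempty.
  by move=> x; apply: Hd; apply: mdist_scons.
- have [B {}HB] := formula_boundedP fp; have [k Hk] := IHp fp (formula_boundedP fp).
  exists k => e e0; have [d d0 Hd] := Hk _ e0.
  exists d => // M a b ab /=; apply: (inf_range_dist_le (B := B)) => //.
    exact: carrier_nonempty.
  by move=> x; apply: Hd; apply: mdist_scons.
- case: HB => _ uf _; have [k Hk] := uniform_family_uc uf; case: uf => [l0 [D0 [lo [hi [_ H]]]]].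
  exists k => e e0; have [d d0 Hd] := Hk _ e0.
  exists d => // M a b ab /=; apply: (sup_range_dist_le (B := `|lo| + `|hi|)).
  + by exists 0%N.
  + by move=> n; have [_ /itv_norm_le] := (H n).2 M a a.
  + by move=> n; have [_ /itv_norm_le] := (H n).2 M b b.
  + exact: Hd.
- case: HB => _ uf _; have [k Hk] := uniform_family_uc uf; case: uf => [l0 [D0 [lo [hi [_ H]]]]].
  exists k => e e0; have [d d0 Hd] := Hk _ e0.
  exists d => // M a b ab /=; apply: (inf_range_dist_le (B := `|lo| + `|hi|)).
  + by exists 0%N.
  + by move=> n; have [_ /itv_norm_le] := (H n).2 M a a.
  + by move=> n; have [_ /itv_norm_le] := (H n).2 M b b.
  + exact: Hd.
Qed.

Lemma teval_subst M (a : nat -> M) s t :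
  teval a (tsubst s t) = teval (fun n => teval a (s n)) t.
Proof. by elim: t => //= f ts IH; congr finterp; apply/funext => i; rewrite IH. Qed.

Lemma feval_subst M (a : nat -> M) s p :
  feval a (fsubst s p) = feval (fun n => teval a (s n)) p.
Proof.
have lift (x : M) b (r : nat -> term L) :
    (fun n => teval (scons x b) (lift_subst r n)) = scons x (fun n => teval b (r n)).
  by apply/funext => -[|n] //=; rewrite teval_subst.
elim: p a s => //= [P ts|p IHp q IHq|r p IHp|p IHp q IHq|p IHp q IHq|p IHp|p IHp|ps IH|ps IH] a s;
  rewrite ?IHp ?IHq//.
- by congr pinterp; apply/funext => i; rewrite teval_subst.
- by congr (sup _); congr image; apply/funext => x; rewrite IHp lift.
- by congr (inf _); congr image; apply/funext => x; rewrite IHp lift.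
- by congr (sup _); congr image; apply/funext => n; rewrite IH.
- by congr (inf _); congr image; apply/funext => n; rewrite IH.
Qed.

Lemma teval_embedding M N (e : M -> N) : embedding e ->
  forall (a : nat -> M) t, teval (e \o a) t = e (teval a t).
Proof.
move=> [ef _] a; elim => //= f ts IH; rewrite ef; congr finterp.
by apply/funext => i /=; rewrite IH.
Qed.

Lemma feval_iso M N (e : M -> N) : embedding e -> (forall y, exists x, e x = y) ->
  forall p (a : nat -> M), feval (e \o a) p = feval a p.
Proof.
move=> ee es.
have ec x (b : nat -> M) : scons (e x) (e \o b) = e \o scons x b.
  by apply/funext => -[|n].
elim => //= [P ts|p IHp q IHq|r p IHp|p IHp q IHq|p IHp q IHq|p IHp|p IHp|ps IH|ps IH] a;
  rewrite ?IHp ?IHq//.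
- rewrite -ee.2; congr pinterp; apply/funext => i /=; exact: teval_embedding.
- congr (sup _); apply/seteqP; split => _ [x _ <-].
    by have [y <-] := es x; rewrite ec IHp; exists y.
  by exists (e x) => //; rewrite ec IHp.
- congr (inf _); apply/seteqP; split => _ [x _ <-].
    by have [y <-] := es x; rewrite ec IHp; exists y.
  by exists (e x) => //; rewrite ec IHp.
- by congr (sup _); congr image; apply/funext => n; rewrite IH.
- by congr (inf _); congr image; apply/funext => n; rewrite IH.
Qed.

Definition fdist (t u : term L) : preformula L :=
  FAtom (P := dsymb L) (fun i => if val i == 0%N then t else u).

Lemma feval_fdist M (a : nat -> M) t u :
  feval a (fdist t u) = mdist (teval a t) (teval a u).
Proof.
rewrite /= -pinterp_dist; congr pinterp; apply/funext => i.
by case: ifP.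
Qed.

Lemma embedding_dist M N (e : M -> N) : embedding e ->
  forall x y, mdist (e x) (e y) = mdist x y.
Proof.
move=> [_ eP] x y; rewrite -!pinterp_dist -eP; congr pinterp.
by apply/funext => i /=; case: ifP.
Qed.

Lemma mdist_bounded M (x y : M) : mdist x y <= pupper (dsymb L).
Proof. by rewrite -pinterp_dist; have /andP[] := pinterp_bound (fun i : 'I_(parity (dsymb L)) => if val i == 0%N then x else y). Qed.

End logic.

(** * Elementary substructures *)

Section submetric.
Context {R : realType} {M : metricType R} (A : set M).

Let sub_dist (x y : set_type A) : R := mdist (set_val x) (set_val y).

Let sub_dist_ge0 x y : 0 <= sub_dist x y. Proof. exact: mdist_ge0. Qed.

Let sub_dist_positivity x y : sub_dist x y = 0 -> x = y.
Proof. by move=> /mdist_positivity; exact: val_inj. Qed.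

(** The metric has to match the uniformity that [set_type] already carries; it does, that uniformity
    being pulled back along the inclusion. *)
Let sub_ballE (x : set_type A) d : ball x d = [set y | sub_dist x y < d].
Proof.
rewrite -[LHS]/[set y : set_type A | ball (set_val x) d (set_val y)].
by rewrite ballEmdist.
Qed.

HB.instance Definition _ := @PseudoMetric_isMetric.Build R (set_type A)
  sub_dist sub_dist_ge0 sub_dist_positivity sub_ballE.

End submetric.

Section metric_facts.
Context {R : realType} {M : metricType R}.

Lemma closureP (A : set M) x :
  closure A x <-> forall e : R, 0 < e -> exists2 y, A y & mdist x y < e.
Proof.
split=> [cA e e0|H B /nbhs_ballP[e /= e0 eB]].
  have [y [Ay]] := cA _ (nbhsx_ballx x e e0); rewrite ballEmdist /= => xy.
  by exists y.
have [y Ay xy] := H e e0; exists y; split => //; apply: eB.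
by rewrite ballEmdist.
Qed.

End metric_facts.
Lemma sub_complete (R : realType) (M : metricType R) (A : set M) :
  complete_metric M -> closed A -> complete_metric (set_type A).
Proof.
move=> cM cA F PF cF.
have FF : ProperFilter (set_val @ F) by exact: fmap_proper_filter.
have cG : cauchy (set_val @ F).
  apply/cauchy_exP => e e0.
  by have [x Fx] := (cauchyP F).1 cF e e0; exists (set_val x).
have [l Fl] := cM _ FF cG.
have Al : A l.
  apply: cA => B /Fl FB.
  have [x Bx] := @filter_ex _ F _ _ FB.
  by exists (set_val x); split => //; exact: set_valP.
exists (exist _ l (mem_set Al)).
apply/cvg_ballP => e e0.
have /Fl := nbhsx_ballx l e e0.
by apply: filterS => x.
Qed.

Section substructure.
Context {R : realType} {L : signature R} (M : structure L) (A : set M).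
Hypotheses (A0 : exists x, A x) (cA : closed A)
  (fA : forall f (a : 'I_(farity f) -> M), (forall i, A (a i)) -> A (finterp a)).

Definition sub_finterp (f : fsymb L) (a : 'I_(farity f) -> set_type A) : set_type A :=
  exist _ (finterp (fun i => set_val (a i))) (mem_set (fA (fun i => set_valP (a i)))).

Lemma sub_nonempty : exists x : set_type A, True.
Proof. by have [x Ax] := A0; exists (exist _ x (mem_set Ax)). Qed.

Definition substructure : structure L := @Structure R L (set_type A)
  sub_nonempty (sub_complete (@carrier_complete _ _ M) cA)
  (fun P a => pinterp (fun i => set_val (a i)))
  sub_finterp
  (fun P a b => pinterp_modulus (fun i => set_val (a i)) (fun i => set_val (b i)))
  (fun f a b => finterp_modulus (fun i => set_val (a i)) (fun i => set_val (b i)))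
  (fun P a => pinterp_bound (fun i => set_val (a i)))
  (fun x y => etrans
     (congr1 (@pinterp _ _ M (dsymb L)) (funext (fun i => fun_if set_val _ _ _)))
     (pinterp_dist (set_val x) (set_val y))).

Definition sub_incl (x : substructure) : M := set_val (x : set_type A).

Lemma sub_inclP x : A (sub_incl x).
Proof. exact: set_valP. Qed.

Lemma range_sub_incl : range sub_incl = A.
Proof.
apply/seteqP; split => [_ [x _ <-]|x Ax]; first exact: sub_inclP.
by exists (exist _ x (mem_set Ax)).
Qed.

End substructure.

Lemma has_inf_approx (R : realType) (A : set R) (y e : R) : has_inf A -> 0 < e ->
  inf A <= y -> exists2 x, A x & x < y + e.
Proof.
move=> hA e0 Ay; have [x Ax xe] := inf_adherent e0 hA.
by exists x => //; apply: (lt_le_trans xe); rewrite lerD2r.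
Qed.

Section tarski_vaught.
Context {R : realType} {L : signature R} (F : fragment L) (M : structure L).
Variable a : nat -> M.
Hypothesis aF : forall phi : frag_type F,
  tp F a (inf_in phi) = inf (range (fun j => tp F a (inst_in j phi))).

(** Codes speak only of the assignment [a] itself. Closure of the fragment under substitution
    transports their condition to every reindexed assignment [a \o s]; the lifted substitution
    spares the bound variable. *)
Lemma inf_dense_seq p (s : nat -> nat) : frag_set F p ->
  inf (range (fun y => feval (scons y (a \o s)) p)) =
  inf (range (fun j => feval (scons (a j) (a \o s)) p)).
Proof.
move=> Fp; have := aF (exist _ _ (frag_subst (lift_subst (Var \o s)) Fp)).
have sE (y : M) : (fun n => teval (scons y a) (lift_subst (Var \o s) n)) =
    scons y (a \o s) by apply/funext => -[].
have iE j : (fun n => teval a (scons (Var j) Var n)) = scons (a j) a.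
  by apply/funext => -[].
rewrite /tp /=.
under eq_fun do rewrite feval_subst sE.
move=> ->; congr (inf _); congr image; apply/funext => j.
by rewrite !feval_subst iE sE.
Qed.

(** The Tarski-Vaught test with parameters in the closure: two changes of parameters and one
    approximate infimum cost [e / 4] each. *)
Lemma inf_approx_closure p (s : nat -> M) : frag_set F p ->
  (forall i, closure (range a) (s i)) -> forall (y : M) (e : R), 0 < e ->
  exists j, feval (scons (a j) s) p < feval (scons y s) p + e.
Proof.
move=> Fp cs y e e0.
have fp := frag_formula Fp.
have [k Hk] := formula_ucP fp; have [B HB] := formula_boundedP fp.
have e30 : 0 < e / 4 by lra.
have [d d0 Hd] := Hk _ e30.
have /choice[u Hu] : forall i, exists j, mdist (s i) (a j) < d.
  by move=> i; have [_ [j _ <-]] := (closureP _ _).1 (cs i) _ d0; exists j.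
have near_s z : `|feval (scons z s) p - feval (scons z (a \o u)) p| <= e / 4.
  apply: Hd; apply: mdist_scons => // i _; exact: Hu.
have hi : has_inf (range (fun j => feval (scons (a j) (a \o u)) p)).
  by apply: (range_has_inf (B := B)) => //; exists 0%N.
have [_ [j _ <-] jlt] : exists2 r, range (fun j => feval (scons (a j) (a \o u)) p) r &
    r < feval (scons y (a \o u)) p + e / 4.
  apply: has_inf_approx => //; rewrite -inf_dense_seq//; apply: ge_inf.
    by have [] := range_has_inf (f := fun y => feval (scons y (a \o u)) p) (carrier_nonempty M) (fun y => HB M _).
  by exists y.
exists j; have := near_s y; have := near_s (a j).
rewrite !ler_norml => /andP[? ?] /andP[? ?]; lra.
Qed.

(** The atomic formula [d(y, f(s))] vanishes at [y = finterp s], so by the Tarski-Vaught test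
    members of the sequence make it arbitrarily small. *)
Lemma closure_finterp f (s : 'I_(farity f) -> M) :
  (forall i, closure (range a) (s i)) -> closure (range a) (finterp s).
Proof.
move=> cs; apply/closureP => e e0.
pose t : nat -> M := fun n => if insub n is Some i then s i else a 0%N.
have ct i : closure (range a) (t i).
  by rewrite /t; case: insubP => // _; apply: subset_closure; exists 0%N.
have tE : (fun i : 'I_(farity f) => t i) = s.
  by apply/funext => i; rewrite /t valK.
have Fp : frag_set F (fdist (Var 0) (App (fun i : 'I_(farity f) => Var i.+1))).
  exact: frag_atom.
have [j] := inf_approx_closure Fp ct (finterp s) e0.
rewrite !feval_fdist /= tE mdistxx add0r => h; exists (a j); first by exists j.
by rewrite metric_sym.
Qed.

Lemma closure_range_nonempty : exists x, closure (range a) x.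
Proof. by exists (a 0%N); apply: subset_closure; exists 0%N. Qed.

Definition hull : structure L :=
  substructure closure_range_nonempty (@closed_closure _ _) closure_finterp.

Definition hull_seq (n : nat) : hull :=
  exist _ (a n) (mem_set (@subset_closure _ (range a) _ (ex_intro2 _ _ n I erefl))).

Definition hull_incl : hull -> M := @sub_incl _ _ M _
  closure_range_nonempty (@closed_closure _ _) closure_finterp.

Lemma hull_incl_seq n : hull_incl (hull_seq n) = a n.
Proof. by []. Qed.

Lemma hull_seq_dense (x : hull) (e : R) : 0 < e -> exists n, mdist x (hull_seq n) < e.
Proof.
move=> e0; have /closureP/(_ e e0)[_ [n _ <-] h] : closure (range a) (hull_incl x).
  exact: sub_inclP.
by exists n.
Qed.

Lemma hull_elementary p : frag_set F p -> forall s : nat -> hull,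
  feval s p = feval (hull_incl \o s) p.
Proof.
have es (x : hull) (s : nat -> hull) : hull_incl \o scons x s = scons (hull_incl x) (hull_incl \o s).
  by apply/funext => -[].
have hinf q : frag_set F q ->
    (forall s : nat -> hull, feval s q = feval (hull_incl \o s) q) ->
    forall s : nat -> hull, inf (range (fun x : hull => feval (scons x s) q)) =
      inf (range (fun x : M => feval (scons x (hull_incl \o s)) q)).
  move=> Fq IH s; have [B HB] := formula_boundedP (frag_formula Fq).
  have h1 := range_has_inf (f := fun x => feval (scons x s) q) (carrier_nonempty hull) (fun y => HB hull _).
  have h2 := range_has_inf (f := fun x => feval (scons x (hull_incl \o s)) q) (carrier_nonempty M) (fun y => HB M _).
  apply/eqP; rewrite eq_le; apply/andP; split; last first.
    apply: lb_le_inf; first by case: h1.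
    move=> _ [x _ <-]; rewrite IH es; apply: ge_inf; first by case: h2.
    by exists (hull_incl x).
  apply: lb_le_inf; first by case: h2.
  move=> _ [y _ <-]; apply/ler_addgt0Pr => e e0.
  have [j /ltW jl] := inf_approx_closure Fq (fun i => sub_inclP (s i)) y e0.
  apply: le_trans jl; rewrite -hull_incl_seq -es -IH.
  by apply: ge_inf; [case: h1|exists (hull_seq j)].
elim: p => [P ts|//|p IHp q IHq|r p IHp|p IHp q IHq|p IHp q IHq|p IHp|p IHp|ps IH|ps IH] Fp s.
- transitivity (pinterp (fun i => hull_incl (teval s (ts i)))); first by [].
  rewrite /=; congr pinterp; apply/funext => i; apply/esym.
  exact: (teval_embedding (e := hull_incl)).
- have h := frag_sub Fp; rewrite /= (IHp (h _ (or_introl erefl))).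
  by rewrite (IHq (h _ (or_intror erefl))).
- by rewrite /= (IHp (frag_sub Fp erefl)).
- have h := frag_sub Fp; rewrite /= (IHp (h _ (or_introl erefl))).
  by rewrite (IHq (h _ (or_intror erefl))).
- have h := frag_sub Fp; rewrite /= (IHp (h _ (or_introl erefl))).
  by rewrite (IHq (h _ (or_intror erefl))).
(* A supremum is minus the infimum of [FScale (-1) p], which is again in the fragment. *)
- have Fq : frag_set F p := frag_sub Fp erefl.
  have := hinf _ (frag_scale (-1) Fq) _ s => /(_ _)/esym.
  rewrite /inf /=.
  have nE (T : Type) (f : T -> R) : -%R @` range (fun x => ratr (-1) * f x) = range f.
    rewrite rmorphN rmorph1; apply/seteqP; split => [_ [_ [x _ <-] <-]|_ [x _ <-]].
      by exists x => //; rewrite mulN1r opprK.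
    by exists (-1 * f x); [exists x|rewrite mulN1r opprK].
  rewrite !nE => h; apply: oppr_inj; apply/esym; apply: h => s'.
  by rewrite (IHp Fq).
- exact/hinf/IHp/(frag_sub Fp erefl)/(frag_sub Fp erefl).
- rewrite /=; congr (sup _); congr image; apply/funext => n.
  by apply: IH; apply: (frag_sub Fp); exists n.
- rewrite /=; congr (inf _); congr image; apply/funext => n.
  by apply: IH; apply: (frag_sub Fp); exists n.
Qed.

End tarski_vaught.

(** * Isomorphisms from dense sequences *)

Definition dense_seq (R : realType) (M : metricType R) (s : nat -> M) :=
  forall (x : M) (e : R), 0 < e -> exists n, mdist x (s n) < e.

Section dense_embedding.
Context {R : realType} {L : signature R}.
Implicit Types M N Q : structure L.

Lemma finterp_uc (f : fsymb L) (e : R) : 0 < e -> exists2 d, 0 < d &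
  forall M (a b : 'I_(farity f) -> M), (forall i, mdist (a i) (b i) < d) ->
    mdist (finterp a) (finterp b) < e.
Proof.
move=> e0; have [d d0 Hd] := modulus_small (fmodulusP f) e0.
exists d => // M a b ab; apply: le_lt_trans (finterp_modulus _ _) _.
by apply: Hd; [exact: max_dist_ge0|exact: max_dist_lt].
Qed.

Lemma pinterp_uc (P : psymb L) (e : R) : 0 < e -> exists2 d, 0 < d &
  forall M (a b : 'I_(parity P) -> M), (forall i, mdist (a i) (b i) < d) ->
    `|pinterp a - pinterp b| < e.
Proof.
move=> e0; have [d d0 Hd] := modulus_small (pmodulusP P) e0.
exists d => // M a b ab; apply: le_lt_trans (pinterp_modulus _ _) _.
by apply: Hd; [exact: max_dist_ge0|exact: max_dist_lt].
Qed.

Context {M N : structure L} (s : nat -> M) (t : nat -> N).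
Hypotheses (ds : dense_seq s)
  (st : forall P (ts : 'I_(parity P) -> term L), feval s (FAtom ts) = feval t (FAtom ts)).

Let st_dist i j : mdist (s i) (s j) = mdist (t i) (t j).
Proof. by have : feval s (fdist (Var i) (Var j)) = feval t (fdist (Var i) (Var j)); [exact: st|rewrite !feval_fdist]. Qed.

Let ext_ex x : exists y, forall e : R, 0 < e ->
  exists2 d, 0 < d & forall i, mdist x (s i) < d -> mdist y (t i) < e.
Proof.
pose G : set_system N := filter_from [set d : R | 0 < d]
  (fun d => [set y | exists2 i, mdist x (s i) < d & t i = y]).
have PG : ProperFilter G.
  apply: filter_from_proper; last first.
    by move=> d /= d0; have [i xi] := ds x d0; exists (t i), i.
  apply: filter_from_filter; first by exists 1 => /=.
  move=> d d' /= d0 d'0; exists (Num.min d d'); first by rewrite /= lt_min d0.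
  by move=> _ [i + <-]; rewrite lt_min => /andP[h1 h2]; split; exists i.
have cG : cauchy G.
  apply/cauchy_exP => e e0; have e20 : 0 < e / 2 by lra.
  have [i xi] := ds x e20; exists (t i); exists (e / 2) => //.
  move=> _ [j xj <-]; rewrite ballEmdist /= -st_dist.
  by have := metric_triangle (s i) x (s j); rewrite (metric_sym (s i) x); lra.
have [y Gy] := @carrier_complete _ _ N _ PG cG.
exists y => e e0; have [d d0 Hd] := Gy _ (nbhsx_ballx y e e0).
exists d => // i xi; have : ball y e (t i) by apply: Hd; exists i.
by rewrite ballEmdist.
Qed.

(** Agreement on the atomic formulas [d(x_i, x_j)] makes [s i |-> t i] isometric, and completeness
    of [N] extends it to [M]. The symbols are respected along the sequence, hence everywhere by
    uniform continuity. *)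
Lemma dense_embedding : exists2 g : M -> N, embedding g & forall i, g (s i) = t i.
Proof.
have [g Hg] := choice ext_ex.
have dg x i : mdist (g x) (t i) = mdist x (s i).
  have key e : 0 < e -> `|mdist (g x) (t i) - mdist x (s i)| < e.
    move=> e0; have e20 : 0 < e / 2 by lra.
    have [d d0 Hd] := Hg x _ e20.
    have dd0 : 0 < Num.min d (e / 2) by rewrite lt_min d0.
    have [j] := ds x dd0; rewrite lt_min => /andP[/Hd h1 h2].
    have := metric_triangle (g x) (t j) (t i).
    have := metric_triangle (t j) (g x) (t i).
    have := metric_triangle x (s j) (s i).
    have := metric_triangle (s j) x (s i).
    rewrite -!st_dist (metric_sym (t j) (g x)) (metric_sym (s j) x) ltr_norml.
    by move=> *; apply/andP; split; lra.
  apply/eqP; rewrite -subr_eq0 -normr_le0; apply/ler_addgt0Pl => e e0.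
  by rewrite addr0 ltW// key.
have gs i : g (s i) = t i by apply: mdist_positivity; rewrite dg mdistxx.
exists g => //; split.
  move=> f a; apply: mdist_positivity; apply/eqP; rewrite eq_le mdist_ge0 andbT.
  apply/ler_addgt0Pl => e e0; rewrite addr0; have e30 : 0 < e / 4 by lra.
  have [d d0 Hd] := finterp_uc f e30.
  have /choice[u Hu] : forall i, exists j, mdist (a i) (s j) < d by move=> i; apply: ds.
  have h1 := Hd M a (fun i => s (u i)) Hu.
  have h2 : mdist (finterp (g \o a)) (finterp (fun i => t (u i))) < e / 4.
    by apply: Hd => i; rewrite dg.
  have [j hj] := ds (finterp a) e30.
  (* A function value need not belong to the sequence; it is compared through its distance to a
     nearby member [s j]. *)
  pose q : preformula L := fdist (Var j) (App (fun i => Var (u i))).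
  have : feval s q = feval t q by exact: st.
  rewrite !feval_fdist /= => h3.
  have := metric_triangle (g (finterp a)) (t j) (finterp (g \o a)).
  have := metric_triangle (t j) (finterp (fun i => t (u i))) (finterp (g \o a)).
  have := metric_triangle (s j) (finterp a) (finterp (fun i => s (u i))).
  rewrite dg -h3 (metric_sym (finterp (fun i => t (u i))) (finterp (g \o a))) (metric_sym (s j) (finterp a)).
  by move: h1 h2 hj => *; lra.
move=> P a; apply/eqP; rewrite -subr_eq0 -normr_le0; apply/ler_addgt0Pl => e e0.
rewrite addr0; have e30 : 0 < e / 4 by lra.
have [d d0 Hd] := pinterp_uc P e30.
have /choice[u Hu] : forall i, exists j, mdist (a i) (s j) < d by move=> i; apply: ds.
have := Hd M a (fun i => s (u i)) Hu.
have : `|pinterp (g \o a) - pinterp (fun i => t (u i))| < e / 4.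
  by apply: Hd => i; rewrite dg.
have /= <- := st (fun i => Var (u i)).
rewrite !ltr_norml => /andP[? ?] /andP[? ?]; rewrite ler_norml; apply/andP; split; lra.
Qed.

End dense_embedding.

Section dense_iso.
Context {R : realType} {L : signature R} {M N : structure L} (s : nat -> M) (t : nat -> N).
Hypotheses (ds : dense_seq s) (dt : dense_seq t)
  (st : forall P (ts : 'I_(parity P) -> term L), feval s (FAtom ts) = feval t (FAtom ts)).

Lemma embedding_inj (g : M -> N) : embedding g -> injective g.
Proof.
move=> eg x y xy; apply: mdist_positivity.
by rewrite -(embedding_dist eg) xy mdistxx.
Qed.

Lemma dense_iso : exists2 g : M -> N, embedding g & bijective g /\ forall i, g (s i) = t i.
Proof.
have [g eg gs] := dense_embedding ds st.
have [h eh hs] := dense_embedding dt (fun P ts => esym (st ts)).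
exists g => //; split => //; exists h => [x|y]; apply: mdist_positivity;
  apply/eqP; rewrite eq_le mdist_ge0 andbT; apply/ler_addgt0Pl => e e0; rewrite addr0;
  have e20 : 0 < e / 2 by lra.
- have [i xi] := ds x e20.
  have := metric_triangle (h (g x)) (s i) x.
  by rewrite -{1}hs -gs (embedding_dist eh) (embedding_dist eg) (metric_sym (s i) x); lra.
- have [i yi] := dt y e20.
  have := metric_triangle (g (h y)) (t i) y.
  by rewrite -{1}gs -hs (embedding_dist eg) (embedding_dist eh) (metric_sym (t i) y); lra.
Qed.

End dense_iso.

(** * Structures coded by a point of the space of models *)

Section coded.
Context {R : realType} {L : signature R} (T : set (preformula L * R)) (F : fragment L).
Hypotheses (TF : forall p, T p -> frag_set F p.1).
Implicit Types M N Q : structure L.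

Lemma coded_exists (xi : Mod_space T F) : exists (N : structure L) (x : nat -> N),
  [/\ coded_structure T (set_val xi) N, models N T, dense_seq x & set_val xi = tp F x].
Proof.
have [[M [a [MT xiE]]] aF] := set_valP xi.
rewrite xiE in aF; exists (hull aF), (hull_seq aF); split.
- exists M, a, (@hull_incl _ _ F _ _ aF); split => //.
  exact: range_sub_incl.
- by move=> p Tp s; rewrite hull_elementary ?MT//; exact: TF.
- by move=> x e; exact: hull_seq_dense.
- by apply: (etrans xiE); apply/funext => -[p Fp]; rewrite /tp /= hull_elementary.
Qed.

(** The map [e] is given only as an embedding, so only atomic formulas are pulled back from the
    model realizing [xi]; they are what [dense_iso] asks for. *)
Lemma coded_dense (xi : {ptws frag_type F -> R}) N : coded_structure T xi N ->
  exists2 x : nat -> N, dense_seq x &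
    forall P (ts : 'I_(parity P) -> term L), feval x (FAtom ts) =
      xi (exist _ (FAtom ts) (frag_atom F ts)).
Proof.
move=> [M [a [e [_ xiE ee re]]]].
have /choice[x xa] : forall i, exists y, e y = a i.
  move=> i; have : range e (a i) by rewrite re; apply: subset_closure; exists i.
  by case=> y _ <-; exists y.
exists x => [y d d0|P ts].
  have : range e (e y) by exists y.
  rewrite re => /closureP/(_ _ d0)[_ [i _ <-]]; rewrite -xa (embedding_dist ee).
  by exists i.
rewrite xiE /tp /= -ee.2; congr pinterp; apply/funext => i /=.
by rewrite -teval_embedding//; congr (teval _ _); apply/funext.
Qed.

Lemma coded_unique (xi : {ptws frag_type F -> R}) M N : coded_structure T xi M -> coded_structure T xi N ->
  isomorphic M N.
Proof.
move=> /coded_dense[x dx xE] /coded_dense[y dy yE].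
have [|g eg [bg _]] := dense_iso dx dy; first by move=> P ts; rewrite xE yE.
by exists g.
Qed.

End coded.

Section isomorphic_equivalence.
Context {R : realType} {L : signature R}.
Implicit Types M N Q : structure L.

Lemma embedding_inv M N (e : M -> N) e' : embedding e -> cancel e e' -> cancel e' e ->
  embedding e'.
Proof.
move=> [ef eP] ee' e'e; split => [f a|P a].
  apply: (can_inj ee'); rewrite e'e ef; congr finterp.
  by apply/funext => i /=; rewrite e'e.
by rewrite -eP; congr pinterp; apply/funext => i /=; rewrite e'e.
Qed.

Lemma embedding_comp M N Q (e : M -> N) (e' : N -> Q) : embedding e -> embedding e' ->
  embedding (e' \o e).
Proof.
move=> [ef eP] [ef' eP']; split => [f a|P a]; first by rewrite /= ef ef'.
by rewrite -eP -eP'.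
Qed.

Lemma isomorphic_sym M N : isomorphic M N -> isomorphic N M.
Proof.
by move=> [e ee [e' k k']]; exists e'; [exact: (embedding_inv ee)|exists e].
Qed.

Lemma isomorphic_trans M N Q : isomorphic M N -> isomorphic N Q -> isomorphic M Q.
Proof.
move=> [e ee be] [e' ee' be']; exists (e' \o e); last exact: bij_comp.
exact: embedding_comp.
Qed.

End isomorphic_equivalence.

(** * Ultralimits and chains of compact balls *)

Lemma filter_forall_lt (T : Type) (G : set_system T) (GG : Filter G) (k : nat) (A : nat -> set T) :
  (forall i, (i < k)%N -> G (A i)) -> G [set x | forall i, (i < k)%N -> A i x].
Proof.
elim: k => [_|k IH H]; first by apply: filterS filterT => x _ i.
have GI : G ([set x | forall i, (i < k)%N -> A i x] `&` A k).
  by apply: filterI; [apply: IH => i ik; exact/H/ltnW|exact: H].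
apply: filterS GI => x [h hk] i; rewrite ltnS leq_eqVlt => /orP[/eqP->//|]; exact: h.
Qed.

Section ultralimits.
Context {R : realType} (U : set_system nat) (UU : UltraFilter U).

Definition ulim (M : metricType R) (t : nat -> M) (y : M) :=
  forall e : R, 0 < e -> U [set m | mdist (t m) y < e].

Lemma ultraI (A B : set nat) : U A -> U B -> U (A `&` B).
Proof. by move=> UA UB; apply: filterI. Qed.

Lemma ultraS (A B : set nat) : U A -> A `<=` B -> U B.
Proof. by move=> UA AB; apply: filterS UA. Qed.

Lemma ulim_cst (M : metricType R) (y : M) : ulim (fun=> y) y.
Proof. by move=> e e0; apply: filterS filterT => m _; rewrite /= mdistxx. Qed.

Lemma ultra_compact (M : metricType R) (K : set M) (t : nat -> M) :
  compact K -> U [set m | K (t m)] -> exists y, ulim t y.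
Proof.
move=> cK UK; have [y [_ cy]] := cK (t @ U) _ UK.
exists y => e e0; have [//|Un] := in_ultra_setVsetC [set m | mdist (t m) y < e] UU.
have [z [[m nm]]] : (t @` (~` [set m | mdist (t m) y < e])) `&` ball y e !=set0.
  apply: cy; last exact: nbhsx_ballx.
  by rewrite /fmap /=; apply: filterS Un => m nm; exists m.
by move=> <-; rewrite ballEmdist /= metric_sym.
Qed.

Hypothesis Uoo : \oo `<=` U.

Lemma ultra_ge k : U [set m | (k <= m)%N].
Proof. by apply: Uoo; exists k => // m. Qed.

Lemma ultra_ex (A : set nat) k : U A -> exists2 m, (k <= m)%N & A m.
Proof.
move=> UA; have [m [? ?]] := @filter_ex _ U _ _ (filterI (ultra_ge k) UA).
by exists m.
Qed.

End ultralimits.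

Lemma free_ultrafilter : exists U : set_system nat, UltraFilter U /\ \oo `<=` U.
Proof. by have [U [? ?]] := @ultraFilterLemma nat \oo _; exists U. Qed.

Section radius.
Context {R : realType} {L : signature R}.
Implicit Types M N : structure L.

(** A strict bound on all distances. Truncating radii there keeps [rad] a real number even when all
    balls are compact, and forbids no step. *)
Definition diam_bound : R := pupper (dsymb L) + 1.

Definition rad M (a : M) : R :=
  sup [set r | r <= diam_bound /\ compact (closure (ball a r))].

Lemma ball0 M (a : M) : ball a (0 : R) = set0.
Proof.
rewrite ballEmdist -subset0 => x /=.
by rewrite ltNge mdist_ge0.
Qed.

Lemma diam_bound_gt M (x y : M) : mdist x y < diam_bound.
Proof. by rewrite /diam_bound; have := mdist_bounded x y; lra. Qed.

Lemma rad_has_sup M (a : M) :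
  has_sup [set r | r <= diam_bound /\ compact (closure (ball a r))].
Proof.
split; last by exists diam_bound => r [].
exists 0; split; first by rewrite (le_trans _ (ltW (diam_bound_gt a a))) ?mdistxx.
by rewrite ball0 closure0; exact: compact0.
Qed.

Lemma rad_ge M (a : M) r : r <= diam_bound -> compact (closure (ball a r)) -> r <= rad a.
Proof. by move=> rb cr; apply: ub_le_sup => //; case: (rad_has_sup a). Qed.

Lemma compact_closure_sub M (A B : set M) : A `<=` B -> compact (closure B) ->
  compact (closure A).
Proof.
move=> AB cB; apply: (subclosed_compact (@closed_closure _ _) cB).
exact: closure_subset.
Qed.

Lemma rad_gt_compact M (a : M) r : r < rad a -> compact (closure (ball a r)).
Proof.
move=> ra; have [r' [_ cr'] rr'] := sup_gt (rad_has_sup a).1 ra.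
apply: compact_closure_sub cr' => x; rewrite !ballEmdist /= => h.
exact: lt_trans h rr'.
Qed.

Lemma rad_lip M (a b : M) : rad a <= rad b + mdist a b.
Proof.
apply: ge_sup; first by case: (rad_has_sup a).
move=> r [rb cr]; rewrite -lerBlDr; apply: rad_ge.
  by have := mdist_ge0 a b; lra.
apply: compact_closure_sub cr => x; rewrite !ballEmdist /= => h.
by have := metric_triangle a b x; lra.
Qed.

Lemma ultra_rad (U : set_system nat) (UU : UltraFilter U) M (a : M) r (t : nat -> M) :
  r < rad a -> U [set m | mdist a (t m) < r] -> exists y, ulim U t y.
Proof.
move=> ra Ut; apply: (ultra_compact UU (rad_gt_compact ra)).
apply: filterS Ut => m h; apply: subset_closure.
by rewrite ballEmdist.
Qed.

(* A closed set is compact as soon as an isometry maps it into a compact set: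
   the preimages of a convergent ultrafilter are Cauchy. *)
Lemma isometry_compact M N (h : M -> N) (A : set M) (K : set N) :
  (forall x y, mdist (h x) (h y) = mdist x y) -> closed A -> compact K ->
  (forall x, A x -> K (h x)) -> compact A.
Proof.
move=> hI cA cK AK; rewrite compact_ultra => F UF FA.
have [p [_ cp]] := cK (h @ F) _ (filterS AK FA).
have Fp (e : R) : 0 < e -> F [set x | mdist (h x) p < e].
  move=> e0; have [//|Fn] := in_ultra_setVsetC [set x | mdist (h x) p < e] UF.
  have [z [[x nx]]] : (h @` (~` [set x | mdist (h x) p < e])) `&` ball p e !=set0.
    apply: cp; last exact: nbhsx_ballx.
    by rewrite /fmap /=; apply: filterS Fn => x nx; exists x.
  by move=> <-; rewrite ballEmdist /= metric_sym.
have cF : cauchy F.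
  apply/cauchy_exP => e e0; have e20 : 0 < e / 2 by lra.
  have [x xp] := @filter_ex _ F _ _ (Fp _ e20).
  exists x; apply: filterS (Fp _ e20) => y /= yp; rewrite ballEmdist /= -hI.
  by have := metric_triangle (h x) p (h y); rewrite (metric_sym p); move: xp => /=; lra.
have [l Fl] := @carrier_complete _ _ M F _ cF.
exists l; split => //; apply: cA => B /Fl FB.
exact: (@filter_ex _ F _ _ (@filterI _ F _ _ _ FA FB)).
Qed.

(** Compactness pulls back along isometric maps, onto or not, so that such maps can only lower
    [rad]. *)
Lemma isometry_rad M N (h : M -> N) (a : M) :
  (forall x y, mdist (h x) (h y) = mdist x y) -> rad (h a) <= rad a.
Proof.
move=> hI; apply: ge_sup; first by case: (rad_has_sup (h a)).
move=> r [rb cr]; apply: rad_ge => //.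
apply: (isometry_compact hI (@closed_closure _ _) cr) => x /closureP cx.
apply/closureP => e e0; have [y] := cx e e0.
rewrite ballEmdist /= => ay xy; exists (h y); last by rewrite hI.
by rewrite ballEmdist /= hI.
Qed.

(** The margin [q] absorbs small moves of the endpoints and keeps limits inside a compact ball. *)
Definition step (q : R) M (a t : M) := mdist a t + q < rad a.

(** Mind the shift: [n] counts the interior points, so a chain has [n.+1] steps. *)
Fixpoint reach (n : nat) (q : R) M (a t : M) : Prop :=
  if n is n'.+1 then exists2 c, reach n' q a c & step q c t else step q a t.

(** Moving the source of a step affects the distance and, by [rad_lip], the radius; moving the
    target affects the distance only: [3 * e] in all. Interior points stay, so the loss does not
    grow with [n]. *)
Lemma reach_perturb n q (e : R) M (a a' t t' : M) : 0 <= e ->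
  reach n q a t -> mdist a a' <= e -> mdist t t' <= e ->
  reach n (q - 3 * e) a' t'.
Proof.
have stepP (x x' y y' : M) : 0 <= e -> step q x y -> mdist x x' <= e -> mdist y y' <= e ->
    step (q - 3 * e) x' y'.
  rewrite /step => e0 xy xx yy; have := rad_lip x x'.
  have := metric_triangle x' x y'; have := metric_triangle x y y'.
  by rewrite (metric_sym x' x); lra.
elim: n t t' => [|n IH] t t' e0 /=; first exact: stepP.
move=> [c ac ct] aa tt; exists c; first by apply: IH ac aa _; rewrite ?mdistxx.
by apply: stepP ct _ tt => //; rewrite mdistxx.
Qed.

Lemma reach_mono n q q' M (a t : M) : q' <= q -> reach n q a t -> reach n q' a t.
Proof.
have stepP (x y : M) : q' <= q -> step q x y -> step q' x y by rewrite /step; lra.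
elim: n t => [|n IH] t qq /=; first exact: stepP.
by move=> [c ac ct]; exists c; [exact: IH|exact: stepP].
Qed.

Lemma reach_strict n q M (a t : M) : reach n q a t -> exists2 q', q < q' & reach n q' a t.
Proof.
have stepP (x y : M) : step q x y -> exists2 q', q < q' & step q' x y.
  rewrite /step => h; exists ((q + (rad x - mdist x y)) / 2); lra.
elim: n t => [|n IH] t /=; first exact: stepP.
move=> [c /IH[q1 qq1 ac] /stepP[q2 qq2 ct]]; exists (Num.min q1 q2); first by rewrite lt_min qq1.
exists c; first by apply: reach_mono ac; rewrite ge_min lexx.
have : Num.min q1 q2 <= q2 by rewrite ge_min lexx orbT.
by move: ct; rewrite /step; lra.
Qed.

(** The longer chain first waits at [a], which a margin below [rad a] permits. *)
Lemma reach_self n q M (a t : M) : q < rad a -> reach n q a t -> reach n.+1 q a t.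
Proof.
move=> qa; elim: n t => [|n IH] t.
  by move=> at'; exists a => //=; rewrite /step mdistxx add0r.
by move=> [c /IH ac ct]; exists c.
Qed.

(** The points of the chains converge one after the other: around the limit of one of them a compact
    ball captures the next. *)
Lemma reach_ulim (U : set_system nat) (UU : UltraFilter U) n q M (a : M) (u t : nat -> M) :
  0 < q -> ulim U u a -> U [set m | reach n q (u m) (t m)] -> exists y, ulim U t y.
Proof.
move=> q0; have stepP (c : M) (c_ t_ : nat -> M) : ulim U c_ c ->
    U [set m | step q (c_ m) (t_ m)] -> exists y, ulim U t_ y.
  (* One third of the margin pays for moving the centre to [c], one for the change of [rad]; the
     last keeps the radius below [rad c]. *)
  move=> cc ct; have q30 : 0 < q / 3 by lra.
  apply: (@ultra_rad U UU M c (rad c - q / 3)); first by lra.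
  have UI := ultraI UU ct (cc _ q30); apply: (ultraS UU UI) => m /= [].
  rewrite /step => h1 h2; have := rad_lip (c_ m) c; have := metric_triangle c (c_ m) (t_ m).
  by rewrite (metric_sym c (c_ m)); lra.
move=> ua; elim: n t => [|n IH] t Ut; first exact: stepP ua Ut.
have /choice[c Hc] : forall m, exists c, reach n.+1 q (u m) (t m) ->
    reach n q (u m) c /\ step q c (t m).
  move=> m.
  have [[c ? ?]|h] := pselect (reach n.+1 q (u m) (t m)); first by exists c.
  by exists (u m) => /h.
have [y cy] : exists y, ulim U c y.
  by apply: IH; apply: (ultraS UU Ut) => m /Hc[].
by apply: (stepP y c t cy); apply: (ultraS UU Ut) => m /Hc[].
Qed.

Lemma isometry_step q M N (h : M -> N) (c t : M) : (forall x y, mdist (h x) (h y) = mdist x y) ->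
  rad c <= rad (h c) -> step q c t -> step q (h c) (h t).
Proof. by move=> hI hr; rewrite /step hI => /lt_le_trans; apply. Qed.

Lemma rad_gt0 M (a : M) : pseudo_connected M -> 0 < rad a.
Proof.
move=> [lc _]; have [V + [cV clV]] := lc a I.
rewrite withinET => /nbhs_ballP[e /= e0 eV].
have e'0 : 0 < Num.min e diam_bound.
  by rewrite lt_min e0 (le_lt_trans (mdist_ge0 a a) (diam_bound_gt a a)).
apply: (lt_le_trans e'0); apply: rad_ge; first by rewrite ge_min lexx orbT.
apply: (subclosed_compact (@closed_closure _ _) cV).
rewrite [X in _ `<=` X](closure_id V).1//; apply: closure_subset => x xe; apply: eV => //.
move: xe; rewrite !ballEmdist /= lt_min => /andP[] //.
Qed.

Lemma pseudo_connected_reach M (a t : M) : pseudo_connected M ->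
  exists n, exists2 q, 0 < q & reach n q a t.
Proof.
move=> pM; have : pseudo_component a t.
  by rewrite (pM.2 a t); exists 0%N, (fun=> t); split.
case=> k [s [<- sk <-]]; elim: k sk => [|k IH] sk.
  exists 0%N; have r0 := rad_gt0 (s 0%N) pM; exists (rad (s 0%N) / 2); first lra.
  by rewrite /= /step mdistxx; lra.
have [n [q q0 nq]] := IH (fun i ik => sk i (ltnW ik)).
have h : mdist (s k) (s k.+1) < rad (s k).
  have := sk k (ltnSn k); rewrite /pc_radius => /ereal_sup_gt[_ [r cr <-]].
  (* Truncating [r] loses nothing, as no distance attains [diam_bound]. *)
  rewrite lte_fin => h; apply: (lt_le_trans (y := Num.min r diam_bound)).
    by rewrite lt_min h diam_bound_gt.
  apply: rad_ge; first by rewrite ge_min lexx orbT.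
  apply: compact_closure_sub cr => x; rewrite !ballEmdist /= lt_min => /andP[] //.
exists n.+1; exists (Num.min q ((rad (s k) - mdist (s k) (s k.+1)) / 2)).
  by rewrite lt_min q0 /=; lra.
exists (s k); first by apply: reach_mono nq; rewrite ge_min lexx.
rewrite /step; set m := Num.min _ _.
have : m <= (rad (s k) - mdist (s k) (s k.+1)) / 2 by rewrite ge_min lexx orbT.
lra.
Qed.

(** Waiting lengthens a chain at a fixed positive margin, whereas the margin demanded tends to 0 as
    the chain grows. *)
Lemma pseudo_connected_reach_inv M (a t : M) (q : R) : pseudo_connected M ->
  exists n, reach n (q / n.+1%:R) a t.
Proof.
move=> pM; have [n [q1 q10 nq]] := pseudo_connected_reach a t pM.
have r0 := rad_gt0 a pM.
pose d := Num.min q1 (rad a / 2).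
have d0 : 0 < d by rewrite lt_min q10 /=; lra.
have dr : d < rad a by apply: (@le_lt_trans _ _ (rad a / 2)); [rewrite ge_min lexx orbT|lra].
have [k qk] : exists k, q / k.+1%:R <= d.
  exists (Num.truncn (`|q| / d)); rewrite ler_pdivrMr// mulrC -ler_pdivrMr//.
  apply: le_trans (ltW (truncnS_gt _)); by rewrite ler_pM2r ?invr_gt0// ler_norm.
have reach_d i : reach (n + i) d a t.
  elim: i => [|i IH]; first by rewrite addn0; apply: reach_mono nq; rewrite ge_min lexx.
  by rewrite addnS; apply: reach_self.
have [q0|q0] := leP q 0.
  exists n; apply: reach_mono nq; apply: (le_trans (y := 0)); last exact: ltW.
  by rewrite pmulr_lle0.
exists (n + k)%N; apply: reach_mono (reach_d k); apply: le_trans qk.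
by rewrite ler_pM2l// lef_pV2 ?posrE// ler_nat ltnS leq_addl.
Qed.

End radius.

(** * Existential types *)

Section existential_types.
Context {R : realType} {L : signature R}.
Implicit Types M N : structure L.

(** Variable 0 is the base point, which also fills all variables beyond the tuple. *)
Definition point_seq M (a : M) (l : seq M) : nat -> M := nth a (a :: l).

(** The same [q] is the threshold of the formula and, divided by the number of steps, the margin of
    the chains; the condition is thus monotone in one parameter. *)
Definition pos (p : preformula L) (ns : seq nat) (q : R) M (a : M) :=
  exists l : seq M, [/\ size l = size ns,
    forall i, (i < size ns)%N -> reach (nth 0%N ns i) (q / (nth 0%N ns i).+1%:R) a (nth a l i) &
    q < feval (point_seq a l) p].

(** Failure at a smaller threshold instead of plain failure: the gap between [q'] and [q] makes this
    condition open in [a], too. *)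
Definition neg (p : preformula L) (ns : seq nat) (q : R) M (a : M) :=
  exists2 q' : rat, ratr q' < q & ~ pos p ns (ratr q') a.

Lemma pos_mono p ns q q' M (a : M) : q' <= q -> pos p ns q a -> pos p ns q' a.
Proof.
move=> qq [l [sl lr lp]]; exists l; split => //; last exact: le_lt_trans lp.
by move=> i /lr; apply: reach_mono; rewrite ler_pM2r ?invr_gt0.
Qed.

Lemma finite_strict (k : nat) (P : nat -> R -> Prop) (q : R) :
  (forall i r r', r' <= r -> P i r -> P i r') ->
  (forall i, (i < k)%N -> exists2 r, q < r & P i r) ->
  exists2 r, q < r & forall i, (i < k)%N -> P i r.
Proof.
move=> Pm; elim: k => [_|k IH H]; first by exists (q + 1) => //; lra.
have [r qr Hr] := IH (fun i ik => H i (ltnW ik)).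
have [r' qr' Hr'] := H k (ltnSn k).
exists (Num.min r r'); first by rewrite lt_min qr.
move=> i; rewrite ltnS leq_eqVlt => /orP[/eqP->|ik].
  by apply: Pm Hr'; rewrite ge_min lexx orbT.
by apply: Pm (Hr i ik); rewrite ge_min lexx.
Qed.

Lemma pos_strict p ns q M (a : M) : pos p ns q a -> exists2 q', q < q' & pos p ns q' a.
Proof.
move=> [l [sl lr lp]].
have [|i iN|r qr Hr] := @finite_strict (size ns)
    (fun i r => reach (nth 0%N ns i) (r / (nth 0%N ns i).+1%:R) a (nth a l i)) q.
- by move=> i r r' rr; apply: reach_mono; rewrite ler_pM2r ?invr_gt0.
- have [r qr Hr] := reach_strict (lr i iN).
  exists (r * (nth 0%N ns i).+1%:R); first by rewrite -ltr_pdivrMr.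
  by rewrite mulfK.
exists (Num.min r ((q + feval (point_seq a l) p) / 2)); first by rewrite lt_min qr /=; lra.
exists l; split => //.
  move=> i iN; apply: reach_mono (Hr i iN).
  by rewrite ler_pM2r ?invr_gt0// ge_min lexx.
apply: (@le_lt_trans _ _ ((q + feval (point_seq a l) p) / 2)); last by lra.
by rewrite ge_min lexx orbT.
Qed.

Lemma point_seq_dist M (a a' : M) l i :
  mdist (point_seq a l i) (point_seq a' l i) <= mdist a a'.
Proof.
rewrite /point_seq; case: i => [|i] //=.
have [il|il] := ltnP i (size l); last by rewrite !nth_default.
by rewrite (set_nth_default a' a)// mdistxx mdist_ge0.
Qed.

Lemma pos_perturb p ns q q' : is_formula p -> q' < q -> exists2 e : R, 0 < e &
  forall M (a a' : M), mdist a a' < e -> pos p ns q a -> pos p ns q' a'.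
Proof.
move=> fp qq; have [k Hk] := formula_ucP fp.
have [|d d0 Hd] := Hk (q - q'); first by lra.
pose K := \max_(n <- ns) n.
(* For [n <= K] the margin may drop by [(q - q') / n.+1], which covers the loss of three times the
   displacement in [reach_perturb]. *)
have e0 : 0 < (q - q') / (3 * K.+1%:R) by rewrite divr_gt0 ?subr_gt0// mulr_gt0.
exists (Num.min d ((q - q') / (3 * K.+1%:R))); first by rewrite lt_min d0.
move=> M a a'; rewrite lt_min => /andP[ad ae] [l [sl lr lp]].
exists l; split => //.
  move=> i iN; set n := nth 0%N ns i.
  have nK : (n <= K)%N by apply: leq_bigmax_seq => //; exact: mem_nth.
  have := reach_perturb (mdist_ge0 a a') (lr i iN) (lexx _).
  rewrite (set_nth_default a' a) ?sl// => /(_ (nth a' l i)).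
  rewrite mdistxx => /(_ (mdist_ge0 _ _)); apply: reach_mono.
  rewrite -/n lerBrDr -lerBrDl -mulrBl.
  have -> : 3 * mdist a a' = mdist a a' * 3 by rewrite mulrC.
  rewrite ler_pdivlMr// -mulrA.
  apply: le_trans (_ : mdist a a' * (3 * K.+1%:R) <= _).
    by rewrite ler_wpM2l ?mdist_ge0// ler_pM2l// ler_nat ltnS.
  by apply: ltW; rewrite -ltr_pdivlMr// mulr_gt0.
have := Hd M (point_seq a l) (point_seq a' l).
move=> /(_ (fun i _ => le_lt_trans (point_seq_dist _ _ _ _) ad)).
by rewrite ler_norml => /andP[? ?]; lra.
Qed.

Context (F : fragment L) (enumF : nat -> preformula L).
Hypotheses (enumF_in : forall k, frag_set F (enumF k))
  (enumF_surj : forall p, frag_set F p -> exists k, enumF k = p).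

Let fF k : is_formula (enumF k) := frag_formula (enumF_in k).

Definition literal := (bool * nat * seq nat * rat)%type.

Definition lit (l : literal) M (a : M) : Prop :=
  let: (b, k, ns, q) := l in
  if b then pos (enumF k) ns (ratr q) a else neg (enumF k) ns (ratr q) a.

Lemma rat_between (x y : R) : x < y -> exists q : rat, x < ratr q < y.
Proof. by move=> /rat_in_itvoo[q]; rewrite in_itv /=; exists q. Qed.

Lemma lit_open (l : literal) M (a : M) : lit l a -> exists2 e : R, 0 < e &
  forall a', mdist a a' < e -> lit l a'.
Proof.
case: l => [[[[] k] ns] q] /=.
  move=> /pos_strict[q' qq' pq']; have [e e0 He] := pos_perturb ns (fF k) qq'.
  by exists e => // a' aa'; apply: (He M a a').
move=> [q' qq' npos]; have [r /andP[q'r rq]] := rat_between qq'.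
have [e e0 He] := pos_perturb ns (fF k) q'r; exists e => // a' aa'.
exists r => // pr; apply: npos; apply: (He M a' a) => //.
by rewrite metric_sym.
Qed.

Definition eqtype M N (a : M) (b : N) :=
  forall k ns (q : rat), pos (enumF k) ns (ratr q) a <-> pos (enumF k) ns (ratr q) b.

Lemma eqtype_sym M N (a : M) (b : N) : eqtype a b -> eqtype b a.
Proof. by move=> h k ns q; apply: iff_sym. Qed.

Lemma eqtype_lit M N (a : M) (b : N) l : eqtype a b -> lit l a -> lit l b.
Proof.
move=> ab; case: l => [[[[] k] ns] q] /=; first by move=> /ab.
by move=> [q' qq' np]; exists q' => // /ab.
Qed.

(** As [pos] leaves room in [q], a rational fits into any difference: it gives a positive literal if
    the condition holds at [a], a negative one if it holds at [b], and either stays false around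
    [b]. *)
Lemma eqtype_separation M N (a : M) (b : N) : ~ eqtype a b -> exists2 l, lit l a &
  exists2 e : R, 0 < e & forall b', mdist b b' < e -> ~ lit l b'.
Proof.
move=> nab.
have [k [ns [q h]]] : exists k ns q, ~ (pos (enumF k) ns (ratr q) a <-> pos (enumF k) ns (ratr q) b).
  apply: contrapT => hn; apply: nab => k ns q; apply: contrapT => h; apply: hn.
  by exists k, ns, q.
have [pa|na] := pselect (pos (enumF k) ns (ratr q) a).
  have nb : ~ pos (enumF k) ns (ratr q) b by move=> pb; apply: h.
  have [r qr pr] := pos_strict pa; have [r' /andP[qr' r'r]] := rat_between qr.
  exists (true, k, ns, r'); first exact: pos_mono (ltW r'r) pr.
  have [e e0 He] := pos_perturb ns (fF k) qr'; exists e => // b' bb' /= pb'.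
  by apply: nb; apply: (He N b' b) => //; rewrite metric_sym.
have pb : pos (enumF k) ns (ratr q) b by apply: contrapT => nb; apply: h.
have [r qr pr] := pos_strict pb; have [r' /andP[qr' r'r]] := rat_between qr.
exists (false, k, ns, r'); first by exists q.
have [e e0 He] := pos_perturb ns (fF k) r'r; exists e => // b' bb' /= [r1 r1r' np].
by apply: np; apply: pos_mono (ltW r1r') _; apply: (He N b b').
Qed.

(** Transfer of literals in one direction suffices, since literals come in both polarities. *)
Lemma ulim_eqtype (U : set_system nat) (UU : UltraFilter U) M N (a : M) (b_ : nat -> N) (b : N) :
  ulim U b_ b -> (forall l, lit l a -> U [set m | lit l (b_ m)]) -> eqtype a b.
Proof.
move=> bb la; apply: contrapT => /eqtype_separation[l al [e e0 He]].
have [m [/= h lm]] := @filter_ex _ U _ _ (ultraI UU (bb _ e0) (la l al)).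
by apply: (He (b_ m)) => //; rewrite metric_sym.
Qed.

End existential_types.

(** * Extending types to isomorphisms *)

Section back_and_forth.
Context {R : realType} {L : signature R}.
Implicit Types M N : structure L.
Context (F : fragment L) (enumF : nat -> preformula L).
Hypotheses (enumF_in : forall k, frag_set F (enumF k))
  (enumF_surj : forall p, frag_set F p -> exists k, enumF k = p).

(** Its value is [1 + e - |p - c|]. The threshold is 1 and not 0 because in [pos] it also sets the
    margin, which has to be positive. *)
Definition near_value (p : preformula L) (c e : rat) : preformula L :=
  FAdd FOne (FAdd (FScale e FOne)
    (FMin (FAdd (FScale c FOne) (FScale (-1) p)) (FAdd p (FScale (- c) FOne)))).

Lemma near_value_frag p c e : frag_set F p -> frag_set F (near_value p c e).
Proof.
by move=> Fp; do ?[exact: Fp|exact: frag_one|apply: frag_scale|apply: frag_add|apply: frag_min].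
Qed.

Lemma feval_near_value M (s : nat -> M) p c e :
  (1 < feval s (near_value p c e)) = (`|feval s p - ratr c| < ratr e).
Proof.
rewrite /= !mulr1 rmorphN rmorph1 mulN1r rmorphN /= ltr_norml.
have [h|h] := leP (ratr c - feval s p) (feval s p - ratr c);
  by apply/idP/idP => [?|/andP[? ?]]; [apply/andP; split; lra|lra].
Qed.

Fixpoint conj_formula (ps : nat -> preformula L) (k : nat) : preformula L :=
  if k is j.+1 then FMin (conj_formula ps j) (ps j) else FScale 2 FOne.

Lemma conj_formula_frag ps k : (forall j, frag_set F (ps j)) -> frag_set F (conj_formula ps k).
Proof.
by move=> Fps; elim: k => [|k IH] /=; [apply/frag_scale/frag_one|apply: frag_min].
Qed.

Lemma feval_conj_formula M (s : nat -> M) ps k :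
  1 < feval s (conj_formula ps k) <-> forall j, (j < k)%N -> 1 < feval s (ps j).
Proof.
elim: k => [|k IH] /=; first by rewrite mulr1 ratr_nat; split => // _; lra.
rewrite lt_min; split => [/andP[/IH h hk] j|h].
  by rewrite ltnS leq_eqVlt => /orP[/eqP->//|]; exact: h.
by rewrite h// andbT; apply/IH => j jk; apply: h; exact: ltnW.
Qed.

Lemma feval_uc_eq M (p : preformula L) k : (forall e : R, 0 < e ->
    exists2 d : R, 0 < d & forall M (a b : nat -> M),
    (forall i, (i < k)%N -> mdist (a i) (b i) < d) ->
    `|feval a p - feval b p| <= e) ->
  forall a b : nat -> M, (forall i, (i < k)%N -> a i = b i) -> feval a p = feval b p.
Proof.
move=> Hk a b ab; apply/eqP; rewrite -subr_eq0 -normr_le0; apply/ler_addgt0Pl => e e0.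
rewrite addr0; have [d d0] := Hk e e0; apply => i ik.
by rewrite ab// mdistxx.
Qed.

(** Finite parts of the dense sequence are copied approximately into [N], the conditions on each
    part being packed into one formula. The chain length for [x i] is fixed once for all parts, so
    the copies of [x i] have an ultralimit, and the limits satisfy the formulas exactly. *)
Lemma existential_embedding M N (x : nat -> M) (a : M) (b : N) :
  pseudo_connected M -> dense_seq x ->
  (forall k ns, pos (enumF k) ns 1 a -> pos (enumF k) ns 1 b) ->
  exists2 g : M -> N, embedding g & g a = b.
Proof.
move=> pM dx ab; have [U [UU Uoo]] := free_ultrafilter.
have /choice[n Hn] : forall i, exists n, reach n (1 / n.+1%:R) a (x i).
  by move=> i; exact: pseudo_connected_reach_inv.
pose s : nat -> M := scons a x.
pose l m := mkseq x m; pose ns m := mkseq n m.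
have sE m i : (i <= m)%N -> point_seq a (l m) i = s i.
  by case: i => [//|i] im; rewrite /point_seq /= nth_mkseq.
have eta m : exists e : rat, 0 < (ratr e : R) < m.+1%:R^-1.
  by apply: rat_between; rewrite invr_gt0.
have [e He] := choice eta.
(* Formulas admit rational coefficients only, so a rational stands in for the true value. *)
have /choice[c Hc] : forall mj : nat * nat, exists c : rat,
    `|feval (point_seq a (l mj.1)) (enumF mj.2) - ratr c| < ratr (e mj.1).
  move=> [m j]; have /andP[e0 _] := He m.
  have [|q] := @rat_between R (feval (point_seq a (l m)) (enumF j) - ratr (e m))
    (feval (point_seq a (l m)) (enumF j) + ratr (e m)); first by lra.
  by move=> /andP[? ?]; exists q => /=; rewrite ltr_norml; apply/andP; split; lra.
pose ps m j := near_value (enumF j) (c (m, j)) (e m).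
have Fps m : frag_set F (conj_formula (ps m) m).
  by apply: conj_formula_frag => j; exact: near_value_frag.
have /choice[l' Hl'] : forall m, exists l' : seq N, [/\ size l' = m,
    forall i, (i < m)%N -> reach (n i) (1 / (n i).+1%:R) b (nth b l' i) &
    forall j, (j < m)%N ->
      `|feval (point_seq b l') (enumF j) - ratr (c (m, j))| < ratr (e m)].
  move=> m; have [k kE] := enumF_surj (Fps m).
  have [l' [sl' rl']] : pos (enumF k) (ns m) 1 b.
    apply: ab; rewrite kE; exists (l m); split; first by rewrite !size_mkseq.
      by move=> i; rewrite size_mkseq => im; rewrite !nth_mkseq.
    apply/feval_conj_formula => j jm; rewrite feval_near_value; exact: (Hc (m, j)).
  rewrite kE => /feval_conj_formula h; exists l'; rewrite sl' size_mkseq; split => //.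
    by move=> i im; have := rl' i; rewrite size_mkseq nth_mkseq//; apply.
  by move=> j /h; rewrite feval_near_value.
pose t_ m := point_seq b (l' m).
have /choice[t Ht] : forall i, exists y, ulim U (fun m => t_ m i) y /\ (i = 0%N -> y = b).
  case=> [|i]; first by exists b; split => //; exact: ulim_cst.
  have q0 : 0 < 1 / (n i).+1%:R :> R by rewrite divr_gt0.
  have [|y yl] := reach_ulim UU (n := n i) (t := fun m => t_ m i.+1) q0 (ulim_cst UU b).
    apply: (ultraS UU (ultra_ge Uoo i.+1)) => m im; rewrite /t_ /point_seq /=.
    by have [_ + _] := Hl' m; apply.
  by exists y.
have tE j : feval s (enumF j) = feval t (enumF j).
  have [k Hk] := formula_ucP (frag_formula (enumF_in j)).
  apply/eqP; rewrite -subr_eq0 -normr_le0; apply/ler_addgt0Pl => r r0; rewrite addr0.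
  have r40 : 0 < r / 4 by lra.
  have [d d0 Hd] := Hk _ r40.
  have Ud : U [set m | forall i, (i < k)%N -> mdist (t_ m i) (t i) < d].
    by apply: filter_forall_lt => i _; apply: (Ht i).1.
  have [m km td] := ultra_ex UU Uoo (maxn (maxn k j.+1) (Num.truncn (r / 4)^-1)) Ud.
  move: km; rewrite !geq_max => /andP[/andP[km jm] rm].
  have /andP[e0 em] := He m.
  have er : ratr (e m) < r / 4.
    apply: (lt_le_trans em); rewrite invf_ple ?posrE//.
    apply: (le_trans (ltW (truncnS_gt _))); by rewrite ler_nat.
  have h1 := Hd _ _ _ td.
  have h2 : feval (point_seq a (l m)) (enumF j) = feval s (enumF j).
    apply: (feval_uc_eq Hk) => i ik; apply: sE; apply: leq_trans km; exact: ltnW.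
  have [_ _ /(_ j jm) h3] := Hl' m.
  have := Hc (m, j); rewrite /= h2.
  move: h1 h3; rewrite -/(t_ m) !ler_norml !ltr_norml => /andP[? ?] /andP[? ?] /andP[? ?].
  by apply/andP; split; lra.
have ds : dense_seq s by move=> y r r0; have [i xi] := dx y r r0; exists i.+1.
have [|g eg gs] := dense_embedding (t := t) ds.
  by move=> P ts; have [j <-] := enumF_surj (frag_atom F ts).
by exists g => //; rewrite -[a]/(s 0%N) gs; exact: (Ht 0%N).2.
Qed.

(** Two late iterates near the same limit are near each other, and the isometry [iter m f] can be
    cancelled from both. *)
Lemma isometry_recurrent (U : set_system nat) (UU : UltraFilter U) (Uoo : \oo `<=` U)
    M (f : M -> M) (c : M) :
  (forall x y, mdist (f x) (f y) = mdist x y) ->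
  (exists y, ulim U (fun m => iter m f c) y) ->
  forall r : R, 0 < r -> forall k0, exists2 k, (k0 < k)%N & mdist (iter k f c) c < r.
Proof.
move=> fI [y cy] r r0 k0; have r20 : 0 < r / 2 by lra.
have fIk k u v : mdist (iter k f u) (iter k f v) = mdist u v.
  by elim: k => //= k IH; rewrite fI.
have [m _ /= cm] := ultra_ex UU Uoo 0 (cy _ r20).
have [m' mm' /= cm'] := ultra_ex UU Uoo (m + k0.+1) (cy _ r20).
exists (m' - m)%N; first by rewrite ltn_subRL -addnS.
rewrite -(fIk m) -iterD subnKC ?(leq_trans (leq_addr _ _) mm')//.
have := metric_triangle (iter m' f c) y (iter m f c).
by rewrite (metric_sym y); lra.
Qed.

(** Since [f] may lower [rad], it need not obviously map chains to chains. But some iterate of an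
    interior point [c] returns close to [c], whence [rad c <= rad (f c)], and reachable points stay
    reachable. Then [y] is a limit of points [f (iter k f y)], and an ultralimit of the points
    [iter k f y] is a preimage of [y]. *)
Lemma isometry_fixpoint_surj M (f : M -> M) (a : M) : pseudo_connected M ->
  (forall x y, mdist (f x) (f y) = mdist x y) -> f a = a -> forall y, exists x, f x = y.
Proof.
move=> pM fI fa; have [U [UU Uoo]] := free_ultrafilter.
have rec_ulim n q c : 0 < q -> (forall m, reach n q a (iter m f c)) ->
    exists y, ulim U (fun m => iter m f c) y.
  move=> q0 rc; apply: (reach_ulim UU q0 (ulim_cst UU a) (n := n)).
  by apply: (ultraS UU (ultra_ge Uoo 0)) => m _; exact: rc.
have freach n q t : 0 < q -> reach n q a t -> reach n q a (f t).
  move=> q0; elim: n t => [|n IH] t /=.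
    by have := fI a t; rewrite fa /step => ->.
  move=> [c ac ct]; exists (f c); first exact: IH.
  apply: isometry_step ct => //.
  have rc m : reach n q a (iter m f c) by elim: m => //= m; exact: IH.
  apply/ler_addgt0Pr => e e0.
  have [k k0 kc] := isometry_recurrent UU Uoo fI (rec_ulim n q c q0 rc) e0 0.
  have h1 : rad (iter k f c) <= rad (f c).
    case: k k0 kc => // k _ _; rewrite iterSr; apply: isometry_rad => u v.
    by elim: k => //= k IHk; rewrite fI.
  by have := rad_lip c (iter k f c); rewrite (metric_sym c); lra.
move=> y; have [n [q q0 ay]] := pseudo_connected_reach a y pM.
have ry m : reach n q a (iter m f y) by elim: m => //= m; exact: freach.
have rec_y := isometry_recurrent UU Uoo fI (rec_ulim n q y q0 ry).
have /choice[k Hk] : forall m, exists k, mdist (iter k.+1 f y) y < m.+1%:R^-1.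
  move=> m; have m0 : 0 < m.+1%:R^-1 :> R by rewrite invr_gt0.
  by have [[//|k] _ h] := rec_y _ m0 0%N; exists k.
have [x zx] : exists x, ulim U (fun m => iter (k m) f y) x.
  apply: (reach_ulim UU q0 (ulim_cst UU a) (n := n)).
  by apply: (ultraS UU (ultra_ge Uoo 0)) => m _; exact: ry.
exists x; apply: mdist_positivity; apply/eqP; rewrite eq_le mdist_ge0 andbT.
apply/ler_addgt0Pl => e e0; rewrite addr0; have e20 : 0 < e / 2 by lra.
have [m mE /= hm] := ultra_ex UU Uoo (Num.truncn (e / 2)^-1) (zx _ e20).
have h1 := metric_triangle (f x) (f (iter (k m) f y)) y.
have h2 : mdist (f (iter (k m) f y)) y < m.+1%:R^-1 := Hk m.
have h3 : m.+1%:R^-1 <= e / 2 :> R.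
  rewrite invf_ple ?posrE//.
  by apply: (le_trans (ltW (truncnS_gt _))); rewrite ler_nat.
have h4 := lt_le_trans h2 h3.
by move: h1 h4 hm; rewrite fI (metric_sym x); clear; lra.
Qed.

Lemma eqtype_iso M N (x : nat -> M) (y : nat -> N) (a : M) (b : N) :
  pseudo_connected M -> pseudo_connected N -> dense_seq x -> dense_seq y ->
  eqtype enumF a b -> exists g : M -> N, [/\ embedding g, bijective g & g a = b].
Proof.
move=> pM pN dx dy ab.
have [k ns|g eg ga] := existential_embedding (a := a) (b := b) pM dx.
  by have := (ab k ns 1).1; rewrite rmorph1.
have [k ns|h eh hb] := existential_embedding (a := b) (b := a) pN dy.
  by have := (ab k ns 1).2; rewrite rmorph1.
have sgh : forall v, exists u, (g \o h) u = v.
  apply: (isometry_fixpoint_surj (a := b) pN) => [u v|]; last by rewrite /= hb.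
  by rewrite /= (embedding_dist eg) (embedding_dist eh).
exists g; split => //.
have /choice[g' gg'] : forall v, exists u, g u = v.
  by move=> v; have [u <-] := sgh v; exists (h u).
exists g' => // u; exact/(embedding_inj eg)/gg'.
Qed.

Lemma iso_reach n q M N (g : M -> N) (a t : M) : embedding g -> bijective g ->
  reach n q a t -> reach n q (g a) (g t).
Proof.
move=> eg [g' gg' g'g]; have eg' := embedding_inv eg gg' g'g.
have rg u : rad u <= rad (g u).
  by rewrite -{1}(gg' u); apply: isometry_rad => ? ?; exact: embedding_dist.
elim: n t => [|n IH] t /=; first by apply: isometry_step => // ? ?; exact: embedding_dist.
move=> [c ac ct]; exists (g c); first exact: IH.
by apply: isometry_step ct => // ? ?; exact: embedding_dist.
Qed.

Lemma iso_pos p ns q M N (g : M -> N) (a : M) : embedding g -> bijective g ->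
  pos p ns q a -> pos p ns q (g a).
Proof.
move=> eg bg [l [sl lr lp]]; exists (map g l); split; first by rewrite size_map.
  move=> i iN; rewrite (nth_map a) ?sl//; exact/iso_reach/lr.
have -> : point_seq (g a) (map g l) = g \o point_seq a l.
  apply/funext => -[//|i]; rewrite /point_seq /=.
  have [il|il] := ltnP i (size l); first by rewrite (nth_map a).
  by rewrite !nth_default// size_map.
by rewrite feval_iso//; case: bg => g' _ g'g v; exists (g' v).
Qed.

Lemma iso_eqtype M N (g : M -> N) (a : M) : embedding g -> bijective g ->
  eqtype enumF a (g a).
Proof.
move=> eg bg k ns q; split; first exact: iso_pos.
case: (bg) => g' gg' g'g; rewrite -{2}(gg' a); apply: iso_pos.
  exact: embedding_inv eg gg' g'g.
by exists g.
Qed.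

End back_and_forth.

(** * Clusters modulo automorphisms *)

Section clusters.
Context {R : realType} {L : signature R}.
Context (F : fragment L) (enumF : nat -> preformula L).
Hypotheses (enumF_in : forall k, frag_set F (enumF k))
  (enumF_surj : forall p, frag_set F p -> exists k, enumF k = p).

Notation lit := (lit enumF).
Notation eqtype := (eqtype enumF).

Definition tame (M : structure L) := pseudo_connected M /\ exists x : nat -> M, dense_seq x.

Implicit Types M N Q : structure L.

Definition isom M N (g : M -> N) := embedding g /\ bijective g.

Lemma isom_id M : isom (@id M).
Proof. by split => //; exists id. Qed.

Lemma isom_comp M N Q (g : M -> N) (h : N -> Q) : isom g -> isom h -> isom (h \o g).
Proof. by move=> [? ?] [? ?]; split; [exact: embedding_comp|exact: bij_comp]. Qed.

Lemma isom_inv M N (g : M -> N) : isom g -> exists h : N -> M, [/\ isom h, cancel g h & cancel h g].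
Proof.
move=> [eg [h gh hg]]; exists h; split => //; split; first exact: embedding_inv eg gh hg.
by exists g.
Qed.

Lemma isom_dist M N (g : M -> N) : isom g -> forall x y, mdist (g x) (g y) = mdist x y.
Proof. by move=> [eg _]; exact: embedding_dist. Qed.

Lemma isom_eqtype M N (g : M -> N) (a : M) : isom g -> eqtype a (g a).
Proof. by move=> [? ?]; exact: iso_eqtype. Qed.

Lemma eqtype_isom M N (a : M) (b : N) : tame M -> tame N -> eqtype a b ->
  exists2 g : M -> N, isom g & g a = b.
Proof.
move=> [pM [x dx]] [pN [y dy]] ab.
by have [g [? ? ?]] := eqtype_iso enumF_in enumF_surj pM pN dx dy ab; exists g.
Qed.

Lemma isom_reach n q M N (g : M -> N) (a t : M) : isom g -> reach n q a t -> reach n q (g a) (g t).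
Proof. by move=> [? ?]; exact: iso_reach. Qed.

Lemma isom_rad M N (g : M -> N) (a : M) : isom g -> rad (g a) = rad a.
Proof.
move=> ig; have [h [ih gh hg]] := isom_inv ig; apply/eqP; rewrite eq_le; apply/andP; split.
  by apply: isometry_rad => ? ?; exact: isom_dist.
by rewrite -{1}(gh a); apply: isometry_rad => ? ?; exact: isom_dist.
Qed.

Lemma eqtype_tr M N Q (a : M) (b : N) (c : Q) : eqtype a b -> eqtype b c -> eqtype a c.
Proof. by move=> ab bc k ns q; rewrite ab. Qed.

(** In a tame structure [b'] ranges over the automorphism orbit of [b], by [eqtype_isom]. Types are
    used instead of automorphisms because literals can be tested on a sequence. *)
Definition orb (q : R) M (a b : M) := exists2 b', eqtype b b' & mdist a b' <= q.

Lemma orb_mono q q' M (a b : M) : q <= q' -> orb q a b -> orb q' a b.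
Proof. by move=> qq [b' bb' ab']; exists b' => //; exact: le_trans qq. Qed.

Lemma orb_dist q M (a b : M) : mdist a b <= q -> orb q a b.
Proof. by move=> ab; exists b. Qed.

Lemma orb_eqtype q M (a b c : M) : orb q a b -> eqtype b c -> orb q a c.
Proof. by move=> [b' bb' ab'] bc; exists b' => //; exact: eqtype_tr (eqtype_sym bc) bb'. Qed.

Lemma orb_isom q M N (g : M -> N) (a b : M) : isom g -> orb q a b -> orb q (g a) (g b).
Proof.
move=> ig [b' bb' ab']; exists (g b'); last by rewrite isom_dist.
apply: eqtype_tr (isom_eqtype _ ig); apply: eqtype_tr bb'.
exact/eqtype_sym/isom_eqtype.
Qed.

Lemma orb_aut q M (a b : M) : tame M -> orb q a b -> exists2 g : M -> M, isom g & mdist a (g b) <= q.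
Proof.
by move=> tM [b' /(eqtype_isom tM tM)[g ig <-] ab']; exists g.
Qed.

Lemma orb_trans q q' M (a b c : M) : tame M -> orb q a b -> orb q' b c -> orb (q + q') a c.
Proof.
move=> tM /(orb_aut tM)[g ig ab] /(orb_aut tM)[h ih bc].
exists (g (h c)); first exact: (isom_eqtype c (isom_comp ih ig)).
apply: le_trans (metric_triangle _ (g b) _) _; rewrite lerD//.
by rewrite isom_dist.
Qed.

Lemma orb_sym q M (a b : M) : tame M -> orb q a b -> orb q b a.
Proof.
move=> tM /(orb_aut tM)[g ig ab]; have [h [ih gh hg]] := isom_inv ig.
exists (h a); first exact: isom_eqtype.
by rewrite -(isom_dist ig) hg metric_sym.
Qed.

Definition lits (W : seq literal) M (a : M) := forall l, l \in W -> lit l a.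

Lemma lits_open W M (a : M) : lits W a -> exists2 e : R, 0 < e &
  forall a', mdist a a' < e -> lits W a'.
Proof.
elim: W => [|l W IH] Wa; first by exists 1.
have [l' l'W|e e0 He] := IH; first by apply: Wa; rewrite inE l'W orbT.
have [|e' e'0 He'] := lit_open enumF_in (l := l) (a := a).
  by apply: Wa; rewrite inE eqxx.
exists (Num.min e e'); first by rewrite lt_min e0.
move=> a'; rewrite lt_min => /andP[/He h1 /He' h2] l'.
by rewrite inE => /orP[/eqP->//|]; exact: h1.
Qed.

Lemma lits_eqtype W M N (a : M) (b : N) : eqtype a b -> lits W a -> lits W b.
Proof. by move=> ab Wa l /Wa; exact: eqtype_lit. Qed.

Definition true_lits M (a : M) (m : nat) : seq literal :=
  [seq l <- pmap unpickle (iota 0 m) | `[< lit l a >]].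

Lemma true_litsP M (a : M) m : lits (true_lits a m) a.
Proof. by move=> l; rewrite mem_filter => /andP[/asboolP]. Qed.

Lemma mem_true_lits M (a : M) m l : lit l a -> (pickle l < m)%N -> l \in true_lits a m.
Proof.
move=> la lm; rewrite mem_filter; apply/andP; split; first exact/asboolP.
rewrite mem_pmap; apply/mapP; exists (pickle l); last by rewrite pickleK.
by rewrite mem_iota.
Qed.

Lemma true_lits_ulim (U : set_system nat) (UU : UltraFilter U) (Uoo : \oo `<=` U)
    M N (a : M) (b_ : nat -> N) (b : N) :
  ulim U b_ b -> (forall m, lits (true_lits a m) (b_ m)) -> eqtype a b.
Proof.
move=> bb h; apply: (ulim_eqtype enumF_in UU bb) => l la.
apply: (ultraS UU (ultra_ge Uoo (pickle l).+1)) => m lm.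
by apply: h; apply: mem_true_lits.
Qed.

(** The slack [d] on both sides makes the condition open; [4 * r < rad a] keeps the balls around [a]
    that occur in limit arguments inside compact ones. *)
Definition core (U : seq literal) (r : rat) M (a : M) :=
  [/\ 0 < ratr r :> R, 4 * ratr r < rad a, lits U a &
    exists2 d : R, 0 < d & forall b, mdist a b < ratr r + d -> lits U b -> orb (ratr r / 4 - d) a b].

Lemma orb_perturb q e e' M (a a' b b' : M) : tame M -> orb q a b -> mdist a a' <= e ->
  mdist b b' <= e' -> orb (q + e + e') a' b'.
Proof.
move=> tM ab aa bb; rewrite (addrC q); apply: orb_trans (orb_dist bb) => //.
apply: orb_trans ab => //; apply: orb_dist; by rewrite metric_sym.
Qed.

Lemma core_open U r M (a : M) : tame M -> core U r a -> exists2 e : R, 0 < e &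
  forall a', mdist a a' < e -> core U r a'.
Proof.
move=> tM [r0 ra Ua [d d0 Hd]]; have [e e0 He] := lits_open Ua.
(* Half of the slack pays for moving [a], the other half remains as slack at [a']. *)
exists (Num.min e (Num.min (d / 2) (rad a - 4 * ratr r))).
  by rewrite !lt_min e0 /=; apply/andP; split; lra.
move=> a'; rewrite !lt_min => /and3P[/He Ua' ad ar]; split => //.
  by have := rad_lip a a'; lra.
exists (d / 2); first by lra.
move=> b a'b Ub; have ab : orb (ratr r / 4 - d) a b.
  by apply: Hd => //; have := metric_triangle a a' b; lra.
apply: orb_mono (orb_perturb tM ab (ltW ad) (_ : mdist b b <= 0)); first by lra.
by rewrite mdistxx.
Qed.

(** Satisfying [U] depends on the type only, so the copy of [b] near [a] falls under the last clause
    of [core U r a]. *)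
Lemma core_orb U r M (a b : M) : core U r a -> core U r b -> orb (ratr r) a b ->
  orb (ratr r / 4) a b.
Proof.
move=> [r0 _ _ [d d0 Hd]] [_ _ Ub _] [b' bb' ab'].
have h : orb (ratr r / 4 - d) a b'.
  by apply: Hd; [lra|exact: lits_eqtype Ub].
by apply: orb_mono (orb_eqtype h (eqtype_sym bb')); lra.
Qed.

Lemma core_isom U r M N (g : M -> N) (a : M) : isom g -> core U r a -> core U r (g a).
Proof.
move=> ig; have [h [ih gh hg]] := isom_inv ig.
move=> [r0 ra Ua [d d0 Hd]]; split => //; first by rewrite isom_rad.
  exact/lits_eqtype/Ua/isom_eqtype.
exists d => // b ab Ub; rewrite -(hg b); apply: (orb_isom ig).
apply: Hd; first by rewrite -(isom_dist ig) hg.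
exact/lits_eqtype/Ub/isom_eqtype.
Qed.

(** If all finite sets of true literals failed, points [b m] near [a] would share more and more of
    its type at orbit distance above [r / 8]; but their limit has the type of [a]. *)
Lemma core_exists M (a : M) : tame M -> exists U r, core U r a.
Proof.
move=> tM; have [W [WW Woo]] := free_ultrafilter.
have r0 := rad_gt0 a tM.1.
have [|r /andP[r0' rr]] := @rat_between R 0 (rad a / 4); first by lra.
pose rr' : R := ratr r.
apply: contrapT => ncore.
have /choice[b Hb] : forall m, exists b, [/\ mdist a b < rr' + rr' / 8,
    lits (true_lits a m) b & ~ orb (rr' / 4 - rr' / 8) a b].
  move=> m; apply: contrapT => nb; apply: ncore; exists (true_lits a m), r; split => //.
  - by lra.
  - exact: true_litsP.
  - exists (rr' / 8); first by rewrite /rr'; lra.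
    move=> b ab Ub; apply: contrapT => nab; apply: nb; by exists b.
have [y by_] : exists y, ulim W b y.
  apply: (@ultra_rad _ _ W WW M a (2 * rr')); first by rewrite /rr'; lra.
  apply: (ultraS WW (ultra_ge Woo 0)) => m _ /=.
  by have [h _ _] := Hb m; move: h; rewrite /rr'; lra.
have ay : eqtype a y.
  by apply: (true_lits_ulim WW Woo by_) => m; case: (Hb m).
have [|m _ /= hm] := ultra_ex WW Woo 0 (by_ (rr' / 8) _); first by rewrite /rr'; lra.
case: (Hb m) => _ _; apply.
have aay : orb 0 a y by exists a; [exact: eqtype_sym|rewrite mdistxx].
have h := orb_perturb tM aay (_ : mdist a a <= 0) (_ : mdist y (b m) <= rr' / 8).
apply: orb_mono (h _ _); first by rewrite /rr'; lra.
  by rewrite mdistxx.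
by rewrite metric_sym ltW.
Qed.

(** These bits describe the cluster: any of its points may satisfy [W], so the representative does
    not matter. *)
Definition vbit U r M (a : M) (W : seq literal) :=
  exists c : M, [/\ core U r c, orb (ratr r) a c & lits W c].

(** The two ends may be moved by different automorphisms, which makes this a relation between
    clusters. *)
Definition link n U r M (a : M) U' r' (b : M) :=
  exists c c' : M, [/\ core U r c, orb (ratr r) a c, core U' r' c', orb (ratr r') b c' &
    reach n (1 / n.+1%:R) c c'].

Lemma core_orb_trans U r M (a b c : M) : tame M -> core U r a -> core U r b -> core U r c ->
  orb (ratr r) a b -> orb (ratr r) b c -> orb (ratr r) a c.
Proof.
move=> tM ca cb cc ab bc; have h := orb_trans tM (core_orb ca cb ab) (core_orb cb cc bc).
by apply: orb_mono h; case: ca => ? _ _ _; lra.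
Qed.

Lemma core_orb_refl U r M (a : M) : core U r a -> orb (ratr r) a a.
Proof. by move=> [r0 _ _ _]; apply: orb_dist; rewrite mdistxx; exact: ltW. Qed.

Lemma vbit_sim U r M N (g : M -> N) (a : M) (b : N) W : tame N -> isom g ->
  core U r a -> core U r b -> orb (ratr r) (g a) b -> vbit U r a W -> vbit U r b W.
Proof.
move=> tN ig ca cb gab [c [cc ac Wc]]; exists (g c).
have cgc := core_isom ig cc; split => //.
  apply: (core_orb_trans tN cb (core_isom ig ca)) => //; first exact: orb_sym.
  exact: orb_isom.
exact/lits_eqtype/Wc/isom_eqtype.
Qed.

Lemma link_sim n U r U' r' M N (g : M -> N) (a b : M) (a' b' : N) : tame N -> isom g ->
  core U r a -> core U r a' -> orb (ratr r) (g a) a' ->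
  core U' r' b -> core U' r' b' -> orb (ratr r') (g b) b' ->
  link n U r a U' r' b -> link n U r a' U' r' b'.
Proof.
move=> tN ig ca ca' aa' cb cb' bb' [c [d [cc ac cd bd cd']]]; exists (g c), (g d).
have cgc := core_isom ig cc; have cgd := core_isom ig cd; split => //.
- apply: (core_orb_trans tN ca' (core_isom ig ca)) => //; first exact: orb_sym.
  exact: orb_isom.
- apply: (core_orb_trans tN cb' (core_isom ig cb)) => //; first exact: orb_sym.
  exact: orb_isom.
- exact: isom_reach.
Qed.

(** The type of [a] is approximated in the cluster of [b], and copies of the approximations lie
    within [r / 4] of [b]. They have a limit of the type of [a], which [eqtype_isom] turns into an
    isomorphism. *)
Lemma vbit_det U r M N (a : M) (b : N) : tame M -> tame N -> core U r a -> core U r b ->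
  (forall W, vbit U r a W -> vbit U r b W) ->
  exists2 g : M -> N, isom g & orb (ratr r) (g a) b.
Proof.
move=> tM tN ca cb ab; have [W [WW Woo]] := free_ultrafilter.
have [r0 rb _ _] := cb; pose rr : R := ratr r.
have /choice[c Hc] : forall m, exists c, lits (true_lits a m) c /\ mdist b c <= rr / 4.
  move=> m; have [|c [cc bc ac]] := ab (true_lits a m).
    by exists a; split => //; [exact: core_orb_refl ca|exact: true_litsP].
  have [c' cc' bc'] := core_orb cb cc bc.
  by exists c'; split => //; exact: lits_eqtype ac.
have [y cy] : exists y, ulim W c y.
  apply: (@ultra_rad _ _ W WW N b rr); first by rewrite /rr; lra.
  apply: (ultraS WW (ultra_ge Woo 0)) => m _ /=.
  by have [_] := Hc m; rewrite /rr; lra.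
have ay : eqtype a y by apply: (true_lits_ulim WW Woo cy) => m; case: (Hc m).
have [g ig ga] := eqtype_isom tM tN ay; exists g => //; apply: orb_dist; rewrite ga.
have [|m _ /= hm] := ultra_ex WW Woo 0 (cy (rr / 4) _); first by rewrite /rr; lra.
have [_ bc] := Hc m; have := metric_triangle y (c m) b.
by move: hm bc; rewrite (metric_sym y (c m)) (metric_sym (c m) b) /rr; lra.
Qed.

Lemma link_exists U r U' r' M (a b : M) : tame M -> core U r a -> core U' r' b ->
  exists n, link n U r a U' r' b.
Proof.
move=> tM ca cb; have [n h] := pseudo_connected_reach_inv a b 1 tM.1.
by exists n, a, b; split => //; [exact: core_orb_refl ca|exact: core_orb_refl cb].
Qed.

(* Modulo automorphisms the clusters linked to a given one at a fixed stage meet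
   a compact set, and they are uniformly separated. *)
Lemma link_isolated n U r U' r' M (a : M) (b : nat -> M) : tame M -> core U r a ->
  (forall m, core U' r' (b m) /\ link n U r a U' r' (b m)) ->
  exists m0, forall k, exists2 m, (k <= m)%N & orb (ratr r') (b m0) (b m).
Proof.
move=> tM ca Hb; have [W [WW Woo]] := free_ultrafilter.
have /choice[t Ht] : forall m, exists ct : M * M,
    [/\ mdist a ct.1 <= ratr r / 4, reach n (1 / n.+1%:R) ct.1 ct.2,
      core U' r' ct.2 & orb (ratr r') (b m) ct.2].
  move=> m; have [cbm [c [c' [cc ac cc' bc' cr]]]] := Hb m.
  (* An automorphism brings the start of the chain into a compact ball around [a]; applied to the
     end as well, it preserves the chain and the cluster of the end. *)
  have [g ig acg] := orb_aut tM (core_orb ca cc ac).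
  exists (g c, g c'); split => //=; [exact: isom_reach|exact: core_isom|].
  apply: orb_eqtype bc' _; exact: isom_eqtype.
have [r0 ra _ _] := ca.
have [y cy] : exists y, ulim W (fun m => (t m).1) y.
  apply: (@ultra_rad _ _ W WW M a (ratr r)); first by lra.
  apply: (ultraS WW (ultra_ge Woo 0)) => m _ /=.
  by have [? _ _ _] := Ht m; lra.
have [z tz] : exists z, ulim W (fun m => (t m).2) z.
  apply: (reach_ulim WW _ cy (n := n) (q := 1 / n.+1%:R)); first by rewrite divr_gt0.
  by apply: (ultraS WW (ultra_ge Woo 0)) => m _ /=; have [] := Ht m.
have [[r'0 _ _ _] _] := Hb 0%N.
have r'20 : 0 < ratr r' / 2 :> R by lra.
(* Ends closer than [r' / 2] to the limit are within [r'] of each other, hence in one cluster. *)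
have [m0 _ /= zm0] := ultra_ex WW Woo 0 (tz _ r'20).
exists m0 => k; have [m km /= zm] := ultra_ex WW Woo k (tz _ r'20).
exists m => //; have [_ _ c0 bt0] := Ht m0; have [_ _ c1 bt1] := Ht m.
have tt : orb (ratr r') (t m0).2 (t m).2.
  apply: orb_dist; have := metric_triangle (t m0).2 z (t m).2.
  by rewrite (metric_sym z); lra.
apply: (core_orb_trans tM (Hb m0).1 c0 (Hb m).1 bt0).
apply: (core_orb_trans tM c0 c1 (Hb m).1 tt); exact: orb_sym.
Qed.

End clusters.

(** * Canonical re-enumerations of relational states *)

Section sigma_algebra_predicates.
Context {T : Type} (S : set (set T)) (sS : sigma_algebra setT S).

Lemma sigma_ext (P Q : T -> Prop) : (forall t, P t <-> Q t) -> S [set t | P t] -> S [set t | Q t].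
Proof.
by move=> PQ; have -> : [set t | Q t] = [set t | P t] by apply/seteqP; split => t /PQ.
Qed.

Lemma sigma_not (P : T -> Prop) : S [set t | P t] -> S [set t | ~ P t].
Proof. by case: sS => _ h _ /h; rewrite setTD. Qed.

Lemma sigma_exists_nat (P : nat -> T -> Prop) :
  (forall n, S [set t | P n t]) -> S [set t | exists n, P n t].
Proof.
case: sS => _ _ h /h; apply: (@sigma_ext (fun t => (\bigcup_n [set t | P n t]) t)) => t.
by split=> [[n _ ?]|[n ?]]; exists n.
Qed.

Lemma sigma_const (P : Prop) : S [set t | P].
Proof.
case: sS => h0 hD _; have [p|np] := pselect P.
  by have := hD _ h0; rewrite setD0; apply: (@sigma_ext setT).
by move: h0; apply: (@sigma_ext set0).
Qed.

Lemma sigma_exists (I : countType) (P : I -> T -> Prop) :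
  (forall i, S [set t | P i t]) -> S [set t | exists i, P i t].
Proof.
move=> h; pose Q n t := if unpickle n is Some i then P i t else False.
have : S [set t | exists n, Q n t].
  apply: sigma_exists_nat => n; rewrite /Q; case: unpickle => [i|] //.
  exact: sigma_const.
apply: sigma_ext => t; split => [[n]|[i Pi]].
  by rewrite /Q; case: unpickle => // i ?; exists i.
by exists (pickle i); rewrite /Q pickleK.
Qed.

Lemma sigma_forall (I : countType) (P : I -> T -> Prop) :
  (forall i, S [set t | P i t]) -> S [set t | forall i, P i t].
Proof.
move=> h; have := sigma_not (sigma_exists (fun i => sigma_not (h i))).
apply: sigma_ext => t; split; last by move=> Pt [i]; apply.
by move=> nP i; apply: contrapT => nPi; apply: nP; exists i.
Qed.

Lemma sigma_and (P Q : T -> Prop) :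
  S [set t | P t] -> S [set t | Q t] -> S [set t | P t /\ Q t].
Proof.
move=> hP hQ; have : S [set t | forall b : bool, if b then P t else Q t].
  by apply: sigma_forall => -[].
by apply: sigma_ext => t; split => [h|[? ?] []//]; split; [exact: (h true)|exact: (h false)].
Qed.

Lemma sigma_or (P Q : T -> Prop) :
  S [set t | P t] -> S [set t | Q t] -> S [set t | P t \/ Q t].
Proof.
move=> hP hQ; have : S [set t | exists b : bool, if b then P t else Q t].
  by apply: sigma_exists => -[].
apply: sigma_ext => t; split => [[[] ?]|[?|?]]; [by left|by right|by exists true|by exists false].
Qed.

Lemma sigma_imp (P Q : T -> Prop) :
  S [set t | P t] -> S [set t | Q t] -> S [set t | P t -> Q t].
Proof.
move=> hP hQ; apply: sigma_ext (sigma_or (sigma_not hP) hQ) => t; split.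
  by move=> [h|h] // /h.
by move=> h; have [/h|] := pselect (P t); [right|left].
Qed.

Lemma sigma_iff (P Q : T -> Prop) :
  S [set t | P t] -> S [set t | Q t] -> S [set t | P t <-> Q t].
Proof. by move=> hP hQ; apply: sigma_and; exact: sigma_imp. Qed.

End sigma_algebra_predicates.

(* A state codes a countable family of points of the Cantor space together with
   countably many binary relations on its index set: [s 0 i] is the [i]-th point
   and [s m.+1] the [m]-th relation. *)
Definition state := nat -> nat -> nat -> Prop.

Definition isolating (s : state) (i m : nat) (B : seq bool) (j : nat) : Prop :=
  [/\ s m.+1 i j, (forall w, (w < size B)%N -> (nth false B w <-> s 0 j w)) &
    forall k, s m.+1 i k -> (forall w, (w < size B)%N -> (nth false B w <-> s 0 k w)) ->
      forall w, s 0 k w <-> s 0 j w].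

(* [entry s i K] are the indices named by [K] from the base point [i]: keys name
   points that are isolated by finitely many bits among those related to [i]. *)
Definition entry (s : state) (i K j : nat) : Prop :=
  if K is K'.+1 then
    if unpickle K' is Some (m, B) then
      isolating s i m B j \/ (~ (exists j', isolating s i m B j') /\ j = i)
    else j = i
  else j = i.

Definition canon (s : state) (i : nat) : state := fun m K K' =>
  if m is _.+1 then exists j j', [/\ entry s i K j, entry s i K' j' & s m j j']
  else exists j, entry s i K j /\ s 0 j K'.

(** Equality of the coded families with their relations, regardless of the enumerations;
    [similar s s] says that the relations depend on points and not on indices. *)
Definition similar (s t : state) :=
  [/\ forall i, exists j, s 0 i = t 0 j, forall j, exists i, s 0 i = t 0 j &
    forall m i i' j j', s 0 i = t 0 j -> s 0 i' = t 0 j' -> s m.+1 i i' <-> t m.+1 j j'].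

(** Exactly what gives every point a key from every base point: some relation leads to it, and
    finitely many bits isolate it there. *)
Definition determined (s : state) :=
  [/\ similar s s, forall i j, exists m, s m.+1 i j &
    forall m i j, s m.+1 i j -> exists n, forall k, s m.+1 i k ->
      (forall w, (w < n)%N -> (s 0 k w <-> s 0 j w)) -> s 0 k = s 0 j].

Lemma similar_sym s t : similar s t -> similar t s.
Proof.
move=> [h1 h2 h3]; split => [j|i|m j j' i i' /esym ij /esym ij'].
- by have [i] := h2 j; exists i.
- by have [j] := h1 i; exists j.
- by apply: iff_sym; exact: h3.
Qed.

Lemma entry_total s i K : exists j, entry s i K j.
Proof.
case: K => [|K] /=; first by exists i.
case: unpickle => [[m B]|]; last by exists i.
by have [[j ?]|?] := pselect (exists j, isolating s i m B j); [exists j; left|exists i; right].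
Qed.

Lemma entry_uniq s i K j j' : entry s i K j -> entry s i K j' -> s 0 j = s 0 j'.
Proof.
case: K => [|K] /=; first by move=> -> ->.
case: unpickle => [[m B]|]; last by move=> -> ->.
move=> [ij|[nex ->]] [ij'|[nex' ->]] //.
- case: ij => i1 i2 i3; case: ij' => i1' i2' i3'; apply/funext => w; apply/propext.
  exact: i3'.
- by exfalso; apply: nex'; exists j.
- by exfalso; apply: nex; exists j'.
Qed.

Lemma isolating_similar s t i i' m B j : similar s t -> s 0 i = t 0 i' ->
  isolating s i m B j -> exists2 j', isolating t i' m B j' & s 0 j = t 0 j'.
Proof.
move=> [h1 h2 h3] ii' [k1 k2 k3]; have [j' jj'] := h1 j; exists j' => //; split.
- exact/(h3 _ _ _ _ _ ii' jj').
- by rewrite -jj'.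
- move=> l' il' Bl'; have [l ll'] := h2 l'; rewrite -ll' -jj' in Bl' *.
  by apply: k3 => //; apply/(h3 _ _ _ _ _ ii' ll').
Qed.

Lemma entry_similar s t i i' K j : similar s t -> s 0 i = t 0 i' ->
  entry s i K j -> exists2 j', entry t i' K j' & s 0 j = t 0 j'.
Proof.
move=> st ii'; case: K => [|K] /=; first by move=> ->; exists i'.
case: unpickle => [[m B]|]; last by move=> ->; exists i'.
move=> [/(isolating_similar st ii')[j' ij' jj']|[nex ->]]; first by exists j'; [left|].
exists i' => //; right; split => // -[j' ij']; apply: nex.
have [k ik _] := isolating_similar (similar_sym st) (esym ii') ij'.
by exists k.
Qed.

Lemma canon_row s i K j : entry s i K j -> canon s i 0 K = s 0 j.
Proof.
move=> Kj; apply/funext => w; apply/propext; split => [[j' [Kj' j'w]]|jw].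
  by rewrite (entry_uniq Kj Kj').
by exists j.
Qed.

(** Keys, including the failure to isolate, are interpreted through points and relations alone, so
    the indices leave no trace. *)
Lemma canon_similar s t i i' : similar s t -> s 0 i = t 0 i' -> canon s i = canon t i'.
Proof.
move=> st ii'; have row K : canon s i 0 K = canon t i' 0 K.
  have [j Kj] := entry_total s i K; have [j' Kj' jj'] := entry_similar st ii' Kj.
  by rewrite (canon_row Kj) (canon_row Kj').
have h3 : forall m i i' j j', s 0 i = t 0 j -> s 0 i' = t 0 j' -> s m.+1 i i' <-> t m.+1 j j'.
  by case: st.
apply/funext => -[|m]; first exact/funext.
apply/funext => K; apply/funext => K'; apply/propext; split=> -[j [j' [Kj Kj' jj']]].
  have [k Kk jk] := entry_similar st ii' Kj; have [k' Kk' jk'] := entry_similar st ii' Kj'.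
  by exists k, k'; split => //; apply/(h3 _ _ _ _ _ jk jk').
have st' := similar_sym st; have i'i := esym ii'.
have [k Kk jk] := entry_similar st' i'i Kj; have [k' Kk' jk'] := entry_similar st' i'i Kj'.
by exists k, k'; split => //; apply/(h3 _ _ _ _ _ (esym jk) (esym jk')).
Qed.

Lemma entry_cover s i : determined s -> forall j, exists2 K, entry s i K j & canon s i 0 K = s 0 j.
Proof.
move=> [_ hd he] j; have [m ij] := hd i j; have [n hn] := he m i j ij.
pose B := mkseq (fun w => `[< s 0 j w >]) n.
have iso : isolating s i m B j.
  split => // [w|k ik Bk w].
    by rewrite size_mkseq => wn; rewrite nth_mkseq//; split => /asboolP.
  rewrite (hn k ik)// => w' wn; have := Bk w'; rewrite size_mkseq => /(_ wn).
  by rewrite nth_mkseq// => <-; split => /asboolP.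
have Kj : entry s i (pickle (m, B)).+1 j by rewrite /= pickleK; left.
by exists (pickle (m, B)).+1 => //; exact: canon_row.
Qed.

Lemma similar_canon s i : determined s -> similar (canon s i) s.
Proof.
move=> ds; have [[_ _ h3] _ _] := ds; split => [K|j|m K K' j j' Kj Kj'].
- by have [j Kj] := entry_total s i K; exists j; exact: canon_row.
- by have [K _ Kj] := entry_cover i ds j; exists K.
- split => [[k [k' [Kk Kk' kk']]]|jj'].
    by apply/(h3 _ k k') => //; rewrite -?Kj -?Kj'; apply/esym/canon_row.
  have [k Kk] := entry_total s i K; have [k' Kk'] := entry_total s i K'.
  exists k, k'; split => //; apply/(h3 _ _ _ j j') => //.
    by rewrite -Kj; apply/esym/canon_row.
  by rewrite -Kj'; apply/esym/canon_row.
Qed.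

(** As [canon s i] is similar to [s], rebasing it forgets [i]; so every rebasing of a canonical
    state is again one of the countably many [canon s j]. *)
Lemma canon_canon s i K j : determined s -> entry s i K j ->
  canon (canon s i) K = canon s j.
Proof. by move=> ds Kj; apply: canon_similar; [exact: similar_canon|exact: canon_row]. Qed.

(** Stated for arbitrary states with countable quantifiers, so that it is Borel. The first two
    clauses put each state among its own rebasings, which makes the classes countable. *)
Definition canon_equiv (s t : state) := [/\ exists k, s = canon s k, exists k, t = canon t k,
  forall k, exists l, canon s k = canon t l & forall l, exists k, canon s k = canon t l].

Lemma canon_equiv_canon s t i j : determined s -> determined t -> similar s t ->
  canon_equiv (canon s i) (canon t j).
Proof.
have self u k : determined u -> exists l, canon u k = canon (canon u k) l.
  by move=> du; exists 0%N; rewrite (canon_canon (K := 0) (j := k)).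
have half u v k l : determined u -> determined v -> similar u v ->
    forall K, exists K', canon (canon u k) K = canon (canon v l) K'.
  move=> du dv uv K; have [p Kp] := entry_total u k K.
  have [h1 _ _] := uv; have [p' pp'] := h1 p.
  have [K' Kp' _] := entry_cover l dv p'; exists K'.
  by rewrite (canon_canon du Kp) (canon_canon dv Kp'); exact: canon_similar.
move=> ds dt st; split; [exact: self|exact: self|exact: half|].
by move=> l; have [k] := half t s j i dt ds (similar_sym st) l; exists k.
Qed.

Lemma canon_equiv_row s t i j : canon_equiv (canon s i) (canon t j) ->
  exists k l, s 0 k = t 0 l.
Proof.
move=> [_ _ /(_ 0%N)[l e] _]; have [k Kk] := entry_total t j l.
exists i, k; rewrite -(canon_row (s := s) (i := i) (K := 0) (j := i))// -(canon_row Kk).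
rewrite -(canon_row (s := canon s i) (i := 0) (K := 0) (j := 0))//.
by rewrite e; apply: (canon_row (s := canon t j) (i := l) (K := 0) (j := l)).
Qed.

Lemma canon_equiv_sym s t : canon_equiv s t -> canon_equiv t s.
Proof.
by move=> [h1 h2 h3 h4]; split => // [k|l]; [have [l] := h4 k|have [k] := h3 l];
  [exists l|exists k].
Qed.

Lemma canon_equiv_trans s t u : canon_equiv s t -> canon_equiv t u -> canon_equiv s u.
Proof.
move=> [h1 h2 h3 h4] [g1 g2 g3 g4]; split => // [k|l].
  by have [l ->] := h3 k; exact: g3.
by have [k <-] := g4 l; exact: h4.
Qed.

Lemma canon_equiv_canonE s t : canon_equiv s t -> exists k, t = canon s k.
Proof. by move=> [_ [l tl] _ /(_ l)[k e]]; exists k; rewrite {1}tl e. Qed.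

Section canon_measurable.
Context {T : Type} (S : set (set T)) (sS : sigma_algebra setT S) (s : T -> state).
Hypothesis mS : forall m i j, S [set t | s t m i j].

Lemma isolating_measurable i m B j : S [set t | isolating (s t) i m B j].
Proof.
have pref k : S [set t | forall w, (w < size B)%N -> (nth false B w <-> s t 0 k w)].
  apply: (sigma_forall sS) => w; apply: (sigma_imp sS); first exact: sigma_const.
  by apply: (sigma_iff sS) => //; exact: sigma_const.
have : S [set t | s t m.+1 i j /\ ((forall w, (w < size B)%N -> (nth false B w <-> s t 0 j w)) /\
    forall k, s t m.+1 i k -> (forall w, (w < size B)%N -> (nth false B w <-> s t 0 k w)) ->
      forall w, s t 0 k w <-> s t 0 j w)].
  apply: (sigma_and sS) => //; apply: (sigma_and sS) => //.
  apply: (sigma_forall sS) => k; apply: (sigma_imp sS) => //; apply: (sigma_imp sS) => //.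
  by apply: (sigma_forall sS) => w; exact: sigma_iff.
by apply: sigma_ext => t; split => [[? [? ?]]|[? ? ?]]; split.
Qed.

Lemma entry_measurable i K j : S [set t | entry (s t) i K j].
Proof.
case: K => [|K] /=; first exact: sigma_const.
case: unpickle => [[m B]|]; last exact: sigma_const.
apply: (sigma_or sS); first exact: isolating_measurable.
apply: (sigma_and sS); last exact: sigma_const.
apply/(sigma_not sS)/(sigma_exists sS) => j'; exact: isolating_measurable.
Qed.

Lemma canon_measurable i m K K' : S [set t | canon (s t) i m K K'].
Proof.
case: m => [|m] /=.
  apply: (sigma_exists sS) => j; apply: (sigma_and sS) => //; exact: entry_measurable.
apply: (sigma_exists sS) => j; apply: (sigma_exists sS) => j'.
have : S [set t | entry (s t) i K j /\ (entry (s t) i K' j' /\ s t m.+1 j j')].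
  by do 2![apply: (sigma_and sS); first exact: entry_measurable].
by apply: sigma_ext => t; split => [[? [? ?]]|[? ? ?]]; split.
Qed.

End canon_measurable.

(** * Digits *)

Section cantor_coding.
Context {R : realType}.
Implicit Types (b : nat -> bool) (y : R).

(** Ternary expansions with digits 0 and 2, that is, the middle-thirds Cantor set, where expansions
    are unique. *)
Definition digit_sum b (n : nat) : R := \sum_(k < n) (2 * (b k)%:R / 3 ^+ k.+1).

Definition encode b : R := sup (range (digit_sum b)).

(** On the Cantor set this is the shift; [1/2] lies in the removed middle third and tells the first
    digit. *)
Definition unfold_digit y : R := if 2^-1 < y then 3 * y - 2 else 3 * y.

Definition digit (k : nat) y : bool := 2^-1 < iter k unfold_digit y.

Lemma digit_sumS b n : digit_sum b n.+1 = 2 * (b 0%N)%:R / 3 + digit_sum (b \o S) n / 3.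
Proof.
rewrite /digit_sum big_ord_recl /= expr1; congr (_ + _); rewrite mulr_suml.
apply: eq_bigr => k _ /=; rewrite /bump /= add1n exprS invfM.
by rewrite mulrA mulrAC.
Qed.

Lemma digit_sum_ge0 b n : 0 <= digit_sum b n.
Proof. by apply: sumr_ge0 => k _; rewrite !mulr_ge0// invr_ge0 exprn_ge0. Qed.

Lemma digit_sum_le1 b n : digit_sum b n <= 1.
Proof.
elim: n b => [|n IH] b; first by rewrite /digit_sum big_ord0.
by rewrite digit_sumS; have := IH (b \o S); case: (b 0%N); rewrite /= ?mulr1n ?mulr0n; lra.
Qed.

Lemma digit_sum_has_sup b : has_sup (range (digit_sum b)).
Proof.
split; first by exists (digit_sum b 0), 0%N.
by exists 1 => _ [n _ <-]; exact: digit_sum_le1.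
Qed.

Lemma encode_gt b q : q < encode b <-> exists n, q < digit_sum b n.
Proof.
split=> [/(sup_gt (digit_sum_has_sup b).1)[_ [n _ <-]]|[n qn]]; first by exists n.
apply: (lt_le_trans qn); apply: ub_le_sup; first exact: (digit_sum_has_sup b).2.
by exists n.
Qed.

Lemma encode_itv b : 0 <= encode b <= 1.
Proof.
apply/andP; split.
  apply: (le_trans (digit_sum_ge0 b 0)); apply: ub_le_sup; last by exists 0%N.
  exact: (digit_sum_has_sup b).2.
apply: ge_sup; first by case: (digit_sum_has_sup b).
by move=> _ [n _ <-]; exact: digit_sum_le1.
Qed.

Lemma encodeS b : encode b = 2 * (b 0%N)%:R / 3 + encode (b \o S) / 3.
Proof.
apply/eqP; rewrite eq_le; apply/andP; split.
  apply: ge_sup; first by case: (digit_sum_has_sup b).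
  move=> _ [[|n] _ <-].
    rewrite /digit_sum big_ord0; have /andP[? _] := encode_itv (b \o S).
    by case: (b 0%N); rewrite /= ?mulr1n ?mulr0n; lra.
  rewrite digit_sumS; have : digit_sum (b \o S) n <= encode (b \o S).
    by apply: ub_le_sup; [exact: (digit_sum_has_sup _).2|exists n].
  lra.
rewrite leNgt; apply/negP => h.
have /encode_gt[n] : (encode b - 2 * (b 0%N)%:R / 3) * 3 < encode (b \o S) by lra.
have : digit_sum b n.+1 <= encode b.
  by apply: ub_le_sup; [exact: (digit_sum_has_sup _).2|exists n.+1].
rewrite digit_sumS; lra.
Qed.

Lemma unfold_digit_encode b : unfold_digit (encode b) = encode (b \o S).
Proof.
rewrite /unfold_digit encodeS; have /andP[? ?] := encode_itv (b \o S).
by case: (b 0%N); rewrite /= ?mulr1n ?mulr0n; case: ltP => *; lra.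
Qed.

Lemma digit_encode b k : digit k (encode b) = b k.
Proof.
have iterE : iter k unfold_digit (encode b) = encode (fun i => b (i + k)%N).
  elim: k => [|k IH] /=; first by congr encode; apply/funext => i; rewrite addn0.
  rewrite IH unfold_digit_encode; congr encode; apply/funext => i /=.
  by rewrite addSnnS.
rewrite /digit iterE encodeS /=; have /andP[? ?] := encode_itv ((fun i => b (i + k)%N) \o S).
rewrite add0n; case: (b k); rewrite /= ?mulr1n ?mulr0n; first by lra.
by apply/negbTE; rewrite -leNgt; lra.
Qed.

Lemma unfold_digit_measurable : measurable_fun [set: R] unfold_digit.
Proof.
apply: measurable_fun_ifT.
- exact: measurable_fun_ltr.
- by apply: measurable_funB => //; exact: measurable_funM.
- exact: measurable_funM.
Qed.

Lemma digit_measurable k : measurable [set y : R | digit k y].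
Proof.
have mi : measurable_fun [set: R] (iter k unfold_digit).
  elim: k => [|k IH]; first exact: measurable_id.
  by apply: measurableT_comp => //; exact: unfold_digit_measurable.
have := mi measurableT _ (measurable_itv `]2^-1, +oo[).
rewrite setTI; congr measurable; apply/seteqP; split => y /=;
  by rewrite /digit in_itv /= andbT.
Qed.

Lemma measurable_sigma_algebra d (T : measurableType d) : sigma_algebra setT (@measurable d T).
Proof.
split; [exact: measurable0|by move=> A mA; rewrite setTD; exact: measurableC|].
by move=> A mA; exact: bigcupT_measurable.
Qed.

Lemma encode_measurable (T : Type) (S : set (set T)) (sS : sigma_algebra setT S)
    (b : T -> nat -> Prop) : (forall k, S [set t | b t k]) ->
  forall B : set R, measurable B -> S [set t | B (encode (fun k => `[< b t k >]))].
Proof.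
move=> mb; pose f t := encode (fun k => `[< b t k >]).
have fgt q : S [set t | q < f t].
  have fin n (p : nat -> R) : S [set t | q < \sum_(k < n) (2 * (`[< b t k >])%:R / 3 ^+ k.+1)].
    (* The partial sum depends on [n] bits, so the set is a finite union over bit tuples. *)
    have : S [set t | exists l : n.-tuple bool, (forall k : 'I_n, tnth l k <-> b t k) /\
        q < \sum_(k < n) (2 * (tnth l k)%:R / 3 ^+ k.+1)].
      apply: (sigma_exists sS) => l; apply: (sigma_and sS); last exact: sigma_const.
      by apply: (sigma_forall sS) => k; apply: (sigma_iff sS) => //; exact: sigma_const.
    apply: sigma_ext => t; split=> [[l [lb]]|h].
      congr (_ < _); apply: eq_bigr => k _; congr (_ * _%:R / _).
      by congr nat_of_bool; apply/idP/asboolP => /lb.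
    exists [tuple `[< b t k >] | k < n]; split.
      by move=> k; rewrite tnth_mktuple; split => /asboolP.
    by under eq_bigr do rewrite tnth_mktuple.
  have := sigma_exists sS (fun n : nat => fin n (fun=> 0)).
  by apply: sigma_ext => t; apply: iff_sym; exact: encode_gt.
have sub : (@RGenOInfty.G R).-sigma.-measurable `<=` [set B | S (f @^-1` B)].
  apply: smallest_sub; last first.
    move=> _ [x ->]; move: (fgt x).
    by apply: (@sigma_ext _ S _ (fun t => f t \in `]x, +oo[)) => t; rewrite in_itv /= andbT.
  split.
  - exact: (sigma_const sS False).
  - by move=> A SA; rewrite /= setTD; apply: (sigma_not sS).
  - move=> A SA; have := sigma_exists_nat sS (P := fun n t => A n (f t)) SA.
    apply: (@sigma_ext _ S _ (fun t => (\bigcup_n A n) (f t))) => t.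
    by split=> [[n ?]|[n _ ?]]; exists n.
by move=> B mB; apply: sub; rewrite -RGenOInfty.measurableE.
Qed.

End cantor_coding.

(** * Borel reduction through states *)

Section borel_reduction.
Context {R : realType}.

Lemma Borel_sigma_algebra (X : topologicalType) : sigma_algebra setT (@Borel X).
Proof. exact: smallest_sigma_algebra. Qed.

Definition state_bits (s : state) (k : nat) : Prop :=
  if unpickle k is Some (m, i, j) then s m i j else False.

Definition state_code (s : state) : R := encode (fun k => `[< state_bits s k >]).

Definition state_decode (y : R) : state := fun m i j => digit (pickle (m, i, j)) y.

Lemma state_codeK s : state_decode (state_code s) = s.
Proof.
apply/funext => m; apply/funext => i; apply/funext => j; apply/propext.
rewrite /state_decode /state_code digit_encode /state_bits pickleK.
by split => /asboolP.
Qed.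

Lemma state_code_measurable (T : Type) (S : set (set T)) (sS : sigma_algebra setT S)
    (s : T -> state) : (forall m i j, S [set t | s t m i j]) ->
  forall B : set R, measurable B -> S [set t | B (state_code (s t))].
Proof.
move=> ms; apply: encode_measurable => // k; rewrite /state_bits.
by case: unpickle => [[[m i] j]|]; [exact: ms|exact: sigma_const].
Qed.

(** Equality takes care of reals that are not codes; on codes decoding is injective, so countably
    many states mean countably many reals. *)
Definition code_equiv (y z : R) := y = z \/ [/\ y = state_code (state_decode y),
  z = state_code (state_decode z) & canon_equiv (state_decode y) (state_decode z)].

Lemma code_equiv_equivalence : Equivalence (fun y z => code_equiv y z).
Proof.
split=> [y|y z [->|[yE zE yz]]|y z t [->//|[yE zE yz]] [<-|[_ tE zt]]].
- by left.
- by left.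
- by right; split => //; exact: canon_equiv_sym.
- by right.
- by right; split => //; exact: canon_equiv_trans zt.
Qed.

Lemma code_equiv_countable (y : R) : countable [set z | code_equiv y z].
Proof.
pose f k := if k is k'.+1 then state_code (canon (state_decode y) k') else y.
apply: (@sub_countable _ _ _ (range f)); last exact: (sub_countable (card_image_le _ _)).
apply: subset_card_le => z [yz|[_ zE /canon_equiv_canonE[k ek]]]; first by exists 0%N => /=.
by exists k.+1 => //=; rewrite -ek.
Qed.

Lemma sigma_real_eq (T : Type) (S : set (set T)) (sS : sigma_algebra setT S) (f g : T -> R) :
  (forall B : set R, measurable B -> S [set t | B (f t)]) ->
  (forall B : set R, measurable B -> S [set t | B (g t)]) -> S [set t | f t = g t].
Proof.
move=> mf mg; have : S [set t | forall q : rat, f t \in `]ratr q, +oo[ <-> g t \in `]ratr q, +oo[].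
  by apply: (sigma_forall sS) => q; apply: (sigma_iff sS);
    [apply: (mf [set` `]ratr q, +oo[])|apply: (mg [set` `]ratr q, +oo[])]; exact: measurable_itv.
apply: sigma_ext => t; split=> [h|-> //]; apply/eqP; rewrite eq_le; apply/andP; split.
  rewrite leNgt; apply/negP => /rat_in_itvoo[q]; rewrite in_itv /= => /andP[gq qf].
  have := (h q).1; rewrite !in_itv /= !andbT => /(_ qf) /(lt_trans gq).
  by rewrite ltxx.
rewrite leNgt; apply/negP => /rat_in_itvoo[q]; rewrite in_itv /= => /andP[gq qf].
have := (h q).2; rewrite !in_itv /= !andbT => /(_ qf) /(lt_trans gq).
by rewrite ltxx.
Qed.

Lemma code_equiv_measurable : measurable [set p : R * R | code_equiv p.1 p.2].
Proof.
have sM := @measurable_sigma_algebra _ (R * R)%type.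
have m1 (B : set R) : measurable B -> measurable [set p : R * R | B p.1].
  by move=> mB; have := @measurable_fst _ _ R R measurableT B mB; rewrite setTI.
have m2 (B : set R) : measurable B -> measurable [set p : R * R | B p.2].
  by move=> mB; have := @measurable_snd _ _ R R measurableT B mB; rewrite setTI.
have d1 m i j : measurable [set p : R * R | state_decode p.1 m i j].
  by apply: (m1 [set y | digit (pickle (m, i, j)) y]); exact: digit_measurable.
have d2 m i j : measurable [set p : R * R | state_decode p.2 m i j].
  by apply: (m2 [set y | digit (pickle (m, i, j)) y]); exact: digit_measurable.
have state_eq (s t : R * R -> state) : (forall m i j, measurable [set p | s p m i j]) ->
    (forall m i j, measurable [set p | t p m i j]) -> measurable [set p | s p = t p].
  move=> ms mt; have : measurable [set p | forall m i j, s p m i j <-> t p m i j].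
    by do 3![apply: (sigma_forall sM) => ?]; exact: (sigma_iff sM).
  apply: (@sigma_ext _ measurable) => p; split=> [h|-> //].
  by do 3![apply/funext => ?]; exact/propext.
have c1 k := canon_measurable sM d1 k; have c2 k := canon_measurable sM d2 k.
apply: (sigma_or sM); first exact: (sigma_real_eq sM m1 m2).
have : measurable [set p : R * R | p.1 = state_code (state_decode p.1) /\
  (p.2 = state_code (state_decode p.2) /\
  ((exists k, state_decode p.1 = canon (state_decode p.1) k) /\
  ((exists k, state_decode p.2 = canon (state_decode p.2) k) /\
  ((forall k, exists l, canon (state_decode p.1) k = canon (state_decode p.2) l) /\
   (forall l, exists k, canon (state_decode p.1) k = canon (state_decode p.2) l)))))].
  apply: (sigma_and sM); first by apply: (sigma_real_eq sM m1); exact: state_code_measurable.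
  apply: (sigma_and sM); first by apply: (sigma_real_eq sM m2); exact: state_code_measurable.
  apply: (sigma_and sM); first by apply: (sigma_exists sM) => k; exact: state_eq.
  apply: (sigma_and sM); first by apply: (sigma_exists sM) => k; exact: state_eq.
  by apply: (sigma_and sM); apply: (sigma_forall sM) => k; apply: (sigma_exists sM) => l;
    exact: state_eq.
apply: (@sigma_ext _ measurable) => p; split=> [[? [? [? [? [? ?]]]]]|[? ? [? ? ? ?]]].
  by split.
by do !split.
Qed.

Lemma standard_Borel_real : @standard_Borel R _ R.
Proof.
exists R^o, id; split.
- by move=> F PF /cauchy_cvg; exists (lim F).
- exists (range (ratr : rat -> R)); first exact: (sub_countable (card_image_le _ _)).
  exact: dense_rat.
- by exists id.
- move=> A; rewrite image_id; split; last first.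
    apply: (@smallest_sub _ _ _ _ (@measurable_sigma_algebra _ R)) => B.
    exact: open_measurable.
  have sB := Borel_sigma_algebra R^o.
  move=> mA; have : (@RGenOpens.G R).-sigma.-measurable A by rewrite -RGenOpens.measurableE.
  apply: (smallest_sub sB) => _ [x [y ->]]; apply: sub_sigma_algebra.
  exact: interval_open.
Qed.

(** The reduction codes the enumeration based at index 0. Similar states may get different base
    points there, but their codes stay equivalent; conversely, equivalent codes share a point, and a
    shared point forces [E]. *)
Lemma essentially_countable_states (X : topologicalType) (E : X -> X -> Prop) (St : X -> state) :
  (forall m i j, Borel [set x | St x m i j]) -> (forall x, determined (St x)) ->
  (forall x x', E x x' -> similar (St x) (St x')) ->
  (forall x x' i j, St x 0 i = St x' 0 j -> E x x') -> essentially_countable R E.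
Proof.
move=> mSt dSt Esim simE.
exists _, R, [set p : R * R | code_equiv p.1 p.2], (fun x => state_code (canon (St x) 0)).
have sB := Borel_sigma_algebra X.
split; [exact: standard_Borel_real| |move=> B mB|move=> x x'].
- split; [exact: code_equiv_measurable|exact: code_equiv_equivalence|].
  exact: code_equiv_countable.
- by apply: (state_code_measurable sB) => // m i j; exact: canon_measurable.
split=> [xx'|/= [e|[_ _]]].
- right; rewrite !state_codeK; split => //; apply: canon_equiv_canon => //; exact: Esim.
- have := congr1 state_decode e; rewrite !state_codeK => ee.
  apply: (simE _ _ 0%N 0%N); rewrite -(canon_row (s := St x) (i := 0) (K := 0) (j := 0))//.
  by rewrite ee; apply: (canon_row (s := St x') (i := 0) (K := 0) (j := 0)).
- by rewrite !state_codeK => /canon_equiv_row[k [l]]; exact: simE.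
Qed.

End borel_reduction.

(** * Restricting quantifiers to a dense sequence *)

Section dense_predicates.
Context {R : realType} {L : signature R}.
Context (F : fragment L) (enumF : nat -> preformula L).
Hypotheses (enumF_in : forall k, frag_set F (enumF k))
  (enumF_surj : forall p, frag_set F p -> exists k, enumF k = p).
Context {M : structure L} (x : nat -> M).
Hypotheses (tM : tame M) (dx : dense_seq x).

Notation lit := (lit enumF).
Notation lits := (lits enumF).
Notation orb := (orb enumF).
Notation core := (core enumF).
Notation vbit := (vbit enumF).
Notation link := (link enumF).

Lemma invS_lt (e : R) : 0 < e -> exists m, m.+1%:R^-1 < e.
Proof.
move=> e0; exists (Num.truncn e^-1); rewrite invf_plt ?posrE//.
exact: truncnS_gt.
Qed.

(** By completeness compactness amounts to total boundedness, and this is visible on the members of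
    the sequence in the open ball. The centres [x k] may lie outside the ball. *)
Lemma compact_ball_dense (a : M) r : compact (closure (ball a r)) <->
  forall m, exists n, forall j, mdist a (x j) < r ->
    exists2 k, (k < n)%N & mdist (x j) (x k) < m.+1%:R^-1.
Proof.
split=> [cK m|tb].
  have m0 : 0 < m.+1%:R^-1 :> R by rewrite invr_gt0.
  apply: contrapT => nex; have [U [UU Uoo]] := free_ultrafilter.
  have /choice[j Hj] : forall n, exists j, mdist a (x j) < r /\
      forall k, (k < n)%N -> ~ (mdist (x j) (x k) < m.+1%:R^-1).
    move=> n; apply: contrapT => nj; apply: nex; exists n => j aj.
    apply: contrapT => nk; apply: nj; exists j; split => // k kn h.
    by apply: nk; exists k.
  have [y yj] : exists y, ulim U (fun n => x (j n)) y.
    apply: (ultra_compact UU cK); apply: (ultraS UU (ultra_ge Uoo 0)) => n _.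
    by apply: subset_closure; rewrite ballEmdist; case: (Hj n).
  have m20 : 0 < m.+1%:R^-1 / 2 :> R by rewrite divr_gt0.
  have [k yk] := dx y m20; have [n kn /= jn] := ultra_ex UU Uoo k.+1 (yj _ m20).
  have [_ /(_ k kn)] := Hj n; apply.
  have := metric_triangle (x (j n)) y (x k); move: jn yk; move: (m.+1%:R^-1 : R) => z; clear; lra.
rewrite compact_ultra => G UG GK.
have cG : cauchy G.
  apply/cauchy_exP => e e0; have e20 : 0 < e / 2 by lra.
  have [m me] := invS_lt e20; have [n Hn] := tb m.
  have [[k Gk]|nG] := pselect (exists k, G (ball (x k) e)); first by exists (x k).
  have GC : G [set z | forall k, (k < n)%N -> ~ ball (x k) e z].
    apply: filter_forall_lt => k _.
    by have [Gk|//] := in_ultra_setVsetC (ball (x k) e) UG; case: nG; exists k.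
  have GI : G (closure (ball a r) `&` [set z | forall k, (k < n)%N -> ~ ball (x k) e z]).
    exact: filterI.
  have [z [cz nz]] := @filter_ex _ G _ _ GI.
  have [y ay zy] := (closureP _ _).1 cz (e / 4) ltac:(lra).
  rewrite ballEmdist /= in ay.
  have [|j] := dx y (e := Num.min (e / 4) (r - mdist a y)).
    by rewrite lt_min; apply/andP; split; lra.
  rewrite lt_min => /andP[yj yr].
  have [|k kn jk] := Hn j; first by have := metric_triangle a y (x j); lra.
  exfalso; apply: (nz k kn); rewrite ballEmdist /= metric_sym.
  have := metric_triangle z y (x k); have := metric_triangle y (x j) (x k).
  by have := lt_trans jk me; move: zy yj; clear; lra.
have [l Gl] := @carrier_complete _ _ M G _ cG.
exists l; split => //; apply: (@closed_closure _ (ball a r)) => B /Gl GB.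
exact: (@filter_ex _ G _ _ (@filterI _ G _ _ _ GK GB)).
Qed.

Lemma rad_gt_rat (a : M) q : q < rad a <-> exists q' : rat,
  [/\ q < ratr q', ratr q' <= diam_bound (L := L) & compact (closure (ball a (ratr q' : R)))].
Proof.
split=> [/(sup_gt (rad_has_sup a).1)[r [rb cr] qr]|[q' [qq q'b cq]]].
  have [q' /andP[qq' q'r]] := rat_between qr; exists q'; split => //.
    by rewrite (le_trans (ltW q'r)).
  apply: compact_closure_sub cr => z; rewrite !ballEmdist /= => h.
  exact: lt_trans q'r.
exact: lt_le_trans qq (rad_ge q'b cq).
Qed.

Lemma step_rat (q : R) (a t : M) : step q a t <->
  exists q' : rat, mdist a t < ratr q' /\ ratr q' + q < rad a.
Proof.
rewrite /step; split=> [h|[q' []]]; last by lra.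
have [|q' /andP[? ?]] := @rat_between R (mdist a t) (rad a - q); first by lra.
by exists q'; split => //; lra.
Qed.

(** The inequalities are strict, so an interior point can be moved into the sequence. *)
Lemma reach_dense n q (a t : M) : reach n.+1 q a t <->
  exists k, reach n q a (x k) /\ step q (x k) t.
Proof.
split=> [[c /reach_strict[q1 qq1 ac] ct]|[k [ak kt]]]; last by exists (x k).
have [q2 qq2 {}ct] := reach_strict (n := 0) ct.
pose e := Num.min ((q1 - q) / 3) ((q2 - q) / 3).
have e0 : 0 < e by rewrite lt_min; apply/andP; split; lra.
have [e1 e2] : e <= (q1 - q) / 3 /\ e <= (q2 - q) / 3.
  by rewrite /e; split; rewrite ge_min lexx ?orbT.
have [k /ltW ck] := dx c e0; exists k; split.
  apply: (@reach_mono _ _ n (q1 - 3 * e)); first by lra.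
  by apply: (reach_perturb (ltW e0) ac); rewrite ?mdistxx// ltW.
apply: (@reach_mono _ _ 0 (q2 - 3 * e)); first by lra.
by apply: (reach_perturb (ltW e0) ct); rewrite ?mdistxx// ltW.
Qed.

Lemma pos_dense p ns q i : is_formula p -> pos p ns q (x i) <->
  exists l : seq nat, [/\ size l = size ns,
    forall j, (j < size ns)%N ->
      reach (nth 0%N ns j) (q / (nth 0%N ns j).+1%:R) (x i) (x (nth i l j)) &
    q < feval (x \o nth i (i :: l)) p].
Proof.
have psE (l : seq nat) : point_seq (x i) (map x l) = x \o nth i (i :: l).
  apply/funext => -[//|j]; rewrite /point_seq /=.
  have [jl|jl] := ltnP j (size l); first by rewrite (nth_map i).
  by rewrite !nth_default// size_map.
move=> fp; split=> [|[l [sl lr lp]]]; last first.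
  exists (map x l); split; rewrite ?size_map ?psE// => j jN.
  by rewrite (nth_map i) ?sl//; exact: lr.
move=> /pos_strict[q' qq' [l [sl lr lp]]].
have [k Hk] := formula_ucP fp; have [|d d0 Hd] := Hk (q' - q); first by lra.
pose K := \max_(n <- ns) n.
have e0 : 0 < (q' - q) / (3 * K.+1%:R) by rewrite divr_gt0 ?subr_gt0// mulr_gt0.
pose e := Num.min d ((q' - q) / (3 * K.+1%:R)).
have ee0 : 0 < e by rewrite lt_min d0.
have /choice[u Hu] : forall z, exists j, mdist z (x j) < e by move=> z; exact: dx.
exists (map u l); split; first by rewrite size_map.
  move=> j jN; set n := nth 0%N ns j.
  have nK : (n <= K)%N by apply: leq_bigmax_seq => //; exact: mem_nth.
  rewrite (nth_map (x i)) ?sl//; set z := nth _ _ _.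
  have eE : e <= (q' - q) / (3 * K.+1%:R) by rewrite ge_min lexx orbT.
  have := reach_perturb (ltW ee0) (lr j jN) (_ : mdist (x i) (x i) <= e) (ltW (Hu z)).
  rewrite mdistxx => /(_ (ltW ee0)); apply: reach_mono.
  rewrite -/n lerBrDr -lerBrDl -mulrBl mulrC ler_pdivlMr// -mulrA.
  apply: le_trans (_ : e * (3 * K.+1%:R) <= _).
    by rewrite ler_wpM2l ?(ltW ee0)// ler_pM2l// ler_nat ltnS.
  by rewrite -ler_pdivlMr// mulr_gt0.
have pd j : mdist (point_seq (x i) l j) ((x \o nth i (i :: map u l)) j) < d.
  apply: (@lt_le_trans _ _ e); last by rewrite ge_min lexx.
  rewrite /point_seq; case: j => [|j] /=; first by rewrite mdistxx.
  have [jl|jl] := ltnP j (size l); first by rewrite (nth_map (x i)).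
  by rewrite !nth_default ?size_map// mdistxx.
have := Hd _ _ _ (fun j _ => pd j); rewrite ler_norml => /andP[? ?]; lra.
Qed.

(** A point of the exact type of [b] is replaced by approximations from the sequence; as [q < rad a]
    they eventually stay in a compact ball, and their limit has that type. *)
Lemma orb_dense q (a b : M) : q < rad a -> orb q a b <->
  forall m, exists j, mdist a (x j) < q + m.+1%:R^-1 /\
    forall l, (pickle l < m)%N -> lit l b -> lit l (x j).
Proof.
move=> qa; split=> [[b' bb' ab'] m|H].
  have Wb' : lits (true_lits enumF b m) b' by apply: lits_eqtype bb' _; exact: true_litsP.
  have [e e0 He] := lits_open enumF_in Wb'.
  have m0 : 0 < m.+1%:R^-1 :> R by rewrite invr_gt0.
  have [|j] := dx b' (e := Num.min e m.+1%:R^-1); first by rewrite lt_min e0.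
  rewrite lt_min => /andP[/He h bm]; exists j; split.
    by have := metric_triangle a b' (x j); move: ab' bm; move: (m.+1%:R^-1 : R) => z; clear; lra.
  by move=> l lm lb; apply: h; exact: mem_true_lits.
have [U [UU Uoo]] := free_ultrafilter; have [j Hj] := choice H.
have small (e : R) : 0 < e -> U [set m | m.+1%:R^-1 < e].
  move=> e0; have [k ke] := invS_lt e0; apply: (ultraS UU (ultra_ge Uoo k)) => m /= km.
  by apply: le_lt_trans ke; rewrite lef_pV2 ?posrE// ler_nat ltnS.
have [y yj] : exists y, ulim U (fun m => x (j m)) y.
  apply: (@ultra_rad _ _ U UU M a ((q + rad a) / 2)); first by lra.
  have h0 : 0 < (rad a - q) / 2 by lra.
  apply: (ultraS UU (small _ h0)) => m /= hm; have [h _] := Hj m.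
  by move: h hm; move: (m.+1%:R^-1 : R) => z; clear; lra.
exists y.
  apply: (ulim_eqtype enumF_in UU yj) => l lb.
  by apply: (ultraS UU (ultra_ge Uoo (pickle l).+1)) => m lm; have [_] := Hj m; apply.
apply/ler_addgt0Pr => e e0; have e20 : 0 < e / 2 by lra.
have [m _ [/= jy me]] := ultra_ex UU Uoo 0 (ultraI UU (yj _ e20) (small _ e20)).
have [h _] := Hj m; have := metric_triangle a (x (j m)) y.
by move: h jy me; move: (m.+1%:R^-1 : R) => z; clear; lra.
Qed.

(** Since [U] is open, the quantifier over all points can be restricted to the sequence at the price
    of half the slack. *)
Lemma core_dense U r (a : M) : core U r a <-> [/\ 0 < ratr r :> R, 4 * ratr r < rad a, lits U a &
  exists d : rat, 0 < ratr d :> R /\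
    forall j, mdist a (x j) < ratr r + ratr d -> lits U (x j) -> orb (ratr r / 4 - ratr d) a (x j)].
Proof.
split=> [[r0 ra Ua [d d0 Hd]]|[r0 ra Ua [d [d0 Hd]]]]; split => //.
  have [d' /andP[d'0 dd']] := rat_between d0; exists d'; split => // j aj Uj.
  have [||b' bb' ab'] := Hd (x j); [lra|by []|].
  by exists b' => //; lra.
exists (ratr d / 2); first by lra.
move=> b ab Ub; have [e e0 He] := lits_open enumF_in Ub.
have [|j] := dx b (e := Num.min e (ratr d / 2)).
  by rewrite lt_min e0 /=; lra.
rewrite lt_min => /andP[/He Uj bj].
have aj : orb (ratr r / 4 - ratr d) a (x j).
  by apply: Hd => //; have := metric_triangle a b (x j); lra.
have h := orb_perturb enumF_in enumF_surj tM aj (_ : mdist a a <= 0)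
  (_ : mdist (x j) b <= ratr d / 2).
apply: orb_mono (h _ _); first by lra.
  by rewrite mdistxx.
by rewrite metric_sym ltW.
Qed.

Lemma vbit_dense U r (a : M) W : core U r a -> vbit U r a W <->
  exists j, [/\ core U r (x j), orb (ratr r) a (x j) & lits W (x j)].
Proof.
move=> ca; split=> [[c [cc ac Wc]]|[j [? ? ?]]]; last by exists (x j).
have [e e0 He] := core_open enumF_in enumF_surj tM cc.
have [e' e'0 He'] := lits_open enumF_in Wc.
have [r0 _ _ _] := ca.
have [|j] := dx c (e := Num.min (Num.min e e') (ratr r / 2)).
  by rewrite !lt_min e0 e'0 /=; lra.
rewrite !lt_min => /andP[/andP[/He cj /He' Wj] cxj].
exists j; split => //.
apply: orb_mono (orb_perturb enumF_in enumF_surj tM (core_orb ca cc ac)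
  (_ : mdist a a <= 0) (ltW cxj)); first by lra.
by rewrite mdistxx.
Qed.

Lemma link_dense n U r (a : M) U' r' (b : M) : core U r a -> core U' r' b ->
  link n U r a U' r' b <-> exists i j, [/\ core U r (x i), orb (ratr r) a (x i),
    core U' r' (x j), orb (ratr r') b (x j) & reach n (1 / n.+1%:R) (x i) (x j)].
Proof.
move=> ca cb; split=> [[c [c' [cc ac cc' bc' cr]]]|[i [j [? ? ? ? ?]]]]; last first.
  by exists (x i), (x j).
have [q qn {}cr] := reach_strict cr.
have e30 : 0 < (q - 1 / n.+1%:R) / 3 by rewrite divr_gt0 ?subr_gt0.
have near_core V s (d e : M) : core V s d -> core V s e -> orb (ratr s) d e ->
    exists j, [/\ core V s (x j), orb (ratr s) d (x j) & mdist e (x j) < (q - 1 / n.+1%:R) / 3].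
  move=> cd ce de; have [u u0 Hu] := core_open enumF_in enumF_surj tM ce.
  have [s0 _ _ _] := cd.
  have [|j] := dx e (e := Num.min (Num.min u ((q - 1 / n.+1%:R) / 3)) (ratr s / 2)).
    by rewrite !lt_min u0 e30 /=; lra.
  rewrite !lt_min => /andP[/andP[/Hu cj eq] es]; exists j; split => //.
  apply: orb_mono (orb_perturb enumF_in enumF_surj tM (core_orb cd ce de)
    (_ : mdist d d <= 0) (ltW es)); first by lra.
  by rewrite mdistxx.
have [i [ci ai /ltW di]] := near_core _ _ _ _ ca cc ac.
have [j [cj bj /ltW dj]] := near_core _ _ _ _ cb cc' bc'.
exists i, j; split => //.
by apply: reach_mono (reach_perturb (ltW e30) cr di dj); move: (1 / n.+1%:R : R) => z; lra.
Qed.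

End dense_predicates.

(** * Measurability *)

Section measurability.
Context {R : realType} {L : signature R}.
Context (F : fragment L) (enumF : nat -> preformula L).
Hypotheses (enumF_in : forall k, frag_set F (enumF k))
  (enumF_surj : forall p, frag_set F p -> exists k, enumF k = p).
Context {X : Type} (S : set (set X)) (sS : sigma_algebra setT S).
Context (N : X -> structure L) (x : forall t, nat -> N t).
Hypotheses (tN : forall t, tame (N t)) (dx : forall t, dense_seq (@x t))
  (mF : forall p, frag_set F p -> forall (s : nat -> nat) (q : R),
    S [set t | q < feval (@x t \o s) p]).

Notation lit := (lit enumF).
Notation lits := (lits enumF).
Notation orb := (orb enumF).
Notation core := (core enumF).
Notation vbit := (vbit enumF).
Notation link := (link enumF).

Let dE t i j : feval (@x t \o nth i [:: i; j]) (fdist (Var 0) (Var 1)) = mdist (x t i) (x t j).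
Proof. by rewrite feval_fdist. Qed.

Lemma dist_measurable i j q : S [set t | mdist (x t i) (x t j) < q].
Proof.
have Fd : frag_set F (FScale (-1) (fdist (Var 0) (Var 1))) by exact/frag_scale/frag_atom.
have := mF Fd (nth i [:: i; j]) (- q); apply: sigma_ext => t.
set s := @x t \o _; have -> : feval s (FScale (-1) (fdist (Var 0) (Var 1))) = - feval s (fdist (Var 0) (Var 1)).
  transitivity (ratr (-1) * feval s (fdist (Var 0) (Var 1))) => //.
  by rewrite rmorphN rmorph1 mulN1r.
by rewrite dE ltrN2.
Qed.

Lemma compact_measurable i r : S [set t | compact (closure (ball (x t i) (r : R)))].
Proof.
have : S [set t | forall m, exists n, forall j, mdist (x t i) (x t j) < r ->
    exists k, (k < n)%N /\ mdist (x t j) (x t k) < m.+1%:R^-1].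
  apply: (sigma_forall sS) => m; apply: (sigma_exists sS) => n.
  apply: (sigma_forall sS) => j; apply: (sigma_imp sS); first exact: dist_measurable.
  apply: (sigma_exists sS) => k; apply: (sigma_and sS); first exact: sigma_const.
  exact: dist_measurable.
apply: sigma_ext => t; rewrite (compact_ball_dense (@dx t)).
by split=> h m; have [n hn] := h m; exists n => j /hn[k]; [move=> []|]; exists k.
Qed.

Lemma rad_measurable i q : S [set t | q < rad (x t i)].
Proof.
have : S [set t | exists q' : rat, (q < ratr q' /\ ratr q' <= diam_bound (L := L)) /\
    compact (closure (ball (x t i) (ratr q' : R)))].
  apply: (sigma_exists sS) => q'; apply: (sigma_and sS); first exact: sigma_const.
  exact: compact_measurable.
apply: sigma_ext => t; rewrite rad_gt_rat.
by split=> [[q' [[? ?] ?]]|[q' [? ? ?]]]; exists q'.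
Qed.

Lemma step_measurable i j q : S [set t | step q (x t i) (x t j)].
Proof.
have : S [set t | exists q' : rat, mdist (x t i) (x t j) < ratr q' /\ ratr q' + q < rad (x t i)].
  apply: (sigma_exists sS) => q'; apply: (sigma_and sS); first exact: dist_measurable.
  exact: rad_measurable.
by apply: sigma_ext => t; rewrite step_rat.
Qed.

Lemma reach_measurable n i j q : S [set t | reach n q (x t i) (x t j)].
Proof.
elim: n j => [|n IH] j; first exact: step_measurable.
have : S [set t | exists k, reach n q (x t i) (x t k) /\ step q (x t k) (x t j)].
  by apply: (sigma_exists sS) => k; apply: (sigma_and sS) => //; exact: step_measurable.
by apply: sigma_ext => t; rewrite (reach_dense (@dx t)).
Qed.

Lemma pos_measurable p ns q i : frag_set F p -> S [set t | pos p ns q (x t i)].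
Proof.
move=> Fp; have : S [set t | exists l : seq nat, size l = size ns /\
    ((forall j, (j < size ns)%N ->
      reach (nth 0%N ns j) (q / (nth 0%N ns j).+1%:R) (x t i) (x t (nth i l j))) /\
    q < feval (@x t \o nth i (i :: l)) p)].
  apply: (sigma_exists sS) => l; apply: (sigma_and sS); first exact: sigma_const.
  apply: (sigma_and sS); last exact: mF.
  apply: (sigma_forall sS) => j; apply: (sigma_imp sS); first exact: sigma_const.
  exact: reach_measurable.
apply: sigma_ext => t; rewrite (pos_dense (@dx t) ns q i (frag_formula Fp)).
by split=> [[l [? [? ?]]]|[l [? ? ?]]]; exists l.
Qed.

Lemma lit_measurable (l : literal) i : S [set t | lit l (x t i)].
Proof.
case: l => [[[[] k] ns] q] /=; first exact: pos_measurable.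
have : S [set t | exists q' : rat, (ratr q' : R) < ratr q /\ ~ pos (enumF k) ns (ratr q') (x t i)].
  apply: (sigma_exists sS) => q'; apply: (sigma_and sS); first exact: sigma_const.
  exact/(sigma_not sS)/pos_measurable.
by apply: sigma_ext => t; split => [[q' [? ?]]|[q' ? ?]]; exists q'.
Qed.

Lemma lits_measurable (W : seq literal) i : S [set t | lits W (x t i)].
Proof.
apply: (sigma_forall sS) => l; apply: (sigma_imp sS); first exact: sigma_const.
exact: lit_measurable.
Qed.

(* Below the radius of [x t i] the set coincides with that of [orb q (x t i) (x t j)]. *)
Let orb_approx q t i j := forall m, exists k, mdist (x t i) (x t k) < q + m.+1%:R^-1 /\
  forall l, (pickle l < m)%N -> lit l (x t j) -> lit l (x t k).

Let orb_approxP q t i j : q < rad (x t i) -> orb q (x t i) (x t j) <-> orb_approx q t i j.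
Proof. by move=> qa; apply: orb_dense. Qed.

Let orb_approx_measurable q i j : S [set t | orb_approx q t i j].
Proof.
apply: (sigma_forall sS) => m; apply: (sigma_exists sS) => k; apply: (sigma_and sS).
  exact: dist_measurable.
apply: (sigma_forall sS) => l; apply: (sigma_imp sS); first exact: sigma_const.
by apply: (sigma_imp sS); exact: lit_measurable.
Qed.

Lemma core_measurable U r i : S [set t | core U r (x t i)].
Proof.
have : S [set t | 0 < ratr r :> R /\ (4 * ratr r < rad (x t i) /\ (lits U (x t i) /\
  exists d : rat, 0 < ratr d :> R /\
    forall j, mdist (x t i) (x t j) < ratr r + ratr d -> lits U (x t j) ->
      orb_approx (ratr r / 4 - ratr d) t i j))].
  apply: (sigma_and sS); first exact: sigma_const.
  apply: (sigma_and sS); first exact: rad_measurable.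
  apply: (sigma_and sS); first exact: lits_measurable.
  apply: (sigma_exists sS) => d; apply: (sigma_and sS); first exact: sigma_const.
  apply: (sigma_forall sS) => j; apply: (sigma_imp sS); first exact: dist_measurable.
  by apply: (sigma_imp sS); [exact: lits_measurable|exact: orb_approx_measurable].
apply: sigma_ext => t; rewrite (core_dense enumF_in enumF_surj (tN t) (@dx t)).
split=> [[r0 [ra [Ua [d [d0 Hd]]]]]|[r0 ra Ua [d [d0 Hd]]]].
  split => //; exists d; split => // j aj Uj; apply/orb_approxP; last exact: Hd.
  by lra.
do ![split => //]; exists d; split => // j aj Uj; apply/orb_approxP; last exact: Hd.
by lra.
Qed.

Let core_orb_approx U r t i j : core U r (x t i) ->
  orb (ratr r) (x t i) (x t j) <-> orb_approx (ratr r) t i j.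
Proof. by move=> [r0 ra _ _]; apply: orb_approxP; lra. Qed.

(** The conjunct [core] is kept because the test of [orb] along the sequence is valid only below the
    radius, as the core guarantees. *)
Lemma vbit_measurable U r i W : S [set t | core U r (x t i) /\ vbit U r (x t i) W].
Proof.
have : S [set t | core U r (x t i) /\ exists j, core U r (x t j) /\
    (orb_approx (ratr r) t i j /\ lits W (x t j))].
  apply: (sigma_and sS); first exact: core_measurable.
  apply: (sigma_exists sS) => j; apply: (sigma_and sS); first exact: core_measurable.
  by apply: (sigma_and sS); [exact: orb_approx_measurable|exact: lits_measurable].
apply: sigma_ext => t; split=> -[ca h]; split=> //;
  have e := vbit_dense enumF_in enumF_surj (tN t) (@dx t) W ca.
  case: h => j [? [/(core_orb_approx _ ca) ? ?]].
  by apply/e; exists j.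
case/e: h => j [? ? ?].
by exists j; split => //; split => //; apply/(core_orb_approx _ ca).
Qed.

Lemma link_measurable n U r i U' r' j :
  S [set t | (core U r (x t i) /\ core U' r' (x t j)) /\ link n U r (x t i) U' r' (x t j)].
Proof.
have : S [set t | (core U r (x t i) /\ core U' r' (x t j)) /\ exists k l, core U r (x t k) /\
   (orb_approx (ratr r) t i k /\ (core U' r' (x t l) /\ (orb_approx (ratr r') t j l /\
   reach n (1 / n.+1%:R) (x t k) (x t l))))].
  apply: (sigma_and sS); first by apply: (sigma_and sS); exact: core_measurable.
  apply: (sigma_exists sS) => k; apply: (sigma_exists sS) => l.
  do 2![apply: (sigma_and sS); first exact: core_measurable;
    apply: (sigma_and sS); first exact: orb_approx_measurable].
  exact: reach_measurable.
apply: sigma_ext => t; split=> -[[ca cb] h]; split=> //.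
  apply/(link_dense enumF_in enumF_surj (tN t) (@dx t) _ ca cb).
  case: h => k [l [? [? [? [? ?]]]]]; exists k, l.
  by split => //; [exact/(core_orb_approx _ ca)|exact/(core_orb_approx _ cb)].
move: h => /(link_dense enumF_in enumF_surj (tN t) (@dx t) _ ca cb)[k [l [? ? ? ? ?]]].
exists k, l; split => //; split; first exact/(core_orb_approx _ ca).
by split => //; split => //; exact/(core_orb_approx _ cb).
Qed.

End measurability.

(** * The state of a structure *)

Section cluster_states.
Context {R : realType} {L : signature R}.
Context (F : fragment L) (enumF : nat -> preformula L).
Hypotheses (enumF_in : forall k, frag_set F (enumF k))
  (enumF_surj : forall p, frag_set F p -> exists k, enumF k = p).
Context {X : Type} (N : X -> structure L) (x : forall t, nat -> N t).
Hypotheses (tN : forall t, tame (N t)) (dx : forall t, dense_seq (@x t)).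

Notation orb := (orb enumF).
Notation core := (core enumF).
Notation vbit := (vbit enumF).
Notation link := (link enumF).

(** The kind [(U, r)] of a cluster and the index of a representative in the dense sequence. *)
Definition name := (seq literal * rat * nat)%type.

Implicit Types (v : name) (t : X).

Definition valid t v := core v.1.1 v.1.2 (x t v.2).

(* The index [k] stands for the name it encodes if that name is valid, and for the
   least valid name otherwise. *)
Definition named t k v := valid t v /\ (unpickle k = Some v \/
  (forall v', unpickle k = Some v' -> ~ valid t v') /\
  forall v', (pickle v' < pickle v)%N -> ~ valid t v').

(** The kind is recorded among the bits, so that equal bits entail equal kinds. *)
Definition cluster_bit t v w : Prop :=
  match unpickle w : option ((seq literal * rat) + seq literal) with
  | Some (inl c) => v.1 = c
  | Some (inr W) => vbit v.1.1 v.1.2 (x t v.2) W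
  | None => False
  end.

(** Each relation prescribes the kind of its second argument, since [link_isolated] concerns
    clusters of a single kind. *)
Definition cluster_link t m v v' : Prop :=
  if (unpickle m : option (nat * (seq literal * rat))) is Some (n, c) then
    v'.1 = c /\ link n v.1.1 v.1.2 (x t v.2) v'.1.1 v'.1.2 (x t v'.2)
  else False.

Definition cluster_state t : state := fun m k k' =>
  if m is m'.+1 then exists v v', [/\ named t k v, named t k' v' & cluster_link t m' v v']
  else exists v, named t k v /\ cluster_bit t v k'.

Lemma named_uniq t k v v' : named t k v -> named t k v' -> v = v'.
Proof.
move=> [vv [kv|[kn vmin]]] [vv' [kv'|[kn' vmin']]].
- by have [] : Some v = Some v' by rewrite -kv -kv'.
- exact: False_ind (kn' v kv vv).
- exact: False_ind (kn v' kv' vv').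
- have h1 : (pickle v <= pickle v')%N by rewrite leqNgt; apply/negP => h; exact: vmin vv'.
  have h2 : (pickle v' <= pickle v)%N by rewrite leqNgt; apply/negP => h; exact: vmin' vv.
  have h3 : pickle v = pickle v' by apply/eqP; rewrite eqn_leq h1.
  have : Some v = Some v' by rewrite -!pickleK h3.
  by case.
Qed.

Lemma core_index U r t (a : N t) : core U r a -> exists2 i, core U r (x t i) & orb (ratr r) a (x t i).
Proof.
move=> ca; have [e e0 He] := core_open enumF_in enumF_surj (tN t) ca.
have [r0 _ _ _] := ca.
have [|i] := @dx t a (Num.min e (ratr r)); first by rewrite lt_min e0.
by rewrite lt_min => /andP[/He ci /ltW ai]; exists i => //; exact: orb_dist.
Qed.

Lemma valid_exists t : exists v, valid t v.
Proof.
have [U [r c]] := core_exists enumF_in enumF_surj (x t 0%N) (tN t).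
by have [i ci _] := core_index c; exists (U, r, i).
Qed.

Lemma named_exists t k : exists v, named t k v.
Proof.
have [[v [kv vv]]|kn] := pselect (exists v, unpickle k = Some v /\ valid t v).
  by exists v; split => //; left.
have ex : exists n, `[< exists v, pickle v = n /\ valid t v >].
  by have [v vv] := valid_exists t; exists (pickle v); apply/asboolP; exists v.
case: (ex_minnP ex) => n /asboolP[v [vE vv]] nmin; exists v; split => //; right.
split=> [v' kv' vv'|v' v'v vv']; first by apply: kn; exists v'.
have : (n <= pickle v')%N by apply: nmin; apply/asboolP; exists v'.
by rewrite -vE leqNgt v'v.
Qed.

Lemma cluster_state_row t k v : named t k v -> cluster_state t 0 k = cluster_bit t v.
Proof.
move=> kv; apply/funext => w; apply/propext; split=> [[v' [kv' vw]]|vw]; last by exists v.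
by rewrite (named_uniq kv kv').
Qed.

Lemma cluster_state_rel t m k k' v v' : named t k v -> named t k' v' ->
  cluster_state t m.+1 k k' <-> cluster_link t m v v'.
Proof.
move=> kv kv'; split=> [[u [u' [ku ku' uu']]]|vv']; last by exists v, v'.
by rewrite (named_uniq kv ku) (named_uniq kv' ku').
Qed.

Lemma cluster_bit_eq t t' v v' : valid t v -> valid t' v' ->
  cluster_bit t v = cluster_bit t' v' -> v.1 = v'.1 /\
  exists2 g : N t -> N t', isom g & orb (ratr v.1.2) (g (x t v.2)) (x t' v'.2).
Proof.
move=> vv vv' e.
have e1 : v'.1 = v.1.
  have := congr1 (fun h => h (pickle (inl v.1 : (seq literal * rat) + seq literal))) e.
  by rewrite /cluster_bit pickleK => <-.
have e2 W : vbit v.1.1 v.1.2 (x t v.2) W -> vbit v.1.1 v.1.2 (x t' v'.2) W.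
  have := congr1 (fun h => h (pickle (inr W : (seq literal * rat) + seq literal))) e.
  by rewrite /cluster_bit pickleK e1 => ->.
split; first by rewrite e1.
rewrite /valid e1 in vv'.
exact: (vbit_det enumF_in enumF_surj (tN t) (tN t') vv vv' e2).
Qed.

Lemma cluster_bit_sim t t' v v' (g : N t -> N t') : valid t v -> valid t' v' ->
  v.1 = v'.1 -> isom g -> orb (ratr v.1.2) (g (x t v.2)) (x t' v'.2) ->
  cluster_bit t v = cluster_bit t' v'.
Proof.
move=> vv vv' e ig gv; rewrite /valid -e in vv'.
apply/funext => w; apply/propext; rewrite /cluster_bit.
case: unpickle => [[c|W]|] //; first by rewrite e.
rewrite -e; split; first exact: (vbit_sim enumF_in enumF_surj (tN t') ig).
have [h [ih gh hg]] := isom_inv ig.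
apply: (vbit_sim enumF_in enumF_surj (tN t) ih vv' vv).
apply: (orb_sym enumF_in enumF_surj (tN t)); rewrite -(gh (x t v.2)).
exact: (orb_isom ih).
Qed.

(** Equal bits provide isomorphisms [g] and [h], possibly different for the two clusters. They
    differ by an automorphism, which clusters do not see, so [g] serves for both. *)
Lemma cluster_link_sim t t' m u v u' v' : valid t u -> valid t v -> valid t' u' -> valid t' v' ->
  cluster_bit t u = cluster_bit t' u' -> cluster_bit t v = cluster_bit t' v' ->
  cluster_link t m u v -> cluster_link t' m u' v'.
Proof.
move=> vu vv vu' vv' /(cluster_bit_eq vu vu')[eu [g ig gu]] /(cluster_bit_eq vv vv')[ev [h ih hv]].
rewrite /cluster_link; case: unpickle => // -[n c] [vc luv]; split; first by rewrite -ev.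
rewrite /valid -eu in vu'; rewrite /valid -ev in vv'; rewrite -eu -ev.
apply: (link_sim enumF_in enumF_surj (tN t') ig) luv => //.
have ghv : eqtype enumF (g (x t v.2)) (h (x t v.2)).
  apply: eqtype_tr (isom_eqtype enumF _ ih).
  exact: (eqtype_sym (isom_eqtype enumF _ ig)).
apply: (orb_sym enumF_in enumF_surj (tN t')); apply: orb_eqtype (eqtype_sym ghv).
exact: (orb_sym enumF_in enumF_surj (tN t')).
Qed.

Lemma cluster_state_compat t t' m i i' j j' :
  cluster_state t 0 i = cluster_state t' 0 j -> cluster_state t 0 i' = cluster_state t' 0 j' ->
  cluster_state t m.+1 i i' <-> cluster_state t' m.+1 j j'.
Proof.
have [u iu] := named_exists t i; have [v iv] := named_exists t i'.
have [u' ju'] := named_exists t' j; have [v' jv'] := named_exists t' j'.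
rewrite (cluster_state_row iu) (cluster_state_row iv).
rewrite (cluster_state_row ju') (cluster_state_row jv').
rewrite (cluster_state_rel m iu iv) (cluster_state_rel m ju' jv') => e e'.
split; first exact: cluster_link_sim iu.1 iv.1 ju'.1 jv'.1 e e'.
exact: cluster_link_sim ju'.1 jv'.1 iu.1 iv.1 (esym e) (esym e').
Qed.

Lemma cluster_state_half t t' : isomorphic (N t) (N t') ->
  forall i, exists j, cluster_state t 0 i = cluster_state t' 0 j.
Proof.
move=> [g eg bg] i; have ig : isom g by [].
have [v [vv vmin]] := named_exists t i.
have iv : named t i v by [].
have [j cj gj] := core_index (core_isom ig vv).
pose v' : name := (v.1, j); have vv' : valid t' v' by [].
have jv' : named t' (pickle v') v' by split => //; left; rewrite pickleK.
exists (pickle v'); rewrite (cluster_state_row iv) (cluster_state_row jv').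
exact: (cluster_bit_sim vv vv' _ ig gj).
Qed.

Lemma cluster_state_similar t t' : isomorphic (N t) (N t') ->
  similar (cluster_state t) (cluster_state t').
Proof.
move=> tt'; split; first exact: cluster_state_half.
  by move=> j; have [i ->] := cluster_state_half (isomorphic_sym tt') j; exists i.
exact: cluster_state_compat.
Qed.

Lemma cluster_state_iso t t' i j : cluster_state t 0 i = cluster_state t' 0 j ->
  isomorphic (N t) (N t').
Proof.
have [u iu] := named_exists t i; have [v jv] := named_exists t' j.
rewrite (cluster_state_row iu) (cluster_state_row jv).
by move=> /(cluster_bit_eq iu.1 jv.1)[_ [g [eg bg] _]]; exists g.
Qed.

(** If no number of bits isolated [v], clusters linked to [u] would agree with it on longer and
    longer prefixes, yet differ from it. By [link_isolated] one of them recurs infinitely often, so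
    it agrees with [v] on every bit. *)
Lemma cluster_state_determined t : determined (cluster_state t).
Proof.
split.
- apply: cluster_state_similar; exists id; [exact: (isom_id (N t)).1|exact: (isom_id (N t)).2].
- move=> i j; have [u iu] := named_exists t i; have [v jv] := named_exists t j.
  have [n nuv] := link_exists (tN t) iu.1 jv.1.
  exists (pickle (n, v.1)); apply/(cluster_state_rel _ iu jv).
  by rewrite /cluster_link pickleK.
move=> m i j; have [u iu] := named_exists t i; have [v jv] := named_exists t j.
move=> /(cluster_state_rel m iu jv) muv; apply: contrapT => nex.
have /choice[k Hk] : forall n, exists w, [/\ valid t w, cluster_link t m u w,
    forall b, (b < n)%N -> cluster_bit t w b <-> cluster_bit t v b &
    cluster_bit t w <> cluster_bit t v].
  move=> n; apply: contrapT => nw; apply: nex; exists n => k ik kj.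
  have [w kw] := named_exists t k; apply: contrapT => nkj; apply: nw; exists w.
  rewrite (cluster_state_row kw) (cluster_state_row jv) in nkj.
  split => //; [exact: kw.1|exact/(cluster_state_rel m iu kw)|].
  by move=> b bn; have := kj b bn; rewrite (cluster_state_row kw) (cluster_state_row jv).
have [n [c mE]] : exists n c, unpickle m = Some (n, c) :> option (nat * (seq literal * rat)).
  by move: muv; rewrite /cluster_link; case: unpickle => // -[n c] _; exists n, c.
have Hb p : core c.1 c.2 (x t (k p).2) /\ link n u.1.1 u.1.2 (x t u.2) c.1 c.2 (x t (k p).2).
  have [vk] := Hk p; rewrite /cluster_link mE => -[kc luk] _ _.
  by rewrite /valid kc in vk; rewrite kc in luk.
have [p0 Hp0] := link_isolated enumF_in enumF_surj (tN t) iu.1 Hb.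
have bitE p : orb (ratr c.2) (x t (k p0).2) (x t (k p).2) -> cluster_bit t (k p0) = cluster_bit t (k p).
  move=> pp; have [v0 + _ _] := Hk p0; have [v1 + _ _] := Hk p.
  rewrite /cluster_link mE => -[e1 _] [e0 _].
  apply: (cluster_bit_sim v0 v1 _ (isom_id (N t))); first by rewrite e0 e1.
  by rewrite e0.
have [_ _ _] := Hk p0; apply; apply/funext => b; apply/propext.
have [p bp /bitE ->] := Hp0 b.+1; have [_ _ + _] := Hk p; exact.
Qed.

Context (S : set (set X)) (sS : sigma_algebra setT S).
Hypothesis mF : forall p, frag_set F p -> forall (s : nat -> nat) (q : R),
  S [set t | q < feval (x t \o s) p].

Lemma valid_measurable v : S [set t | valid t v].
Proof. exact: (core_measurable enumF_in enumF_surj sS tN dx mF). Qed.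

Lemma named_measurable k v : S [set t | named t k v].
Proof.
apply: (sigma_and sS); first exact: valid_measurable.
apply: (sigma_or sS); first exact: sigma_const.
apply: (sigma_and sS); apply: (sigma_forall sS) => v'; apply: (sigma_imp sS).
- exact: sigma_const.
- exact/(sigma_not sS)/valid_measurable.
- exact: sigma_const.
- exact/(sigma_not sS)/valid_measurable.
Qed.

Lemma cluster_state_measurable m i j : S [set t | cluster_state t m i j].
Proof.
case: m => [|m] /=.
  have : S [set t | exists v, named t i v /\ (valid t v /\ cluster_bit t v j)].
    apply: (sigma_exists sS) => v; apply: (sigma_and sS); first exact: named_measurable.
    rewrite /cluster_bit; case: unpickle => [[c|W]|].
    - by apply: (sigma_and sS); [exact: valid_measurable|exact: sigma_const].
    - exact: (vbit_measurable enumF_in enumF_surj sS tN dx mF).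
    - by apply: (sigma_and sS); [exact: valid_measurable|exact: sigma_const].
  apply: sigma_ext => t; split=> -[v]; first by move=> [? [? ?]]; exists v.
  by move=> [iv h]; exists v; exact: (conj iv (conj iv.1 h)).
have : S [set t | exists v v', named t i v /\ (named t j v' /\ 
    ((valid t v /\ valid t v') /\ cluster_link t m v v'))].
  apply: (sigma_exists sS) => v; apply: (sigma_exists sS) => v'.
  do 2![apply: (sigma_and sS); first exact: named_measurable].
  rewrite /cluster_link; case: unpickle => [[n c]|]; last first.
    apply: (sigma_and sS); last exact: sigma_const.
    by apply: (sigma_and sS); exact: valid_measurable.
  have : S [set t | v'.1 = c /\ ((valid t v /\ valid t v') /\
      link n v.1.1 v.1.2 (x t v.2) v'.1.1 v'.1.2 (x t v'.2))].
    apply: (sigma_and sS); first exact: sigma_const.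
    exact: (link_measurable enumF_in enumF_surj sS tN dx mF).
  by apply: sigma_ext => t; split=> [[? [? ?]]|[? [? ?]]].
apply: sigma_ext => t; split=> -[v [v']].
  by move=> [? [? [? ?]]]; exists v, v'.
by move=> [iv jv' h]; exists v, v'; exact: (conj iv (conj jv' (conj (conj iv.1 jv'.1) h))).
Qed.

End cluster_states.

(** * The theorem *)

Lemma fragment_enum (R : realType) (L : signature R) (F : fragment L) :
  exists enumF : nat -> preformula L, (forall k, frag_set F (enumF k)) /\
    (forall p, frag_set F p -> exists k, enumF k = p).
Proof.
have /countable_injP[f finj] := @frag_countable _ _ F.
have /choice[e He] : forall n, exists p, frag_set F p /\
    forall q, frag_set F q -> f q = n -> p = q.
  move=> n; have [[q [Fq fq]]|nq] := pselect (exists q, frag_set F q /\ f q = n).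
    by exists q; split => // q' Fq' fq'; apply: finj; rewrite ?inE// fq.
  exists FOne; split; first exact: frag_one.
  by move=> q Fq fq; case: nq; exists q.
exists e; split=> [k|p Fp]; first by case: (He k).
by exists (f p); apply: (He (f p)).2.
Qed.

Lemma eval_open (R : realType) (L : signature R) (T : set (preformula L * R)) (F : fragment L)
    (phi : frag_type F) (q : R) : open [set xi : Mod_space T F | q < set_val xi phi].
Proof.
pose G := [set f : {ptws frag_type F -> R} | q < f phi].
have oG : open G.
  have cphi := @proj_continuous {classic frag_type F} (fun=> R) phi.
  have o1 : open [set y : R | q < y] by exact: open_gt.
  have [h _] := continuousP (proj phi : prod_topology (fun _ : {classic frag_type F} => R) -> R).
  exact: h cphi _ o1.
exact: (@open_comp (Mod_space T F) _ set_val G (fun f _ => @initial_continuous _ _ _ f) oG).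
Qed.

Theorem corollary7p5 (R : realType) (L : signature R)
    (T : set (preformula L * R)) (F : fragment L) :
  is_theory T ->
  countable T ->
  (forall p, T p -> frag_set F p.1) ->
  (forall M : structure L, models M T -> pseudo_connected M) ->
  essentially_countable R (iso_rel T F).
Proof.
move=> _ _ TF pcT; have [enumF [enumF_in enumF_surj]] := fragment_enum F.
(* The representatives are chosen without regard to measurability, which rests only on the values of
   formulas along the sequences. *)
have /choice[Nx HNx] : forall xi : Mod_space T F, exists Nx : {N : structure L & nat -> N},
    [/\ coded_structure T (set_val xi) (projT1 Nx), models (projT1 Nx) T,
        dense_seq (projT2 Nx) & set_val xi = tp F (projT2 Nx)].
  by move=> xi; have [N [x h]] := coded_exists TF xi; exists (existT _ N x).
pose N xi := projT1 (Nx xi); pose x xi : nat -> N xi := projT2 (Nx xi).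
have dx xi : dense_seq (x xi) by case: (HNx xi).
have tN xi : tame (N xi).
  by split; [apply: pcT; case: (HNx xi)|exists (x xi)].
have sB := Borel_sigma_algebra (Mod_space T F).
have mF p : frag_set F p -> forall (s : nat -> nat) (q : R),
    Borel [set xi | q < feval (x xi \o s) p].
  (* The value at a reindexed sequence is the coordinate of [xi] at a substituted formula. *)
  move=> Fp s q; pose phi : frag_type F := exist _ _ (frag_subst (Var \o s) Fp).
  apply: sub_sigma_algebra; have := @eval_open _ _ T F phi q.
  congr open; apply/seteqP; split => xi /=;
    by have [_ _ _ ->] := HNx xi; rewrite /tp /= feval_subst.
have isoE xi eta : iso_rel T F xi eta <-> isomorphic (N xi) (N eta).
  have [cN _ _ _] := HNx xi; have [cN' _ _ _] := HNx eta.
  split=> [[M [M' [cM cM' MM']]]|h]; last by exists (N xi), (N eta).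
  apply: isomorphic_trans (coded_unique cN cM) _.
  by apply: isomorphic_trans MM' _; exact: coded_unique cM' cN'.
apply: (@essentially_countable_states _ _ _ (cluster_state enumF x)).
- by move=> m i j; exact: (cluster_state_measurable enumF_in enumF_surj tN dx sB mF).
- by move=> xi; exact: (cluster_state_determined enumF_in enumF_surj tN dx).
- by move=> xi eta /isoE; exact: (cluster_state_similar enumF_in enumF_surj tN dx).
- by move=> xi eta i j /(cluster_state_iso enumF_in enumF_surj tN dx)/isoE.
Qed.
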